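(* Let $\bar x\in\bar H$ and let $$\bar X_t=\bar T_t\bar x+\tilde Y_t+\int_0^t\bar T_{t-s}\bar A\tilde Y_s\,ds,\qquad t\ge0.$$ Then the $\bar H$-valued random variable $\bar X_t$ has distribution $Q_t^{\bar\mu}(\bar x,\cdot)$ for every $t\ge0$. In particular, if $\bar x\in JH$, then $\bar X_t\in JH$ almost surely for every $t\ge0$.
   Context: $H$ is a real separable Hilbert space with dual $H^*$ (identified with $H$), $(T_t)_{t\ge0}$ is a strongly continuous semigroup of bounded linear operators on $H$ with $\|T_t\|\le c_0e^{b_0t}$ for constants $c_0,b_0\ge0$, and $(U_\alpha)_{\alpha>b_0}$ is its resolvent. An entrance path for $(T_t)_{t\ge0}$ is a path $\tilde x=\{\tilde x(s):s>0\}$ in $H$ with $\tilde x(r+t)=T_t\tilde x(r)$ for all $r,t>0$; it is locally square integrable if $\int_0^l\|\tilde x(s)\|^2ds<\infty$ for some $l>0$. The entrance space $\tilde H$ is the set of all locally square integrable entrance paths, with inner product $\langle\tilde x,\tilde y\rangle_\sim=\int_0^\infty e^{-2bs}\langle\tilde x(s),\tilde y(s)\rangle ds$ for a fixed $b>b_0$ and norm $\|\cdot\|_\sim$; it is a separable Hilbert space. The map $J:H\to\tilde H$ is $Jx=\{T_sx:s>0\}$ (a continuous dense embedding). The strongly continuous semigroup $(\tilde T_t)_{t\ge0}$ on $\tilde H$ is $(\tilde T_t\tilde x)(s)=\tilde x(t+s)$, $s>0$. Fix $\alpha>b_0$. $\bar H$ is the completion of $\tilde H$ with respect to the norm $\|\cdot\|_-$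 of the inner product $\langle\tilde x,\tilde y\rangle_-=\int_0^\infty e^{-2bs}\langle U_\alpha\tilde x(s),U_\alpha\tilde y(s)\rangle ds$; $\tilde H$ is continuously embedded in $\bar H$, so $JH\subset\tilde H\subset\bar H$. Each $\tilde T_t$ extends uniquely to a bounded operator $\bar T_t$ on $\bar H$, and $(\bar T_t)_{t\ge0}$ is a strongly continuous semigroup on $\bar H$ with generator $\bar A$ and domain $D(\bar A)\supset\tilde H$; the restriction of $\bar A$ to $\tilde H$ is continuous from $(\tilde H,\|\cdot\|_\sim)$ to $(\bar H,\|\cdot\|_-)$. A skew convolution semigroup (SC-semigroup) on a Hilbert space $K$ associated with a semigroup $(S_t)_{t\ge0}$ of operators is a family $(\mu_t)_{t\ge0}$ of probability measures with $\mu_{r+t}=(S_t\mu_r)*\mu_t$ for all $r,t\ge0$ ($S_t\mu_r$ is the image measure, $*$ is convolution); it is centered if each $\mu_t$ has mean zero. Let $\lambda_0$ be a centered infinitely divisible probability measure on $\tilde H$ with $\int_{\tilde H}\|\tilde x\|_\sim^2\lambda_0(d\tilde x)<\infty$, and let $\tilde\psi_0$ be the continuous function on $\tilde H^*$ with $\tilde\psi_0(0)=0$ and $\int_{\tilde H}e^{i\langle\tilde x,\tilde a\rangle_\sim}\lambda_0(d\tilde x)=e^{-\tilde\psi_0(\tilde a)}$. Let $(\mu_t)_{t\ge0}$ be the centered SC-semigroup on $H$ associated with $(T_t)_{t\ge0}$ with characteristic functionals $\hat\mu_t(a)=\int_He^{i\langle x,a\rangle}\mu_t(dx)=\exp\{-\int_0^t\psi_s(a)ds\}$,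 $a\in H^*$, where $\psi_s$ is the unique continuous function on $H^*$ with $\psi_s(0)=0$ and $\exp\{-\psi_s(a)\}=\int_{\tilde H}e^{i\langle\tilde x(s),a\rangle}\lambda_0(d\tilde x)$, $s>0$. Let $\tilde\mu_t=J\mu_t$ be the image of $\mu_t$ on $\tilde H$, and let $\bar\mu_t$ be the probability measure on $\bar H$ whose restriction to $\tilde H$ is $\tilde\mu_t$; $(\bar\mu_t)_{t\ge0}$ is an SC-semigroup associated with $(\bar T_t)_{t\ge0}$. The generalized Mehler semigroup $(Q_t^{\bar\mu})_{t\ge0}$ on $\bar H$ is $Q_t^{\bar\mu}f(\bar x)=\int_{\bar H}f(\bar T_t\bar x+\bar y)\,\bar\mu_t(d\bar y)$ for bounded Borel $f$ on $\bar H$, and $Q_t^{\bar\mu}(\bar x,\cdot)$ is the corresponding kernel. $\{\tilde Y_t:t\ge0\}$ is a càdlàg $\tilde H$-valued process with $\tilde Y_0=0$ and independent increments such that for $t\ge r\ge0$ the increment $\tilde Y_t-\tilde Y_r$ has distribution $\gamma_{t-r}$ with characteristic functional $\hat\gamma_{t-r}(\tilde a)=\exp\{-(t-r)\tilde\psi_0(\tilde a)\}$, $\tilde a\in\tilde H^*$ (such a process exists). *)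

(* Defs.v *)
From HB Require Import structures.
From mathcomp Require Import all_boot all_order all_algebra.
From mathcomp Require Import all_classical all_reals all_analysis.
From mathcomp.real_closed Require Import complex.

Set Implicit Arguments.
Unset Strict Implicit.
Unset Printing Implicit Defensive.

Import Order.TTheory GRing.Theory Num.Theory.
Import numFieldNormedType.Exports.

Local Open Scope classical_set_scope.
Local Open Scope ring_scope.

HB.mixin Record NormedModule_hasInnerProduct (R : realType) V
    of NormedModule R V := {
  hdot : {dot V for (@idfun R)} ;
  hdot_norm : forall x : V, hdot x x = `|x| ^+ 2
}.

#[short(type="hilbertType")]
HB.structure Definition Hilbert (R : realType) :=
  { V of CompleteNormedModule R V & NormedModule_hasInnerProduct R V }.

Notation "''[' x , y ]" := (hdot x y) : ring_scope.

Definition separable (T : topologicalType) : Prop :=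
  exists D : set T, countable D /\ dense D.

(* The Borel sigma-algebra; the underlying type is convertible to [V]. *)
Notation borel V := (g_sigma_algebraType (@open V)).

Section complex_valued.
Context {R : realType}.

Definition cexp (z : R[i]) : R[i] :=
  ((expR (complex.Re z) * cos (complex.Im z)) +i*
   (expR (complex.Re z) * sin (complex.Im z)))%C.

Definition Cintegral d (T : measurableType d) (m : {measure set T -> \bar R})
    (D : set T) (f : T -> R[i]) : R[i] :=
  ((\int[m]_(x in D) complex.Re (f x)) +i*
   (\int[m]_(x in D) complex.Im (f x)))%C.

Definition continuousC (T : topologicalType) (f : T -> R[i]) : Prop :=
  continuous (fun x => complex.Re (f x)) /\
  continuous (fun x => complex.Im (f x)).

End complex_valued.

Section bochner_integral.
Context {R : realType} d {T : measurableType d} {V : normedModType R}.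
Variables (m : {measure set T -> \bar R}) (D : set T).

Definition simple_integrable (f : T -> V) : Prop :=
  [/\ finite_set (range f),
      forall v, measurable (f @^-1` [set v]) &
      forall v, v != 0 -> (m (D `&` f @^-1` [set v]) < +oo)%E].

(* On the level set of 0 the measure may be infinite; [fine] then gives 0. *)
Definition simple_integral (f : T -> V) : V :=
  \sum_(v \in range f) fine (m (D `&` f @^-1` [set v])) *: v.

Definition is_bochner (f : T -> V) (v : V) : Prop :=
  exists s : nat -> T -> V,
    [/\ forall n, simple_integrable (s n),
        {ae m, forall x, D x -> s n x @[n --> \oo] --> f x},
        (\int[m]_(x in D) `|f x - s n x|%:E)%E @[n --> \oo] --> (0 : \bar R) &
        simple_integral (s n) @[n --> \oo] --> v].

(* Set to 0 when [f] is not Bochner integrable on [D]. *)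
Definition bochner (f : T -> V) : V := xget 0 [set v | is_bochner f v].

End bochner_integral.

Section semigroups.
Context {R : realType} {V : normedModType R}.
Implicit Type S : R -> {linear V -> V}.

(* Only the operators [S t] with [0 <= t] are meaningful. *)
Definition C0_semigroup S : Prop :=
  [/\ forall x, S 0 x = x,
      forall s t x, 0 <= s -> 0 <= t -> S (s + t) x = S s (S t x),
      forall t, 0 <= t -> continuous (S t) &
      forall x, S t x @[t --> 0^'+] --> x].

Definition growth_bound S (c0 b0 : R) : Prop :=
  forall t x, 0 <= t -> `|S t x| <= c0 * expR (b0 * t) * `|x|.

Definition resolvent S (alpha : R) (x : V) : V :=
  bochner lebesgue_measure `[0, +oo[ (fun s => expR (- alpha * s) *: S s x).

(* [lim] is meaningful only for [x] in the domain of the generator. *)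
Definition generator S (x : V) : V :=
  lim (t^-1 *: (S t x - x) @[t --> 0^'+]).

End semigroups.

Section measures.
Context {R : realType}.

Definition is_image d1 d2 (T1 : measurableType d1) (T2 : measurableType d2)
    (m1 : set T1 -> \bar R) (f : T1 -> T2) (m2 : set T2 -> \bar R) : Prop :=
  forall B, measurable B -> m2 B = m1 (f @^-1` B).

Definition has_law d1 d2 (T1 : measurableType d1) (T2 : measurableType d2)
    (P : probability T1 R) (X : T1 -> T2) (m : set T2 -> \bar R) : Prop :=
  measurable_fun setT X /\ is_image P X m.

Context {V : hilbertType R}.

Definition char_fun (m : probability (borel V) R) (a : V) : R[i] :=
  Cintegral m setT (fun x : V => cexp (0 +i* '[x, a])%C).

Definition centered (m : probability (borel V) R) : Prop :=
  is_bochner m setT (fun x : V => x) 0.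

Definition convolution (m : set V -> \bar R) (n : probability (borel V) R) :
    set V -> \bar R :=
  fun A => (\int[n]_(y in setT) m [set x : V | A (x + (y : V))%R])%E.

Fixpoint convolution_pow (n : probability (borel V) R) (k : nat) :
    set V -> \bar R :=
  if k is k'.+1 then convolution (convolution_pow n k') n
  else dirac (0 : borel V).

Definition infinitely_divisible (m : probability (borel V) R) : Prop :=
  forall k, (0 < k)%N -> exists n : probability (borel V) R,
    forall A : set (borel V), measurable A -> m A = convolution_pow n k A.

Definition SC_semigroup (S : R -> {linear V -> V})
    (mu : R -> probability (borel V) R) : Prop :=
  forall r t, 0 <= r -> 0 <= t -> forall A : set (borel V), measurable A ->
    mu (r + t) A = convolution (fun B => mu r (S t @^-1` B)) (mu t) A.

Definition mehler (S : R -> {linear V -> V})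
    (mu : R -> probability (borel V) R) (t : R) (f : V -> R) (x : V) : R :=
  \int[mu t]_(y in setT) f (S t x + (y : V)).

Definition mehler_kernel (S : R -> {linear V -> V})
    (mu : R -> probability (borel V) R) (t : R) (x : V) (B : set V) : \bar R :=
  (mehler S mu t \1_B x)%:E.

End measures.

(* Paths on ]0, +oo[ are functions on [R] whose values outside ]0, +oo[ are
   irrelevant. *)
Section entrance.
Context {R : realType} {H : hilbertType R}.
Variable T : R -> {linear H -> H}.

Definition entrance_path (x : R -> H) : Prop :=
  forall r t, 0 < r -> 0 < t -> x (r + t) = T t (x r).

Definition loc_sq_integrable (x : R -> H) : Prop :=
  exists2 l : R, 0 < l &
    (\int[lebesgue_measure]_(s in `]0%R, l[) (`|x s| ^+ 2)%:E < +oo)%E.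

(* [ev] identifies the Hilbert space [Ht] with the entrance space: [ev x s] is
   the value at time [s] of the path [x]. *)
Definition is_entrance_space (b : R) (Ht : hilbertType R)
    (ev : Ht -> R -> H) : Prop :=
  [/\ forall x, entrance_path (ev x) /\ loc_sq_integrable (ev x),
      forall f, entrance_path f -> loc_sq_integrable f ->
        exists x, forall s, 0 < s -> ev x s = f s,
      forall x y, (forall s, 0 < s -> ev x s = ev y s) -> x = y,
      forall (c : R) x y s, 0 < s ->
        ev (c *: x + y) s = c *: ev x s + ev y s &
      forall x y, '[x, y] = \int[lebesgue_measure]_(s in `]0, +oo[)
                              (expR (- 2 * b * s) * '[ev x s, ev y s])].

(* [iota] embeds [Ht] in a completion [Hb] of [Ht] for the inner product
   < , >_- obtained from that of [Ht] by applying the resolvent. *)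
Definition is_resolvent_completion (b alpha : R) (Ht : hilbertType R)
    (ev : Ht -> R -> H) (Hb : hilbertType R) (iota : {linear Ht -> Hb}) :
    Prop :=
  dense (range iota) /\
  forall x y, '[iota x, iota y] = \int[lebesgue_measure]_(s in `]0, +oo[)
    (expR (- 2 * b * s) *
     '[resolvent T alpha (ev x s), resolvent T alpha (ev y s)]).

End entrance.

Section processes.
Context {R : realType} d {Om : measurableType d} {V : hilbertType R}.

Definition cadlag (f : R -> V) : Prop :=
  (forall t, 0 <= t -> f s @[s --> t^'+] --> f t) /\
  (forall t, 0 < t -> cvg (f s @[s --> t^'-])).

Definition independent_increments (P : probability Om R) (Y : R -> Om -> V) :
    Prop :=
  forall (n : nat) (t : nat -> R) (B : nat -> set (borel V)),
    0 <= t 0%N -> (forall i, (i < n)%N -> t i <= t i.+1) ->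
    (forall i, (i < n)%N -> measurable (B i)) ->
    P [set w | forall i, (i < n)%N -> B i (Y (t i.+1) w - Y (t i) w)] =
    (\prod_(i < n) P [set w | B i (Y (t i.+1) w - Y (t i) w)%R])%E.

End processes.

(* Main.v *)
(* Fix a in Hb and let theta s in Ht represent x |-> <Tb s (iota x), a>.  The
   resolvent smooths: |iota (Tt h x) - iota x| <= K h |x|, so theta is locally
   Lipschitz, iota Ht lies in the domain of the generator, and the integrand of
   the Bochner integral is the bounded limit of
   Tb (t - s') ((Tb h - 1) / h) iota (Y s'), where s' is the grid point of mesh
   h = t / n following s.  Pairing the integral of these step functions with a
   and summing by parts turns <iota (Y t) + integral, a> into the limit of
   sum_i <Y ((i+1) h) - Y (i h), theta (t - i h)>, whose characteristic functional
   is, by independence, exp(- sum_i h psi0 (theta (t - i h))).  It converges to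
   exp(- int_0^t psi0 (theta s) ds).  If c in H represents x |-> <iota (J x), a>,
   then <ev x s, c> = <x, theta s> because J (ev x s) = Tt s x, hence
   psi s c = psi0 (theta s) by uniqueness of continuous logarithms, and the limit
   is the characteristic functional of mub t at a.  Characteristic functionals
   determine Borel probabilities on a separable Hilbert space.  For the second
   claim, mub t lives on iota (J H), a countable union of images of closed balls,
   which are closed, and Tb t maps this space to itself. *)
Require Import Defs.
From HB Require Import structures.
From mathcomp Require Import all_boot all_order all_algebra.
From mathcomp Require Import all_classical all_reals all_analysis.
From mathcomp Require Import measurable_realfun.
From mathcomp.real_closed Require Import complex.
From mathcomp Require Import ring lra.

Set Implicit Arguments.
Unset Strict Implicit.
Unset Printing Implicit Defensive.

Import Order.TTheory GRing.Theory Num.Theory.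
Import numFieldNormedType.Exports.

Local Open Scope classical_set_scope.
Local Open Scope ring_scope.

(** * Hilbert spaces *)

Section normed.
Context {R : realType}.

(** [bochner] and [generator] are choice operators with default values, so each use first requires
    existence. For the integral, Riesz's theorem supplies a vector with the right scalar integrals,
    dominated step functions show that it is a Bochner value, and uniqueness identifies it with the
    chosen one. For the generator, the difference quotients are only shown to be Cauchy on the range
    of [iota]; the limit exists by completeness and is never computed.

    Before the limit everything is a finite sum of increments of [Y] over a grid. This is the form
    in which independence is assumed, and the same sums yield measurability of the integral term.
    The integrand is sampled at the right end of each cell because a cadlag path converges along
    such points at every time, jump times included.

    Equality of exponents needs care: equal characteristic functionals give equal exponents only up
    to multiples of [2 i pi], and continuity along rays from the origin removes the ambiguity. *)

Lemma cvg_sub0_norm {V : normedModType R} {T : Type} (F : set_system T) {FF : Filter F}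
    (u : T -> V) (l : V) :
  (`|u x - l| @[x --> F] --> 0) -> u x @[x --> F] --> l.
Proof.
move=> h; apply/cvgrPdist_lt => e e0.
move/cvgrPdist_lt : h => /(_ e e0); apply: filterS => x.
by rewrite sub0r normrN normr_id distrC.
Qed.

Lemma cvg_norm_le0 {V : normedModType R} {T : Type} (F : set_system T) {FF : Filter F}
    (u : T -> V) (l : V) (e : T -> R) :
  (\forall x \near F, `|u x - l| <= e x) -> e x @[x --> F] --> 0 ->
  u x @[x --> F] --> l.
Proof.
move=> h e0; apply/cvgrPdist_lt => r r0.
move/cvgrPdist_lt : e0 => /(_ r r0); apply: filterS2 h => x.
rewrite sub0r normrN => h /(le_lt_trans (ler_norm _)) h2.
by rewrite distrC (le_lt_trans h).
Qed.

Lemma cvgn_dist_le {V : completeNormedModType R} (u : nat -> V) (e : nat -> R) :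
  (forall n m, (n <= m)%N -> `|u n - u m| <= e n) ->
  e n @[n --> \oo] --> 0 -> cvgn u.
Proof.
move=> h e0; apply/cauchy_cvgP/cauchyP => r r0.
move/cvgrPdist_lt : e0 => /(_ r r0) [N _ HN].
exists (u N); exists N => // n /= Nn; rewrite -ball_normE /=.
apply: (le_lt_trans (h _ _ Nn)).
by have := HN N (leqnn N); rewrite sub0r normrN; apply: le_lt_trans (ler_norm _).
Qed.

Lemma invn_gt0 (n : nat) : 0 < n.+1%:R^-1 :> R.
Proof. by rewrite invr_gt0 ltr0n. Qed.

Lemma cvgn_inv_nat : (n.+1%:R^-1 : R) @[n --> \oo] --> 0.
Proof. exact: cvg_harmonic. Qed.

End normed.

Section hilbert.
Context {R : realType} {V : hilbertType R}.
Implicit Types x y z : V.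

Lemma hdotDl x y z : '[x + y, z] = '[x, z] + '[y, z].
Proof. exact: linearDl. Qed.
Lemma hdotDr x y z : '[z, x + y] = '[z, x] + '[z, y].
Proof. exact: linearDr. Qed.
Lemma hdotBl x y z : '[x - y, z] = '[x, z] - '[y, z].
Proof. exact: linearBl. Qed.
Lemma hdotBr x y z : '[z, x - y] = '[z, x] - '[z, y].
Proof. exact: linearBr. Qed.
Lemma hdotZl c x z : '[c *: x, z] = c * '[x, z].
Proof. exact: linearZl_LR. Qed.
Lemma hdotZr c x z : '[z, c *: x] = c * '[z, x].
Proof. exact: linearZr_LR. Qed.
Lemma hdot0l x : '[0, x] = 0 :> R.
Proof. exact: linear0l. Qed.
Lemma hdot0r x : '[x, 0] = 0 :> R.
Proof. exact: linear0r. Qed.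
Lemma hdotNl x z : '[- x, z] = - '[x, z].
Proof. exact: linearNl. Qed.
Lemma hdotC x y : '[x, y] = '[y, x].
Proof. by have := hermC hdot x y; rewrite expr0 mul1r. Qed.

Lemma hdot_suml (I : Type) (r : seq I) (F : I -> V) z :
  '[\sum_(i <- r) F i, z] = \sum_(i <- r) '[F i, z].
Proof.
by elim/big_rec2: _ => [|i a b _ <-]; rewrite ?hdot0l ?hdotDl.
Qed.

Lemma normD_hilbert x y : `|x + y| ^+ 2 = `|x| ^+ 2 + 2 * '[x, y] + `|y| ^+ 2.
Proof. by rewrite -!hdot_norm hdotDl !hdotDr (hdotC y x); ring. Qed.

Lemma normB_hilbert x y : `|x - y| ^+ 2 = `|x| ^+ 2 - 2 * '[x, y] + `|y| ^+ 2.
Proof. by rewrite -!hdot_norm hdotBl !hdotBr (hdotC y x); ring. Qed.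

Lemma hdot_CauchySchwarz x y : `|'[x, y]| <= `|x| * `|y|.
Proof.
have [->|y0] := eqVneq y 0; first by rewrite hdot0r !normr0 mulr0.
have yp : 0 < `|y| ^+ 2 by rewrite exprn_gt0 // normr_gt0.
rewrite -ler_sqr ?nnegrE ?mulr_ge0 // exprMn -normrX ger0_norm ?sqr_ge0 //.
rewrite -ler_pdivrMr // -subr_ge0.
have := normB_hilbert x (('[x, y] / `|y| ^+ 2) *: y).
rewrite hdotZr normrZ exprMn real_normK ?num_real //.
suff -> : `|x| ^+ 2 - 2 * ('[x, y] / `|y| ^+ 2 * '[x, y]) +
  ('[x, y] / `|y| ^+ 2) ^+ 2 * `|y| ^+ 2 = `|x| ^+ 2 - '[x, y] ^+ 2 / `|y| ^+ 2.
  by move=> <-; rewrite sqr_ge0.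
by field; rewrite normr_eq0.
Qed.

Lemma hdot_inj x y : (forall a, '[x, a] = '[y, a]) -> x = y.
Proof.
move=> h; apply/eqP; rewrite -subr_eq0 -normr_eq0 -sqrf_eq0 -hdot_norm.
by rewrite hdotBl h subrr.
Qed.

(** Tested at [a = x]. This is how norm bounds are obtained for vectors known only through their
    pairings, such as integrals. *)
Lemma norm_le_hdot x (C : R) : 0 <= C -> (forall a, '[x, a] <= C * `|a|) -> `|x| <= C.
Proof.
move=> C0 h; have [->|x0] := eqVneq x 0; first by rewrite normr0.
have := h x; rewrite hdot_norm expr2 ler_pM2r // normr_gt0 //.
Qed.

Lemma hdot_continuousl a : continuous (fun x : V => '[x, a] : R).
Proof.
move=> x; apply: (@cvg_norm_le0 R R^o _ _ _ _ _ (fun y => `|y - x| * `|a|)).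
  by apply: nearW => y; rewrite -hdotBl hdot_CauchySchwarz.
rewrite -(mul0r `|a|); apply: cvgMl.
rewrite -(@normr0 _ V) -(subrr x); apply: cvg_norm; apply: cvgB => //.
exact: cvg_cst.
Qed.

Lemma cvg_hdotl {T : Type} (F : set_system T) {FF : Filter F} (u : T -> V) x a :
  u t @[t --> F] --> x -> '[u t, a] @[t --> F] --> '[x, a].
Proof.
by move=> h; apply: (@continuous_cvg _ _ _ _ _ _ (fun x : V => '[x, a] : R) x) => //; exact: hdot_continuousl.
Qed.

Lemma norm_midpoint x y :
  `|x - y| ^+ 2 =
  2 * `|x| ^+ 2 + 2 * `|y| ^+ 2 - 4 * `|2^-1 *: (x + y)| ^+ 2.
Proof.
rewrite normrZ exprMn normB_hilbert normD_hilbert real_normK ?num_real //.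
by field.
Qed.

(* By the parallelogram law, points of [C n] of nearly minimal norm form a Cauchy
   sequence; this replaces weak compactness of bounded convex sets. *)
Lemma nested_midconvex_cvg (C : nat -> set V) (r : R) :
  (forall n, C n !=set0) -> (forall n, C n.+1 `<=` C n) ->
  (forall n x y, C n x -> C n y -> C n (2^-1 *: (x + y))) ->
  (forall x, C 0%N x -> `|x| <= r) ->
  exists u : nat -> V, (forall n, C n (u n)) /\ cvgn u.
Proof.
move=> C0 CS Cm Cr.
have Cle n m : (n <= m)%N -> C m `<=` C n.
  move=> /subnK <-; elim: (m - n)%N => [|k ih]; first by rewrite add0n.
  by rewrite addSn => x /CS /ih.
pose D n := [set `|x| ^+ 2 | x in C n].
pose d n := inf (D n).
have Dne n : D n !=set0 by have [x Cx] := C0 n; exists (`|x| ^+ 2); exists x.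
have Dlb n : lbound (D n) 0 by move=> _ [x _ <-]; rewrite sqr_ge0.
have Dinf n : has_inf (D n) by split => //; exists 0.
have dle n x : C n x -> d n <= `|x| ^+ 2.
  by move=> Cx; apply: ge_inf; [exists 0 | exists x].
have dmono n m : (n <= m)%N -> d n <= d m.
  by move=> nm; apply: lb_le_inf => // _ [x Cx <-]; apply: dle; exact: Cle Cx.
have dub n : d n <= r ^+ 2.
  have [x Cx] := C0 n; apply: (le_trans (dle _ _ Cx)).
  have xr := Cr _ (Cle _ _ (leq0n n) _ Cx).
  by rewrite lerXn2r // nnegrE (le_trans (normr_ge0 x)).
have dcvg : cvgn d.
  by apply: nondecreasing_is_cvgn => //; exists (r ^+ 2) => _ [n _ <-].
have dlim n : d n <= limn d by exact: nondecreasing_cvgn_le.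
have H n : exists x, C n x /\ `|x| ^+ 2 < d n + n.+1%:R^-1.
  have [_ [x Cx <-] h] := inf_adherent (invn_gt0 n) (Dinf n).
  by exists x.
pose u n := projT1 (cid (H n)).
have uC n : C n (u n) := proj1 (projT2 (cid (H n))).
have ud n : `|u n| ^+ 2 < d n + n.+1%:R^-1 := proj2 (projT2 (cid (H n))).
exists u; split => //.
(* For [n <= m] the midpoint of [u n] and [u m] lies in [C n], so its squared norm is at least
   [d n]. The parallelogram law leaves [2 (d m - d n)] plus the two adherence errors, and
   [d m <= limn d]. *)
pose e n := 2 * (limn d - d n) + 4 * n.+1%:R^-1.
have e0 : e n @[n --> \oo] --> 0.
  rewrite (_ : 0 = 2 * (limn d - limn d) + 4 * 0); last by rewrite subrr !mulr0 addr0.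
  apply: cvgD; apply: cvgMr; last exact: cvgn_inv_nat.
  by apply: cvgB => //; exact: cvg_cst.
apply: (@cvgn_dist_le _ _ _ (fun n => Num.sqrt (e n))) => [n m nm|].
  rewrite -[X in X <= _](@ger0_norm R) // -sqrtr_sqr ler_wsqrtr //.
  rewrite norm_midpoint.
  have h1 := ud n; have h2 := ud m.
  have h3 := dle _ _ (Cm _ _ _ (uC n) (Cle _ _ nm _ (uC m))).
  have h4 := dmono _ _ nm.
  have h5 : m.+1%:R^-1 <= n.+1%:R^-1 :> R by rewrite lef_pV2 ?posrE ?ltr0n // ler_nat.
  have h6 := dlim m.
  rewrite /e; set a := n.+1%:R^-1 in h1 h5 *; set c := m.+1%:R^-1 in h2 h5; clearbody a c; lra.
by rewrite -(@sqrtr0 R); apply: (continuous_cvg _ (@sqrt_continuous R _)).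
Qed.

(** Variational proof: the minimizer of [|x|^2 - 2 f x] represents [f]. The sublevel sets are closed
    under midpoints, so a minimizing sequence can be chosen convergent. *)
Lemma riesz_representation (f : V -> R) (C : R) :
  (forall x y, f (x + y) = f x + f y) -> (forall c x, f (c *: x) = c * f x) ->
  (forall x, `|f x| <= C * `|x|) -> exists z, forall x, f x = '[x, z].
Proof.
move=> fD fZ fC.
have fN x : f (- x) = - f x by rewrite -scaleN1r fZ mulN1r.
have C0 : 0 <= `|C| by [].
have {}fC x : `|f x| <= `|C| * `|x|.
  by apply: (le_trans (fC _)); rewrite ler_wpM2r // ler_norm.
pose I x := `|x| ^+ 2 - 2 * f x.
have Imid x y : I (2^-1 *: (x + y)) <= 2^-1 * (I x + I y).
  have := norm_midpoint x y; have := sqr_ge0 `|x - y|.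
  rewrite /I fZ fD; lra.
have Ige x : `|x| ^+ 2 - 2 * `|C| * `|x| <= I x.
  rewrite /I lerD2l lerN2 -mulrA ler_pM2l //.
  by apply: le_trans (ler_norm _) (fC _).
have Ilb : lbound (range I) (- `|C| ^+ 2).
  move=> _ [x _ <-]; apply: le_trans (Ige x).
  by have := sqr_ge0 (`|x| - `|C|); rewrite sqrrB; lra.
have Iinf : has_inf (range I) by split; [exists (I 0); exists 0 | exists (- `|C| ^+ 2)].
pose m := inf (range I).
have mI x : m <= I x by apply: ge_inf; [exists (- `|C| ^+ 2) | exists x].
pose K n := [set x | I x <= m + n.+1%:R^-1].
have [u [uK uc]] : exists u : nat -> V, (forall n, K n (u n)) /\ cvgn u.
  (* The radius: on the first sublevel set [|x|^2 - 2 |C| |x| <= m + 1], which fails once [|x|]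
     exceeds [2 |C| + |m| + 2]. *)
  apply: (@nested_midconvex_cvg _ (2 * `|C| + `|m| + 2)).
  - move=> n.
    have [_ [x _ <-] /ltW h] := inf_adherent (invn_gt0 n) Iinf.
    by exists x.
  - move=> n x; rewrite /K /= => /le_trans; apply; rewrite lerD2l.
    by rewrite lef_pV2 ?posrE ?ltr0n // ler_nat.
  - move=> n x y; rewrite /K /= => hx hy; apply: (le_trans (Imid _ _)).
    set a := n.+1%:R^-1 in hx hy *; clearbody a; lra.
  - move=> x; rewrite /K /= invr1 => h; have {}h := le_trans (Ige x) h.
    rewrite leNgt; apply/negP => h2.
    have h1 := ler_norm m; have m0 : 0 <= `|m| by [].
    have h3 : 0 <= `|x| by [].
    nra.
exists (limn u) => y.
have fu : f (u n) @[n --> \oo] --> f (limn u).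
  apply: (@cvg_norm_le0 R R^o _ _ _ _ _ (fun n => `|C| * `|u n - limn u|)).
    by apply: nearW => n; rewrite -fN -fD.
  rewrite -(mulr0 `|C|); apply: cvgMr.
  rewrite -(@normr0 _ V) -(subrr (limn u)); apply: cvg_norm; apply: cvgB => //.
  exact: cvg_cst.
have Iu : I (u n) @[n --> \oo] --> I (limn u).
  by apply: cvgB; [rewrite expr2; under eq_fun do rewrite expr2; apply: cvgM; apply: cvg_norm | apply: cvgMr].
have Im : I (limn u) <= m.
  rewrite -(addr0 m); apply: (ler_cvg_to Iu (cvgD (cvg_cst m) cvgn_inv_nat)).
  by apply: nearW => n; exact: uK.
set z := limn u in Im *.
(* Minimality against [z + t *: y]. The value of [t] chosen below is the vertex of this quadratic,
   where it equals minus a square; the square must vanish. *)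
have key t : 0 <= t ^+ 2 * `|y| ^+ 2 + 2 * t * ('[z, y] - f y).
  have := le_trans Im (mI (z + t *: y)).
  rewrite /I normD_hilbert fD fZ hdotZr normrZ exprMn real_normK ?num_real //.
  lra.
have [y0|y0] := eqVneq y 0.
  by rewrite y0 hdot0l -(scale0r 0) fZ mul0r.
have yp : 0 < `|y| ^+ 2 by rewrite exprn_gt0 // normr_gt0.
have := key (- ('[z, y] - f y) / `|y| ^+ 2).
rewrite expr_div_n sqrrN expr2 mulrAC.
set D := '[z, y] - f y.
rewrite (_ : _ + _ = - (D ^+ 2 / `|y| ^+ 2)); last by field; rewrite normr_eq0.
rewrite oppr_ge0 pmulr_lle0 ?invr_gt0 // => D2.
have /eqP : D ^+ 2 = 0 by apply/eqP; rewrite eq_le D2 sqr_ge0.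
by rewrite sqrf_eq0 subr_eq0 hdotC => /eqP ->.
Qed.

End hilbert.

Section images.
Context {R : realType} {V W : hilbertType R}.

(** Points of the ball whose images lie within [1 / (n + 1)] of [y] form a nested midconvex sequence
    of sets; a convergent selection has its limit in the ball, and [L] sends that limit to [y]. *)
Lemma closed_image_ball (L : V -> W) (C r : R) :
  (forall x y, L (x + y) = L x + L y) -> (forall c x, L (c *: x) = c *: L x) ->
  (forall x, `|L x| <= C * `|x|) ->
  closed [set L x | x in [set x : V | `|x| <= r]].
Proof.
move=> LD LZ LC y yc.
pose K n := [set x : V | `|x| <= r /\ `|L x - y| <= n.+1%:R^-1].
have [u [uK uc]] : exists u : nat -> V, (forall n, K n (u n)) /\ cvgn u.
  apply: (@nested_midconvex_cvg _ _ _ r).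
  - move=> n; have n0 : 0 < n.+1%:R^-1 :> R by rewrite invr_gt0 ltr0n.
    have [_ [[x xr <-] h]] := yc _ (nbhsx_ballx y _ n0).
    exists x; split => //; move: h; rewrite -ball_normE /= distrC; exact: ltW.
  - move=> n x [xr xn]; split => //; apply: (le_trans xn).
    by rewrite lef_pV2 ?posrE ?ltr0n // ler_nat.
  - move=> n x z [xr xn] [zr zn]; split.
      rewrite normrZ ger0_norm //; have := ler_normD x z; lra.
    have -> : L (2^-1 *: (x + z)) - y = 2^-1 *: ((L x - y) + (L z - y)).
      rewrite LZ LD addrACA -opprD scalerBr; congr (_ - _).
      by rewrite -[y in y + y]scale1r -scalerDl scalerA mulVf ?scale1r // (natrD _ 1 1).
    rewrite normrZ ger0_norm //; have := ler_normD (L x - y) (L z - y).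
    set a := n.+1%:R^-1 in xn zn *; clearbody a; lra.
  - by move=> x [].
exists (limn u).
  have : `|u n| @[n --> \oo] --> `|limn u| by exact: cvg_norm.
  by move=> /(ler_cvg_to)/(_ (cvg_cst r)); apply; apply: nearW => n; case: (uK n).
have LN x : L (- x) = - L x by rewrite -scaleN1r LZ scaleN1r.
have h1 : L (u n) @[n --> \oo] --> L (limn u).
  apply: (@cvg_norm_le0 R W _ _ _ _ _ (fun n => C * `|u n - limn u|)).
    by apply: nearW => n; rewrite -LN -LD.
  rewrite -(mulr0 C); apply: cvgMr.
  rewrite -(@normr0 _ V) -(subrr (limn u)); apply: cvg_norm; apply: cvgB => //.
  exact: cvg_cst.
have h2 : L (u n) @[n --> \oo] --> y.
  apply: (@cvg_norm_le0 R W _ _ _ _ _ (fun n => n.+1%:R^-1)); last exact: cvgn_inv_nat.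
  by apply: nearW => n; case: (uK n).
exact: (cvg_unique _ h1 h2).
Qed.

End images.

(** * Expectations and characteristic functionals *)

Section real_integrals.
Context {R : realType} {d : measure_display} {T : measurableType d}.
Variable (m : {measure set T -> \bar R}).

Lemma integrable_dominated (D : set T) (f g : T -> R) : measurable D ->
  measurable_fun D f -> (forall x, D x -> `|f x| <= g x) ->
  m.-integrable D (EFin \o g) -> m.-integrable D (EFin \o f).
Proof.
move=> mD mf fg; apply: le_integrable => //; first exact/measurable_EFinP.
move=> x Dx /=; rewrite lee_fin; apply: le_trans (fg _ Dx) _; exact: ler_norm.
Qed.

Lemma bounded_integrable (D : set T) (f : T -> R) (C : R) : measurable D ->
  (m D < +oo)%E -> measurable_fun D f -> (forall x, D x -> `|f x| <= C) ->
  m.-integrable D (EFin \o f).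
Proof.
move=> mD Dfin mf fC; apply: measurable_bounded_integrable => //.
exists C; split; first exact: num_real.
by move=> M CM x Dx /=; apply: le_trans (fC _ Dx) (ltW CM).
Qed.

Lemma Rdominated_convergence (D : set T) (f_ : nat -> T -> R) (f g : T -> R) :
  measurable D -> (forall n, measurable_fun D (f_ n)) ->
  (forall x, D x -> f_ n x @[n --> \oo] --> f x) ->
  m.-integrable D (EFin \o g) ->
  (forall n x, D x -> `|f_ n x| <= g x) ->
  [/\ m.-integrable D (EFin \o f),
    (\int[m]_(x in D) `|f_ n x - f x|%:E)%E @[n --> \oo] --> (0 : \bar R)
    & (\int[m]_(x in D) f_ n x) @[n --> \oo] --> \int[m]_(x in D) f x].
Proof.
move=> mD mf_ f_f ig f_g.
have mf : measurable_fun D f by exact: measurable_fun_cvg mf_ f_f.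
have [] := @dominated_convergence _ _ _ m D mD (fun n => EFin \o f_ n) (EFin \o f) (EFin \o g) _ _ _ ig _.
- by move=> n; exact/measurable_EFinP.
- exact/measurable_EFinP.
- by apply: aeW => x Dx; apply: cvg_EFin; [exact: nearW | exact: f_f].
- by apply: aeW => x n Dx /=; rewrite lee_fin f_g.
move=> intf h1 h2; split => //.
have fi : (\int[m]_(x in D) (f x)%:E)%E \is a fin_num by exact: integrable_fin_num.
apply: fine_cvg; rewrite fineK //.
Qed.

Lemma Rintegral_sum (D : set T) (I : Type) (s : seq I) (f : I -> T -> R) :
  measurable D -> (forall i, m.-integrable D (EFin \o f i)) ->
  \int[m]_(x in D) (\sum_(i <- s) f i x) = \sum_(i <- s) \int[m]_(x in D) f i x.
Proof.
move=> mD fi; elim: s => [|i s ih].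
  under eq_Rintegral do rewrite big_nil.
  by rewrite big_nil Rintegral_cst // mul0r.
rewrite big_cons -ih -RintegralD //.
  by apply: eq_Rintegral => x _; rewrite big_cons.
have := @integrable_sum _ _ _ m D mD I s xpredT (fun i => EFin \o f i) (fun i _ => fi i).
by apply: eq_integrable => // x _ /=; rewrite sumEFin.
Qed.

End real_integrals.

Section expectation.
Context {R : realType} {d : measure_display} {T : measurableType d}.
Implicit Types (P : probability T R) (f g : T -> R).

Definition bmeas f := measurable_fun setT f /\ exists C, forall x, `|f x| <= C.

Lemma bmeas_cst c : bmeas (fun=> c).
Proof. by split => //; exists `|c|. Qed.

Lemma bmeasD f g : bmeas f -> bmeas g -> bmeas (fun x => f x + g x).
Proof.
move=> [mf [C fC]] [mg [B gB]]; split; first exact: measurable_funD.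
by exists (C + B) => x; apply: le_trans (ler_normD _ _) (lerD _ _).
Qed.

Lemma bmeasM f g : bmeas f -> bmeas g -> bmeas (fun x => f x * g x).
Proof.
move=> [mf [C fC]] [mg [B gB]]; split; first exact: measurable_funM.
by exists (C * B) => x; rewrite normrM ler_pM.
Qed.

Lemma bmeasZ c f : bmeas f -> bmeas (fun x => c * f x).
Proof. exact/bmeasM/bmeas_cst. Qed.

Lemma bmeasN f : bmeas f -> bmeas (fun x => - f x).
Proof. by move=> /(bmeasZ (-1)); under eq_fun do rewrite mulN1r. Qed.

Lemma bmeasB f g : bmeas f -> bmeas g -> bmeas (fun x => f x - g x).
Proof. by move=> bf /bmeasN; exact: bmeasD. Qed.

Lemma bmeas_indic A : measurable A -> bmeas (\1_A : T -> R).
Proof.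
move=> mA; split; first exact: measurable_indic.
by exists 1 => x; rewrite indicE; case: (_ \in _); rewrite ?normr1 ?normr0.
Qed.

Lemma bmeas_comp (h : R -> R) f : continuous h -> (exists C, forall x, `|h x| <= C) ->
  measurable_fun setT f -> bmeas (fun x => h (f x)).
Proof.
move=> ch [C hC] mf; split; last by exists C.
by apply: measurableT_comp => //; exact: continuous_measurable_fun.
Qed.

Lemma bmeas_cos f : measurable_fun setT f -> bmeas (fun x => cos (f x)).
Proof. by apply: bmeas_comp; [exact: continuous_cos | exists 1 => x; rewrite ler_norml cos_geN1 cos_le1]. Qed.

Lemma bmeas_sin f : measurable_fun setT f -> bmeas (fun x => sin (f x)).
Proof. by apply: bmeas_comp; [exact: continuous_sin | exists 1 => x; rewrite ler_norml sin_geN1 sin_le1]. Qed.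

Variable P : probability T R.
Local Notation "'E f" := (\int[P]_(x in setT) f x) (at level 10, f at level 8).

Lemma bmeas_integrable f : bmeas f -> P.-integrable setT (EFin \o f).
Proof.
move=> [mf [C fC]]; apply: (@bounded_integrable _ _ _ _ _ _ C) => //.
by rewrite [X in (X < _)%E](@probability_setT _ _ _ P) ltry.
Qed.

Lemma expectD f g : bmeas f -> bmeas g ->
  'E (fun x => f x + g x) = 'E f + 'E g.
Proof. by move=> bf bg; rewrite RintegralD //; exact: bmeas_integrable. Qed.

Lemma expectB f g : bmeas f -> bmeas g ->
  'E (fun x => f x - g x) = 'E f - 'E g.
Proof. by move=> bf bg; rewrite RintegralB //; exact: bmeas_integrable. Qed.

Lemma expectZ c f : bmeas f -> 'E (fun x => c * f x) = c * 'E f.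
Proof. by move=> bf; rewrite RintegralZl //; exact: bmeas_integrable. Qed.

Lemma expect_cst c : 'E (fun=> c) = c.
Proof. by rewrite Rintegral_cst // [X in fine X](@probability_setT _ _ _ P) mulr1. Qed.

Lemma expect_indic A : measurable A -> 'E (\1_A : T -> R) = fine (P A).
Proof. by move=> mA; rewrite /Rintegral integral_indic // setIT. Qed.

Lemma expect_cvg (f_ : nat -> T -> R) f C :
  (forall n, measurable_fun setT (f_ n)) -> (forall n x, `|f_ n x| <= C) ->
  (forall x, f_ n x @[n --> \oo] --> f x) ->
  'E (f_ n) @[n --> \oo] --> 'E f.
Proof.
move=> mf fC ff.
have [] := @Rdominated_convergence _ _ _ P setT f_ f (fun=> C) => //.
exact/bmeas_integrable/bmeas_cst.
Qed.

Lemma bmeas_cvg (f_ : nat -> T -> R) f C :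
  (forall n, measurable_fun setT (f_ n)) -> (forall n x, `|f_ n x| <= C) ->
  (forall x, f_ n x @[n --> \oo] --> f x) -> bmeas f.
Proof.
move=> mf fC ff; split; first exact: measurable_fun_cvg mf _.
exists C => x; have h : `|f_ n x| @[n --> \oo] --> `|f x| by exact: cvg_norm.
by apply: (ler_cvg_to h (cvg_cst C)); exact: nearW.
Qed.

End expectation.

(** * Borel sets of a separable Hilbert space *)

Section borel_hilbert.
Context {R : realType}.

Lemma continuous_borel_measurable (V : hilbertType R) (f : V -> R) :
  continuous f -> measurable_fun setT (f : borel V -> R).
Proof.
move=> /continuousP cf; apply: (measurability _ (RGenOpens.measurableE R)).
move=> _ [_ [a [b ->] <-]]; rewrite setTI; apply: sub_sigma_algebra.
by apply: cf; exact: interval_open.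
Qed.

Lemma continuous_borelT_measurable (V W : hilbertType R) (f : V -> W) :
  continuous f -> measurable_fun setT (f : borel V -> borel W).
Proof.
move=> /continuousP cf.
apply: (@measurability _ _ (borel V) (borel W) setT f (@open W)) => //.
move=> _ [A oA <-]; rewrite setTI; apply: sub_sigma_algebra.
exact: cf.
Qed.

Lemma hdot_borel_measurable (V : hilbertType R) (a : V) :
  measurable_fun setT ((fun x : V => '[x, a]) : borel V -> R).
Proof. by apply: continuous_borel_measurable; exact: hdot_continuousl. Qed.

Lemma separable_seq (V : hilbertType R) : separable V ->
  exists u : nat -> V, forall (x : V) (e : R), 0 < e -> exists n, `|x - u n| < e.
Proof.
move=> [D [cD dD]].
have [x0 Dx0] : exists x, D x.
  have [x [_ Dx]] := dD setT (ex_intro _ 0 I) openT; by exists x.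
have D0 : D !=set0 by exists x0.
have /(pfcard_geP) [/eqP|[f]] : (D #<= [set: nat])%card by [].
  by move=> /eqP D0'; move: Dx0; rewrite D0'.
exists f => x e e0.
have [y [xy Dy]] := dD (ball x e) (ex_intro _ x (ballxx x e0)) (ball_open x e).
have [n _ fn] := 'surj_f Dy.
by exists n; rewrite fn; move: xy; rewrite -ball_normE.
Qed.

(** A closed ball about [u n] is the intersection of countably many half-spaces with normals among
    the [u k], and an open set is a countable union of such balls. Stated for any sigma-algebra [S],
    to serve both for measurability of maps and for uniqueness of measures. *)
Lemma open_in_halfspaces (V : hilbertType R) (S : set (set V)) (A : set V) :
  separable V -> sigma_algebra setT S ->
  (forall a c, S [set x | '[x, a] < c]) -> open A -> S A.
Proof.
move=> sV [S0 SC SU] SH oA.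
have [u du] := separable_seq sV.
have SCC B : S B -> S (~` B) by move=> /SC; rewrite setTD.
have SI (F : nat -> set V) : (forall n, S (F n)) -> S (\bigcap_n F n).
  move=> SF; rewrite -[\bigcap_n _]setCK setC_bigcap; apply: (SCC); apply: SU => n.
  exact/SCC/SF.
have Sball n (r : R) : 0 <= r -> S [set x | `|x - u n| <= r].
  move=> r0.
  have E x k : (~` [set x | '[x, - u k] < '[u n, - u k] - r * `|u k|]) x <->
      '[x - u n, u k] <= r * `|u k|.
    rewrite /= !(hdotC _ (- _)) !hdotNl !(hdotC (u k)) hdotBl.
    by split => [/negP|h]; [rewrite -leNgt => ?; lra|apply/negP; rewrite -leNgt; lra].
  have -> : [set x | `|x - u n| <= r] =
     \bigcap_k (~` [set x | '[x, - u k] < '[u n, - u k] - r * `|u k|]).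
    apply/seteqP; split => x.
      move=> /= xr k _; apply/E.
      apply: le_trans (ler_norm _) (le_trans (hdot_CauchySchwarz _ _) _).
      by rewrite ler_wpM2r.
    (* If [|x - u n| > r], a [u k] closer than [(|y| - r) / 2] to [y = x - u n] is a normal whose
       half-space excludes [x]. *)
    move=> h /=; rewrite leNgt; apply/negP => rx.
    have {}h k : '[x - u n, u k] <= r * `|u k| by apply/E/h.
    set y := x - u n in rx h.
    have e0 : 0 < (`|y| - r) / 2 by lra.
    have [k ky] := du y _ e0.
    have h1 := h k.
    have h2 : '[y, u k] = `|y| ^+ 2 - '[y, y - u k] by rewrite hdotBr hdot_norm subKr.
    have h3 := le_trans (ler_norm _) (hdot_CauchySchwarz y (y - u k)).
    have h4 : `|u k| <= `|y| + `|y - u k|.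
      by rewrite -{1}(subKr y (u k)); apply: le_trans (ler_normB _ _) _.
    have h5 : 0 <= `|y - u k| by [].
    set p := `|y| in e0 rx h2 h3 h4 ky; set q := `|y - u k| in h3 h4 h5 ky.
    set w := `|u k| in h1 h4; set z := '[y, u k] in h1 h2; clearbody p q w z.
    nra.
  by apply: SI => k; apply: SCC; exact: SH.
pose B n k := if `[< [set x | `|x - u n| <= k.+1%:R^-1] `<=` A >]
  then [set x | `|x - u n| <= k.+1%:R^-1] else set0.
have -> : A = \bigcup_n \bigcup_k B n k.
  apply/seteqP; split => x.
    move=> Ax; have /nbhs_ballP[e /= e0 xe] := open_nbhs_nbhs (conj oA Ax).
    have e2 : 0 < e / 2 by lra.
    have [k ke] : exists k : nat, k.+1%:R^-1 < e / 2.
      move/cvgrPdist_lt : (@cvgn_inv_nat R) => /(_ _ e2) [k _ /(_ k (leqnn k))].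
      by rewrite sub0r normrN ger0_norm ?invr_ge0 //= => ke; exists k.
    have [n nx] := du x _ (invn_gt0 k).
    exists n => //; exists k => //; rewrite /B; case: asboolP => [_|] /=; first exact: ltW.
    case=> y /= ny; apply: xe; rewrite -ball_normE /=.
    have := ler_normB (x - u n) (y - u n); rewrite opprB addrA subrK.
    move: ny nx ke; set a := k.+1%:R^-1; clearbody a; lra.
  by move=> [n _ [k _]]; rewrite /B; case: asboolP => // h /h.
apply: (SU) => n; apply: (SU) => k; rewrite /B; case: asboolP => // _.
by apply: Sball; rewrite ltW.
Qed.

Lemma hdot_measurableP (V : hilbertType R) d (T : measurableType d) (f : T -> V) :
  separable V -> (forall a, measurable_fun setT (fun t => '[f t, a])) ->
  measurable_fun setT (f : T -> borel V).
Proof.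
move=> sV mf; apply: (@measurability _ _ T (borel V) setT f (@open V)) => //.
move=> _ [A oA <-]; rewrite setTI.
apply: (@open_in_halfspaces V [set B | measurable (f @^-1` B)] A) => //=.
- split => /=.
  + by rewrite preimage_set0.
  + by move=> B mB; rewrite setTD preimage_setC; exact: measurableC.
  + by move=> F mF; rewrite preimage_bigcup; exact: bigcupT_measurable.
- move=> a c; rewrite [X in measurable X](_ : _ = setT `&` (fun t => '[f t, a]) @^-1` `]-oo, c[).
    exact: mf.
  by rewrite setTI; apply/seteqP; split => t; rewrite /= in_itv.
Qed.

End borel_hilbert.

(** * Characteristic functionals determine the measure *)

Lemma natM_expr_bounded (R : realType) (s : R) : 0 <= s < 1 ->
  exists C : R, forall n, n%:R * s ^+ n <= C.
Proof.
move=> /andP[s0 s1]; have [->|sn0] := eqVneq s 0.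
  exists 0 => -[|n]; first by rewrite mul0r.
  by rewrite expr0n /= mulr0.
have sp : 0 < s by rewrite lt_neqAle eq_sym sn0.
have h0 : 0 < s^-1 - 1 by rewrite subr_gt0 invf_gt1.
exists (s^-1 - 1)^-1 => n.
(* Bernoulli's inequality for [s^-1 > 1]; dividing by [s^-1 ^+ n] bounds [n s^n]. *)
have B : 1 + n%:R * (s^-1 - 1) <= s^-1 ^+ n.
  elim: n => [|n ih]; first by rewrite mul0r addr0 expr0.
  rewrite exprS; apply: le_trans (_ : s^-1 * (1 + n%:R * (s^-1 - 1)) <= _); last first.
    by rewrite ler_wpM2l // invr_ge0.
  rewrite -natr1; set x := s^-1 - 1 in h0 *; rewrite (_ : s^-1 = 1 + x); last by rewrite /x; ring.
  have : 0 <= n%:R * x ^+ 2 by rewrite mulr_ge0 // sqr_ge0.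
  set k : R := n%:R; clearbody k x; nra.
rewrite -[leRHS]mul1r ler_pdivlMr // mulrAC -ler_pdivlMr ?exprn_gt0 // mul1r -exprVn.
by apply: le_trans B; rewrite lerDr.
Qed.

(* The polynomials of the Brosowski-Deutsch proof of the Stone-Weierstrass
   theorem; the step at 1/2 survives in the limit. *)
Lemma cvg_bernoulli_step (R : realType) (q : R) : 0 <= q <= 1 ->
  (1 - q ^+ (2 * n)) ^+ (n * 4 ^ n) @[n --> \oo] --> ((q < 2^-1)%R%:R : R).
Proof.
move=> /andP[q0 q1].
have y01 n : 0 <= q ^+ (2 * n) <= 1 by rewrite exprn_ge0 // exprn_ile1.
have pow1 (z : R) k : 0 <= z <= 1 -> 1 - k%:R * z <= (1 - z) ^+ k.
  move=> /andP[z0 z1]; elim: k => [|k ih]; first by rewrite mul0r subr0.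
  rewrite exprS; apply: le_trans (_ : (1 - z) * (1 - k%:R * z) <= _); last first.
    by rewrite ler_wpM2l // subr_ge0.
  have : 0 <= k%:R * z ^+ 2 by rewrite mulr_ge0 // sqr_ge0.
  rewrite -natr1; set w : R := k%:R; clearbody w; nra.
have pow2 (z : R) k : 0 <= z <= 1 -> (1 - z) ^+ k * (1 + k%:R * z) <= 1.
  move=> /andP[z0 z1]; elim: k => [|k ih]; first by rewrite mul0r addr0 mulr1.
  apply: le_trans ih; rewrite exprSr -mulrA ler_wpM2l //.
    by rewrite exprn_ge0 // subr_ge0.
  have : 0 <= k%:R :> R by [].
  rewrite -natr1; set w : R := k%:R; clearbody w; nra.
(* With [z = q^(2n)] and [k = n 4^n] the product [k z] is [n (2q)^(2n)]: it tends to 0 when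
   [q < 1/2] and is at least [n] when [q >= 1/2]. The factor [n] in the exponent forces the limit 0
   at [q = 1/2] as well. *)
have qn n : (4 ^ n)%:R * q ^+ (2 * n) = (2 * q) ^+ n * (2 * q) ^+ n :> R.
  by rewrite natrX exprM -!exprMn; congr (_ ^+ _); ring.
have [qlt|qge] := ltP q 2^-1.
  have r01 : 0 <= 2 * q < 1 by apply/andP; split; lra.
  have [C hC] := natM_expr_bounded r01.
  apply: (@cvg_norm_le0 R R^o _ _ _ _ _ (fun n => C * (2 * q) ^+ n)).
    apply: nearW => n /=.
    have h1 : (1 - q ^+ (2 * n)) ^+ (n * 4 ^ n) <= 1.
      by apply: exprn_ile1; have /andP[? ?] := y01 n; lra.
    rewrite distrC ger0_norm ?subr_ge0 // lerBlDl -lerBlDr.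
    apply: le_trans (pow1 _ _ (y01 n)); rewrite lerD2l lerN2 natrM -mulrA qn mulrA.
    by rewrite ler_wpM2r // exprn_ge0; lra.
  rewrite -(mulr0 C); apply: cvgMr; apply: cvg_expr.
  by rewrite ger0_norm; lra.
apply: (@cvg_norm_le0 R R^o _ _ _ _ _ (fun n => n.+1%:R^-1)); last exact: cvgn_inv_nat.
apply: nearW => n /=; rewrite subr0 ger0_norm; last first.
  by rewrite exprn_ge0 //; have /andP[? ?] := y01 n; lra.
have := pow2 _ (n * 4 ^ n)%N (y01 n).
rewrite -ler_pdivlMr; last by rewrite ltr_pwDl // mulr_ge0 //; case/andP: (y01 n).
move/le_trans; apply; rewrite mul1r lef_pV2 ?posrE ?ltr0n //; last first.
  by rewrite ltr_pwDl // mulr_ge0 //; case/andP: (y01 n).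
rewrite -natr1 addrC lerD2l natrM -mulrA ler_peMr //.
by rewrite qn -exprD exprn_ege1 //; lra.
Qed.

Section char_fun_uniqueness.
Context {R : realType} {V : hilbertType R} (m n : probability (borel V) R).

(* [m] and [n] give the same weight to [f] times every character; [agree_mul]
   singles out the multipliers preserving this, which form an algebra closed
   under bounded pointwise limits. *)
Definition agree (f : borel V -> R) := bmeas f /\
  forall a c, \int[m]_(x in setT) (f x * cos ('[x : V, a] + c)) =
              \int[n]_(x in setT) (f x * cos ('[x : V, a] + c)).

Definition agree_mul (p : borel V -> R) := bmeas p /\
  forall f, agree f -> agree (fun x => f x * p x).

Let mcos a c : bmeas ((fun x : V => cos ('[x, a] + c)) : borel V -> R).
Proof. by apply: bmeas_cos; apply: measurable_funD => //; exact: hdot_borel_measurable. Qed.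

Lemma agreeD f g : agree f -> agree g -> agree (fun x => f x + g x).
Proof.
move=> [bf ef] [bg eg]; split => [|a c]; first exact: bmeasD.
have E (P : probability (borel V) R) : \int[P]_(x in setT) ((f x + g x) * cos ('[x : V, a] + c)) =
  \int[P]_(x in setT) (f x * cos ('[x : V, a] + c)) + \int[P]_(x in setT) (g x * cos ('[x : V, a] + c)).
  rewrite -expectD; [|exact: bmeasM|exact: bmeasM].
  by apply: eq_Rintegral => x _; rewrite mulrDl.
by rewrite !E ef eg.
Qed.

Lemma agreeZ k f : agree f -> agree (fun x => k * f x).
Proof.
move=> [bf ef]; split => [|a c]; first exact: bmeasZ.
have E (P : probability (borel V) R) : \int[P]_(x in setT) ((k * f x) * cos ('[x : V, a] + c)) =
  k * \int[P]_(x in setT) (f x * cos ('[x : V, a] + c)).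
  rewrite -expectZ; last exact: bmeasM.
  by apply: eq_Rintegral => x _; rewrite mulrA.
by rewrite !E ef.
Qed.

(** Product-to-sum formula: a product of two cosines is a half sum of cosines of the same form. The
    free phase [c] in [agree] covers the sines and keeps the family closed. *)
Lemma agree_cos a c f : agree f -> agree (fun x => f x * cos ('[x : V, a] + c)).
Proof.
move=> [bf ef]; split => [|a' c']; first exact: bmeasM.
have E (P : probability (borel V) R) : \int[P]_(x in setT) ((f x * cos ('[x : V, a] + c)) * cos ('[x : V, a'] + c')) =
  2^-1 * (\int[P]_(x in setT) (f x * cos ('[x : V, a + a'] + (c + c'))) +
         \int[P]_(x in setT) (f x * cos ('[x : V, a - a'] + (c - c')))).
  rewrite -expectD; [|exact: bmeasM|exact: bmeasM].
  rewrite -expectZ; last by apply: bmeasD; exact: bmeasM.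
  apply: eq_Rintegral => x _; rewrite hdotDr hdotBr.
  rewrite (_ : _ + _ + (c + c') = ('[x : V, a] + c) + ('[x : V, a'] + c')); last by ring.
  rewrite (_ : _ - _ + (c - c') = ('[x : V, a] + c) - ('[x : V, a'] + c')); last by ring.
  by set A := '[x : V, a] + c; set B := '[x : V, a'] + c'; clearbody A B; rewrite cosD cosB; field.
by rewrite !E !ef.
Qed.

Lemma agree_cvg (f_ : nat -> borel V -> R) f C : (forall k, agree (f_ k)) ->
  (forall k x, `|f_ k x| <= C) -> (forall x, f_ k x @[k --> \oo] --> f x) -> agree f.
Proof.
move=> af fC ff; have mf k : measurable_fun setT (f_ k) by case: (af k) => -[].
split; first exact: bmeas_cvg mf fC ff.
move=> a c; have [mc [B cB]] := mcos a c.
have E (P : probability (borel V) R) : \int[P]_(x in setT) (f_ k x * cos ('[x : V, a] + c)) @[k --> \oo] -->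
    \int[P]_(x in setT) (f x * cos ('[x : V, a] + c)).
  apply: (@expect_cvg _ _ _ P _ _ (C * B)).
  - by move=> k; apply: measurable_funM.
  - by move=> k x; rewrite normrM ler_pM.
  - by move=> x; apply: cvgMl; exact: ff.
apply: (cvg_unique _ (E m)) => //=; under eq_fun do rewrite (proj2 (af _)).
exact: E.
Qed.

Lemma agree_mul_cst k : agree_mul (fun=> k).
Proof.
split; first exact: bmeas_cst.
by move=> f /(agreeZ k); under eq_fun do rewrite mulrC.
Qed.

Lemma agree_mulD p q : agree_mul p -> agree_mul q -> agree_mul (fun x => p x + q x).
Proof.
move=> [bp ap] [bq aq]; split; first exact: bmeasD.
by move=> f af; under eq_fun do rewrite mulrDr; apply: agreeD; [exact: ap|exact: aq].
Qed.

Lemma agree_mulM p q : agree_mul p -> agree_mul q -> agree_mul (fun x => p x * q x).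
Proof.
move=> [bp ap] [bq aq]; split; first exact: bmeasM.
by move=> f af; under eq_fun do rewrite mulrA; apply/aq/ap.
Qed.

Lemma agree_mulX p k : agree_mul p -> agree_mul (fun x => p x ^+ k).
Proof.
move=> ap; elim: k => [|k ih]; first exact: agree_mul_cst.
by under eq_fun do rewrite exprS; exact: agree_mulM.
Qed.

Lemma agree_mulC p : agree_mul p -> agree_mul (fun x => 1 - p x).
Proof.
move=> ap; apply: agree_mulD; first exact: agree_mul_cst.
by under eq_fun do rewrite -mulN1r; apply: agree_mulM => //; exact: agree_mul_cst.
Qed.

Lemma agree_mul_cvg (p_ : nat -> borel V -> R) p C : (forall k, agree_mul (p_ k)) ->
  (forall k x, `|p_ k x| <= C) -> (forall x, p_ k x @[k --> \oo] --> p x) ->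
  agree_mul p.
Proof.
move=> ap pC pp; split.
  by apply: (bmeas_cvg _ pC pp) => k; case: (ap k) => -[].
move=> f af; have [[mf [B fB]] _] := af.
apply: (@agree_cvg (fun k x => f x * p_ k x) _ (B * C)).
- by move=> k; exact: (proj2 (ap k)).
- by move=> k x; rewrite normrM ler_pM.
- by move=> x; apply: cvgMr; exact: pp.
Qed.

Let good (A : set V) := agree_mul (\1_A : borel V -> R).

(* For large [N], [x] lies in the halfspace iff sin(('[x, a] - c) / N) < 0; the
   indicator of that event is a limit of polynomials in a cosine. *)
Let good_halfspace a c : good [set x | '[x, a] < c].
Proof.
(* The shift by [pi / 2] turns the cosine into a sine, so the value [(1 + sin) / 2] lies in [[0, 1]]
   and is below [1/2] exactly when the sine is negative, as [cvg_bernoulli_step] detects. *)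
apply: (@agree_mul_cvg (fun N (x : borel V) =>
  (2^-1 * (1 + cos (('[x : V, N.+1%:R^-1 *: a] + (- c / N.+1%:R - pi / 2)))) < 2^-1)%R%:R) _ 1).
- move=> N; apply: (@agree_mul_cvg (fun k (x : borel V) =>
    (1 - (2^-1 * (1 + cos ('[x : V, N.+1%:R^-1 *: a] + (- c / N.+1%:R - pi / 2)))) ^+ (2 * k)) ^+ (k * 4 ^ k)) _ 1).
  + move=> k; apply/agree_mulX/agree_mulC/agree_mulX.
    apply: agree_mulM; first exact: agree_mul_cst.
    apply: agree_mulD; first exact: agree_mul_cst.
    by split; [exact: mcos|exact: agree_cos].
  + move=> k x; set y := cos _; have /andP[h1 h2] : 0 <= (2^-1 * (1 + y)) <= 1.
      by have := cos_geN1 ('[x : V, N.+1%:R^-1 *: a] + (- c / N.+1%:R - pi / 2));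
      have := cos_le1 ('[x : V, N.+1%:R^-1 *: a] + (- c / N.+1%:R - pi / 2)); rewrite -/y;
      move=> *; apply/andP; split; lra.
    have h3 : 0 <= (2^-1 * (1 + y)) ^+ (2 * k) <= 1 by rewrite exprn_ge0 // exprn_ile1.
    rewrite ger0_norm; last by rewrite exprn_ge0 //; lra.
    by apply: exprn_ile1; lra.
  + move=> x; apply: cvg_bernoulli_step.
    have := cos_geN1 ('[x : V, N.+1%:R^-1 *: a] + (- c / N.+1%:R - pi / 2)).
    have := cos_le1 ('[x : V, N.+1%:R^-1 *: a] + (- c / N.+1%:R - pi / 2)).
    by move=> *; apply/andP; split; lra.
- by move=> k x; case: (_ < _); rewrite ?normr1 ?normr0.
- move=> x; apply: cvg_near_cst.
  set z := '[x : V, a] - c.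
  have z0 : `|z| / N.+1%:R @[N --> \oo] --> (0 : R).
    by rewrite -(mulr0 `|z|); apply: cvgMr; exact: cvgn_inv_nat.
  move/cvgrPdist_lt : z0 => /(_ _ (@pi_gt0 R)); apply: filterS => k.
  rewrite sub0r normrN normrM normr_id -normrM => zpi.
  rewrite (_ : '[x : V, k.+1%:R^-1 *: a] + _ = z / k.+1%:R - pi / 2); last first.
    by rewrite hdotZr /z; move: (k.+1%:R^-1 : R) => y; ring.
  rewrite cosBpihalf indicE; congr ((nat_of_bool _)%:R).
  have zpi' : - pi < z / k.+1%:R < pi by rewrite -ltr_norml.
  apply/idP/idP; rewrite inE /= -subr_lt0 -/z => h; last first.
    have : 0 < sin (- (z / k.+1%:R)).
      apply: sin_gt0_pi; rewrite oppr_gt0 pmulr_llt0 ?invr_gt0 ?ltr0n // h /=.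
      by rewrite ltrNl; case/andP: zpi'.
    rewrite sinN; lra.
  rewrite ltNge; apply/negP => z0.
  suff : 0 <= sin (z / k.+1%:R) by lra.
  by apply: sin_ge0_pi; rewrite divr_ge0 //= ltW //; case/andP: zpi'.
Qed.

(** Complements and finite intersections come from the algebra of multipliers; a countable union is
    the bounded pointwise limit of its finite unions. *)
Let good_sigma : sigma_algebra setT good.
Proof.
split.
- have := agree_mul_cst 0; rewrite /good; congr agree_mul; apply/funext => x.
  by rewrite indicE in_set0.
- move=> A /agree_mulC; rewrite /good setTD; congr agree_mul; apply/funext => x.
  by rewrite !indicE in_setC; case: (x \in A); rewrite ?subrr ?subr0.
- move=> A gA.
  have gC B : good B -> good (~` B).
    move=> /agree_mulC; rewrite /good; congr agree_mul; apply/funext => x.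
    by rewrite !indicE in_setC; case: (x \in B); rewrite ?subrr ?subr0.
  have gI B C : good B -> good C -> good (B `&` C).
    by move=> gB gCC; have := agree_mulM gB gCC; rewrite /good indicI.
  have gU N : good (\big[setU/set0]_(i < N) A i).
    elim: N => [|k ih].
      rewrite big_ord0; have := agree_mul_cst 0; rewrite /good; congr agree_mul.
      by apply/funext => x; rewrite indicE in_set0.
    rewrite big_ord_recr /=; rewrite -[_ `|` _]setCK setCU; apply: (gC); apply: (gI); exact: (gC).
  apply: (@agree_mul_cvg (fun k => \1_(\big[setU/set0]_(i < k) A i)) _ 1) => //.
    by move=> k x; rewrite indicE; case: (_ \in _); rewrite ?normr1 ?normr0.
  move=> x; apply: cvg_near_cst.
  have [[k _ Akx]|nAx] := pselect ((\bigcup_k A k) x).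
    have h1 : (\bigcup_k A k) x by exists k.
    exists k.+1 => // l /= kl.
    have h2 : (\big[setU/set0]_(i < l) A i) x by rewrite -bigcup_mkord; exists k.
    by rewrite !indicE (mem_set h1) (mem_set h2).
  apply: nearW => k; rewrite !indicE !memNset // => Akx; apply: nAx.
  by move: Akx; rewrite -bigcup_mkord => -[i _ Aix]; exists i.
Qed.

(** The hypothesis puts the constant 1 in [agree]. Multiplying it by the indicator of [A] and
    pairing with the trivial character compares the masses of [A]. *)
Lemma char_fun_inj : separable V -> (forall a, char_fun m a = char_fun n a) ->
  forall A : set (borel V), measurable A -> m A = n A.
Proof.
move=> sV mn A mA.
have a1 : agree (fun=> 1).
  split => [|a c]; first exact: bmeas_cst.
  have E (P : probability (borel V) R) : \int[P]_(x in setT) (1 * cos ('[x : V, a] + c)) =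
    cos c * complex.Re (char_fun P a) - sin c * complex.Im (char_fun P a).
    rewrite /char_fun /Cintegral /=.
    have bc : bmeas ((fun x : V => cos '[x, a]) : borel V -> R).
      by apply: bmeas_cos; exact: hdot_borel_measurable.
    have bs : bmeas ((fun x : V => sin '[x, a]) : borel V -> R).
      by apply: bmeas_sin; exact: hdot_borel_measurable.
    under [X in _ = _ * X - _]eq_Rintegral do rewrite expR0 mul1r.
    under [X in _ = _ - _ * X]eq_Rintegral do rewrite expR0 mul1r.
    rewrite -!expectZ // -expectB; [|exact: bmeasZ|exact: bmeasZ].
    by apply: eq_Rintegral => x _; rewrite cosD; ring.
  by rewrite !E mn.
have gA : good A.
  apply: (@smallest_sub _ (sigma_algebra setT) open good good_sigma _ A mA) => B oB.
  by apply: (open_in_halfspaces sV good_sigma) oB => a c; exact: good_halfspace.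
have [_ /(_ 0 0)] := proj2 gA _ a1.
have E (P : probability (borel V) R) :
   \int[P]_(x in setT) (1 * \1_A x * cos ('[x : V, 0] + 0)) = fine (P A).
  rewrite -expect_indic //; apply: eq_Rintegral => x _.
  by rewrite hdot0r addr0 cos0 mul1r mulr1.
rewrite !E => h.
by rewrite -[LHS]fineK ?fin_num_measure // h fineK // fin_num_measure.
Qed.

End char_fun_uniqueness.

(** * Bochner integrals *)

Section weak_integral.
Context {R : realType} {d : measure_display} {T : measurableType d} {V : hilbertType R}.
Variables (m : {measure set T -> \bar R}) (D : set T).
Hypothesis mD : measurable D.

(** The Pettis integral. It is unique and computed by scalar integrals, so it pins down the value
    returned by the choice operator [bochner]. *)
Definition is_weak_integral (f : T -> V) (v : V) : Prop := forall a,
  m.-integrable D (EFin \o (fun x => '[f x, a])) /\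
  '[v, a] = \int[m]_(x in D) '[f x, a].

Lemma simple_preimage (s : T -> V) (B : set V) :
  simple_integrable m D s -> measurable (s @^-1` B).
Proof.
move=> [fs ms _].
have -> : s @^-1` B = \bigcup_(v in range s `&` B) (s @^-1` [set v]).
  apply/seteqP; split => x /=.
    by move=> Bx; exists (s x) => //; split => //; exists x.
  by move=> [v [_ Bv] /= ->].
apply: fin_bigcup_measurable => //.
exact: sub_finite_set (@subIsetl _ _ _) fs.
Qed.

Lemma simple_comp_measurable (s : T -> V) (h : V -> R) E :
  simple_integrable m D s -> measurable_fun E (fun x => h (s x)).
Proof.
move=> ss; apply: measurable_funTS => _ B mB; rewrite setTI.
exact: (@simple_preimage s (h @^-1` B)).
Qed.

Lemma simple_norm_sub_measurable (s : T -> V) (f : T -> V) :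
  simple_integrable m D s ->
  (forall v, measurable_fun D (fun x => `|f x - v|)) ->
  measurable_fun D (fun x => `|f x - s x|).
Proof.
move=> ss mf _ B mB; have [fs ms _] := ss.
have -> : D `&` (fun x => `|f x - s x|) @^-1` B =
    \bigcup_(v in range s) (s @^-1` [set v] `&` (D `&` (fun x => `|f x - v|) @^-1` B)).
  apply/seteqP; split => x /=.
    by move=> [Dx Bx]; exists (s x) => //; exists x.
  by move=> [v [y _ <-]] [-> [Dx Bx]].
by apply: fin_bigcup_measurable => // v _; apply: measurableI => //; exact: mf.
Qed.

Lemma simple_weak_integral (s : T -> V) : simple_integrable m D s ->
  is_weak_integral s (simple_integral m D s).
Proof.
move=> ss a; have [fs ms fm] := ss.
pose F v x := '[v, a] * \1_(s @^-1` [set v]) x.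
have sE x : '[s x, a] = \sum_(v <- finmap.enum_fset (fset_set (range s))) F v x.
  rewrite (bigD1_seq (s x)) ?finmap.fset_uniq //=; last by rewrite in_fset_set // inE; exists x.
  rewrite /F indicE mem_set // mulr1 big1 ?addr0 // => v vs.
  rewrite indicE memNset ?mulr0 // => /= E; move: vs; rewrite E eqxx //.
have Fint v : m.-integrable D (EFin \o F v).
  have [->|v0] := eqVneq v 0.
    by apply: eq_integrable (integrable0 _ _) => // x _; rewrite /F /= hdot0l mul0r.
  have I1 : m.-integrable D (EFin \o (\1_(s @^-1` [set v]) : T -> R)).
    apply/integrableP; split.
      by apply/measurable_EFinP; apply: measurable_funTS; exact: measurable_indic.
    under eq_integral do rewrite /= ger0_norm //.
    by rewrite integral_indic // setIC; exact: fm.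
  by have := integrableZl mD '[v, a] I1; apply: eq_integrable => // x _.
have Fval v : \int[m]_(x in D) F v x = '[fine (m (D `&` s @^-1` [set v])) *: v, a].
  have [->|v0] := eqVneq v 0.
    rewrite scaler0 hdot0l; under eq_Rintegral do rewrite /F hdot0l mul0r.
    by rewrite Rintegral_cst // mul0r.
  rewrite RintegralZl //; last first.
    have := integrableZl mD ('[v, v]^-1 : R) (Fint v) => _.
    apply/integrableP; split.
      by apply/measurable_EFinP; apply: measurable_funTS; exact: measurable_indic.
    under eq_integral do rewrite /= ger0_norm //.
    by rewrite integral_indic // setIC; exact: fm.
  by rewrite hdotZl mulrC /Rintegral integral_indic // setIC.
split.
  have := @integrable_sum _ _ _ m D mD _ (finmap.enum_fset (fset_set (range s))) xpredT _ (fun v _ => Fint v).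
  by apply: eq_integrable => // x _ /=; rewrite sE sumEFin.
under eq_Rintegral do rewrite sE.
rewrite Rintegral_sum // /simple_integral fsbig_finite //= hdot_suml.
by apply: eq_bigr => v _; rewrite Fval.
Qed.

Lemma weak_integral_uniq (f : T -> V) v w :
  is_weak_integral f v -> is_weak_integral f w -> v = w.
Proof.
by move=> fv fw; apply: hdot_inj => a; rewrite (proj2 (fv a)) (proj2 (fw a)).
Qed.

Lemma simple_integral_dist (f s : T -> V) v : is_weak_integral f v ->
  (forall w, measurable_fun D (fun x => `|f x - w|)) -> simple_integrable m D s ->
  (`|simple_integral m D s - v|%:E <= \int[m]_(x in D) `|f x - s x|%:E)%E.
Proof.
move=> fv mf ss; have sS := simple_weak_integral ss.
set S := simple_integral m D s in sS *.
have mfs := simple_norm_sub_measurable ss mf.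
have [fin|] := pselect (\int[m]_(x in D) `|f x - s x|%:E < +oo)%E; last first.
  by move=> /negP; rewrite -leNgt leye_eq => /eqP ->; rewrite leey.
have ifs : m.-integrable D (EFin \o (fun x => `|f x - s x|)).
  apply/integrableP; split; first exact/measurable_EFinP.
  by under eq_integral do rewrite /= normr_id.
have fi : (\int[m]_(x in D) `|f x - s x|%:E)%E \is a fin_num.
  exact: (@integrable_fin_num _ _ _ m D mD _ ifs).
rewrite -(fineK fi) lee_fin.
apply: norm_le_hdot => [|a]; first exact: (@Rintegral_ge0 _ _ _ m D (fun x => `|f x - s x|)).
have [If Ef] := fv a; have [Is Es] := sS a.
rewrite hdotBl Es Ef -RintegralB // -[leRHS](@RintegralZr _ _ _ m D (fun x => `|f x - s x|)) //.
apply: le_Rintegral => //.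
- by have := integrableB mD Is If; apply: eq_integrable.
- by have := integrableZr mD `|a| ifs; apply: eq_integrable.
- move=> x Dx; rewrite -hdotBl; apply: le_trans (ler_norm _) _.
  by rewrite [`|f x - _|]distrC hdot_CauchySchwarz.
Qed.

Lemma is_bochner_weak (f : T -> V) v w : is_weak_integral f v ->
  (forall w, measurable_fun D (fun x => `|f x - w|)) -> is_bochner m D f w -> w = v.
Proof.
move=> fv mf [s [ss _ h1 h2]].
apply: (cvg_unique _ h2) => //.
have H : `|simple_integral m D (s n) - v|%:E @[n --> \oo] --> (0%:E : \bar R).
  apply: (@squeeze_cvge _ _ _ _ (cst 0%E) _ _ _ _ (cvg_cst _) h1).
  apply: nearW => n; rewrite /= lee_fin normr_ge0 /=.
  exact: simple_integral_dist.
exact: (cvg_sub0_norm (fine_cvg H)).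
Qed.

(** Riesz's theorem produces the weak integral [v]. By dominated convergence [s n] tends to [f] in
    mean, so [v] is a Bochner value, and by [is_bochner_weak] it is the only one [xget] can
    return. *)
Lemma bochner_dominated (f : T -> V) (s : nat -> T -> V) (g : T -> R) :
  (forall n, simple_integrable m D (s n)) ->
  (forall x, D x -> s n x @[n --> \oo] --> f x) ->
  m.-integrable D (EFin \o g) ->
  (forall n x, D x -> `|s n x| <= g x) ->
  is_weak_integral f (bochner m D f).
Proof.
move=> ss sf ig sg.
have nsf w x : D x -> `|s n x - w| @[n --> \oo] --> `|f x - w|.
  by move=> Dx; apply: cvg_norm; apply: cvgB; [exact: sf|exact: cvg_cst].
have mf w : measurable_fun D (fun x => `|f x - w|).
  apply: (@measurable_fun_cvg _ _ _ D (fun n x => `|s n x - w|)); last exact: nsf.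
  by move=> n; exact: (@simple_comp_measurable (s n) (fun v => `|v - w|)).
have fg x : D x -> `|f x| <= g x.
  move=> Dx; have h : `|s n x| @[n --> \oo] --> `|f x| by apply: cvg_norm; exact: sf.
  by apply: (ler_cvg_to h (cvg_cst (g x))); apply: nearW => n; exact: sg.
have Iabs : m.-integrable D (EFin \o (fun x => `|f x|)).
  apply: integrable_dominated ig => //.
    by have := mf 0; under eq_fun do rewrite subr0.
  by move=> x Dx; rewrite normr_id fg.
have mfa a : measurable_fun D (fun x => '[f x, a]).
  apply: (@measurable_fun_cvg _ _ _ D (fun n x => '[s n x, a])).
    by move=> n; exact: (@simple_comp_measurable (s n) (fun v => '[v, a])).
  by move=> x Dx; apply: cvg_hdotl; exact: sf.
have Ia a : m.-integrable D (EFin \o (fun x => '[f x, a])).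
  apply: (@integrable_dominated _ _ _ m D _ (fun x => `|f x| * `|a|)) => //.
    by move=> x _; exact: hdot_CauchySchwarz.
  by have := integrableZr mD `|a| Iabs; apply: eq_integrable.
have [v hv] : exists v, forall a, \int[m]_(x in D) '[f x, a] = '[a, v].
  apply: (@riesz_representation _ _ _ (\int[m]_(x in D) `|f x|)).
  - move=> a b; rewrite -RintegralD //; apply: eq_Rintegral => x _.
    by rewrite hdotDr.
  - move=> c a; rewrite -RintegralZl //; apply: eq_Rintegral => x _.
    by rewrite hdotZr.
  - move=> a; apply: le_trans (le_normr_Rintegral mD (Ia a)) _.
    rewrite -RintegralZr //; apply: le_Rintegral => //.
    + by have := integrable_norm (Ia a); apply: eq_integrable.
    + by have := integrableZr mD `|a| Iabs; apply: eq_integrable.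
    + by move=> x _; exact: hdot_CauchySchwarz.
have fv : is_weak_integral f v by move=> a; split => //; rewrite hv hdotC.
have bv : is_bochner m D f v.
  have dcv : (\int[m]_(x in D) `|f x - s n x|%:E)%E @[n --> \oo] --> (0%E : \bar R).
    have [] := @Rdominated_convergence _ _ _ m D (fun n x => `|f x - s n x|) (fun=> 0) (fun x => g x + g x) mD.
    - by move=> n; exact: simple_norm_sub_measurable.
    - move=> x Dx; rewrite -(@normr0 _ V) -(subrr (f x)); apply: cvg_norm; apply: cvgB => //; [exact: cvg_cst|exact: sf].
    - by have := integrableD mD ig ig; apply: eq_integrable.
    - move=> n x Dx; rewrite normr_id; apply: le_trans (ler_normB _ _) (lerD _ _); [exact: fg|exact: sg].
    by move=> _ + _; under eq_fun do under eq_integral do rewrite subr0 normr_id.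
  exists s; split => //; first exact: aeW.
  have H : `|simple_integral m D (s n) - v|%:E @[n --> \oo] --> (0%:E : \bar R).
    apply: (@squeeze_cvge _ _ _ _ (cst 0%E) _ _ _ _ (cvg_cst _) dcv).
    apply: nearW => n; rewrite /= lee_fin normr_ge0 /=.
    exact: simple_integral_dist.
  exact: (cvg_sub0_norm (fine_cvg H)).
rewrite (_ : bochner m D f = v) // /bochner.
by case: xgetP => [w -> /(is_bochner_weak fv mf)//|] /(_ v).
Qed.

End weak_integral.

(** * Step functions on a uniform grid *)

Section step_functions.
Context {R : realType}.

Definition cell (h : R) (i : nat) : set R := `[i%:R * h, i.+1%:R * h[%classic.

Definition stepf {V : zmodType} (h : R) (N : nat) (c : nat -> V) (x : R) : V :=
  if (0 <= x) && (x < N%:R * h) then c (Num.truncn (x / h)) else 0.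

Lemma cellP (h : R) i x : 0 < h -> 0 <= x ->
  cell h i x <-> Num.truncn (x / h) = i.
Proof.
move=> h0 x0; rewrite /cell /= in_itv /= -ler_pdivlMr // -ltr_pdivrMr //.
have xh : 0 <= x / h by rewrite divr_ge0 // ltW.
split => [/truncn_def//|<-]; exact: truncn_itv.
Qed.

Lemma cell_ge0 (h : R) i x : 0 < h -> cell h i x -> 0 <= x.
Proof.
by move=> h0; rewrite /cell /= in_itv /= => /andP[+ _]; apply: le_trans; rewrite mulr_ge0 // ltW.
Qed.

Lemma trunc_lt (h : R) N x : 0 < h -> 0 <= x -> (x < N%:R * h) = (Num.truncn (x / h) < N)%N.
Proof.
move=> h0 x0; rewrite -ltr_pdivrMr // truncn_lt_nat //.
by rewrite divr_ge0 // ltW.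
Qed.

Lemma stepf_sum {V : lmodType R} h N (c : nat -> V) x : 0 < h ->
  stepf h N c x = \sum_(i < N) (\1_(cell h i) x : R) *: c i.
Proof.
move=> h0; rewrite /stepf.
have [x0|x0] /= := leP 0 x; last first.
  rewrite big1 // => i _; rewrite indicE memNset ?scale0r // => /(cell_ge0 h0).
  by rewrite leNgt x0.
rewrite trunc_lt //; case: ltnP => kN.
  rewrite (bigD1 (Ordinal kN)) //= indicE mem_set ?scale1r; last exact/cellP.
  rewrite big1 ?addr0 // => i /eqP ik; rewrite indicE memNset ?scale0r // => /(cellP _ h0 x0) E.
  by apply: ik; apply/val_inj.
rewrite big1 // => i _; rewrite indicE memNset ?scale0r // => /(cellP _ h0 x0) E.
by move: (ltn_ord i); rewrite -E ltnNge kN.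
Qed.

Lemma cell_measure h i : 0 < h -> lebesgue_measure (cell h i) = h%:E.
Proof.
move=> h0; rewrite /cell lebesgue_measure_itv /= lte_fin ltr_pM2r // ltr_nat ltnSn.
by rewrite -EFinD -mulrBl -natrB // subSnn mul1r.
Qed.

Lemma stepf_simple {V : hilbertType R} (D : set R) h N (c : nat -> V) : 0 < h -> measurable (D : set (measurableTypeR R)) ->
  simple_integrable (@lebesgue_measure R) D (stepf h N c).
Proof.
move=> h0 mD.
have mcell i : measurable (cell h i : set (measurableTypeR R)) by exact: measurable_itv.
(* [J v] gathers the cells carrying the value [v]. The outside [O] joins only the level set of 0,
   whose measure may be infinite. *)
pose J v := (\bigcup_(i in [set i | (i < N)%N /\ c i = v]) cell h i).
pose O := ~` (\bigcup_(i in [set i | (i < N)%N]) cell h i).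
have fN (A : set nat) : finite_set [set i | (i < N)%N /\ A i].
  by apply: sub_finite_set (finite_II N) => i [].
have mJ v : measurable (J v : set (measurableTypeR R)) by apply: fin_bigcup_measurable => //; exact: (fN (fun i => c i = v)).
have mO : measurable (O : set (measurableTypeR R)).
  by apply: measurableC; apply: fin_bigcup_measurable => //; exact: finite_II.
have inJ i x : (i < N)%N -> cell h i x -> stepf h N c x = c i.
  move=> iN ix; have x0 := cell_ge0 h0 ix; rewrite /stepf x0 trunc_lt //.
  by move/(cellP _ h0 x0): ix => ->; rewrite iN.
have inO x : O x -> stepf h N c x = 0.
  move=> nx; rewrite /stepf; case: ifP => // /andP[x0]; rewrite trunc_lt // => kN.
  by exfalso; apply: nx; exists (Num.truncn (x / h)) => //; apply/cellP.
have pre v : stepf h N c @^-1` [set v] = J v `|` (O `&` [set x | v = 0]).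
  apply/seteqP; split => x /=.
    have [ox|] := pselect (O x); first by rewrite inO // => <-; right.
    by rewrite /O /setC /= => /contrapT[i iN ix]; rewrite (inJ i) // => iv; left; exists i.
  by move=> [[i [iN <-] ix]|[/inO -> ->]//]; exact: inJ.
split.
- apply: (@sub_finite_set _ _ (0 |` (c @` [set i | (i < N)%N]))).
    move=> _ [x _ <-]; rewrite /stepf; case: ifP => [/andP[x0 xN]|_]; last by left.
    by right; exists (Num.truncn (x / h)) => //=; rewrite -trunc_lt.
  by rewrite finite_setU; split => //; apply: finite_image; exact: finite_II.
- move=> v; rewrite pre; apply: measurableU; first exact: mJ.
  have [->|/eqP v0] := eqVneq v 0; first by rewrite (_ : [set x | _] = setT) ?setIT //; apply/seteqP.
  by rewrite (_ : [set x | _] = set0) ?setI0 //; apply/seteqP; split.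
- move=> v v0; rewrite pre (_ : O `&` _ = set0) ?setU0; last first.
    by apply/seteqP; split => x // [_ /= v0']; move/eqP: v0.
  apply: (@le_lt_trans _ _ (lebesgue_measure (`[0, N%:R * h]%classic : set R))).
    have mDJ : measurable (D `&` J v : set (measurableTypeR R)) by apply: measurableI => //; exact: mJ.
    apply: le_measure; [by rewrite inE|by rewrite inE; exact: measurable_itv|].
    move=> x [_ [i [iN _] ix]] /=; rewrite in_itv /= (cell_ge0 h0 ix) /=.
    move: ix; rewrite /cell /= in_itv /= => /andP[_ /ltW /le_trans]; apply.
    by rewrite ler_pM2r // ler_nat.
  by rewrite lebesgue_measure_itv /=; case: ifP => _; rewrite ?ltry // -EFinB ltry.
Qed.

Lemma stepf_measurable h N (c : nat -> R) : 0 < h -> measurable_fun setT (stepf h N c : measurableTypeR R -> R).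
Proof.
move=> h0; rewrite (_ : stepf h N c = fun x => \sum_(i < N) (\1_(cell h i) x : R) * c i).
  apply: measurable_sum => i; apply: measurable_funM => //.
  apply: measurable_indic; exact: measurable_itv.
by apply/funext => x; rewrite (@stepf_sum R^o).
Qed.

Lemma stepf_Rintegral (D : set R) h N (c : nat -> R) : 0 < h -> measurable (D : set (measurableTypeR R)) ->
  (forall i, (i < N)%N -> cell h i `<=` D) ->
  \int[lebesgue_measure]_(x in D) (stepf h N c x) = \sum_(i < N) h * c i.
Proof.
move=> h0 mD cD.
have mcell i : measurable (cell h i : set (measurableTypeR R)) by exact: measurable_itv.
under eq_Rintegral do rewrite (@stepf_sum R^o) //.
have I1 (i : 'I_N) : lebesgue_measure.-integrable D (EFin \o (\1_(cell h i) : R -> R)).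
  apply/integrableP; split.
    by apply/measurable_EFinP; exact: (measurable_indic (mcell i)).
  under eq_integral do rewrite /= ger0_norm //.
  rewrite integral_indic; [|exact: mD|exact: mcell].
  rewrite -[X in (X < _)%E]/(lebesgue_measure (cell h i `&` D)).
  by rewrite (setIidl (cD i (ltn_ord i))) cell_measure // ltry.
rewrite Rintegral_sum //; last first.
  by move=> i; have := integrableZr mD (c i) (I1 i); apply: eq_integrable.
apply: eq_bigr => i _; rewrite RintegralZr //; congr (_ * _).
rewrite /Rintegral integral_indic; [|exact: mD|exact: mcell].
rewrite -[X in fine X]/(lebesgue_measure (cell h i `&` D)).
by rewrite (setIidl (cD i (ltn_ord i))) cell_measure.
Qed.

Lemma stepf_hdot {V : hilbertType R} h N (c : nat -> V) a x :
  '[stepf h N c x, a] = stepf h N (fun i => '[c i, a]) x.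
Proof. by rewrite /stepf; case: ifP => //; rewrite hdot0l. Qed.

(* The first point of the grid [h * nat] strictly to the right of [x], so that
   right limits are the relevant ones. *)
Definition next (h x : R) : R := (Num.truncn (x / h)).+1%:R * h.

Lemma next_gt h x : 0 < h -> 0 <= x -> x < next h x <= x + h.
Proof.
move=> h0 x0; rewrite /next -ltr_pdivrMr //.
have /truncn_itv/andP[h1 ->] /= : 0 <= x / h by rewrite divr_ge0 // ltW.
rewrite -natr1 mulrDl mul1r lerD2r -ler_pdivlMr //.
Qed.

Lemma next_cvg (h : nat -> R) x : (forall n, 0 < h n) -> 0 <= x ->
  h n @[n --> \oo] --> 0 -> next (h n) x @[n --> \oo] --> x^'+.
Proof.
move=> h0 x0 hc U xU.
have : next (h n) x @[n --> \oo] --> x.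
  apply: (@cvg_norm_le0 R R^o _ _ _ _ _ h) => //; apply: nearW => n.
  have /andP[h1 h2] := next_gt (h0 n) x0.
  by rewrite ger0_norm; [rewrite lerBlDl|rewrite subr_ge0 ltW].
move=> /(_ _ xU)[N _ HN]; exists N => // n /= /HN; apply.
by have /andP[] := next_gt (h0 n) x0.
Qed.

Lemma stepf_next {V : zmodType} h N (F : R -> V) x : 0 < h -> 0 <= x -> x < N%:R * h ->
  stepf h N (fun i => F (i.+1%:R * h)) x = F (next h x).
Proof. by move=> h0 x0 xN; rewrite /stepf x0 xN. Qed.

End step_functions.

(** * Resolvents *)

Section lebesgue_halfline.
Context {R : realType}.
Local Notation mu := (@lebesgue_measure R).

Lemma integrable_expN (C k : R) : 0 < k ->
  mu.-integrable `[0, +oo[ (EFin \o (fun x => C * expR (- k * x))).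
Proof.
move=> k0; have I1 := integrable_exponential_pdf k0.
have mD : measurable (`[0, +oo[%classic : set (measurableTypeR R)) by exact: measurable_itv.
have {}I1 : mu.-integrable `[0, +oo[ (EFin \o exponential_pdf k).
  by apply: integrableS I1.
have := integrableZl mD (C / k) I1; apply: eq_integrable => // x.
rewrite inE /= in_itv /= andbT => x0.
by rewrite exponential_pdfE // -EFinM mulrA divfK // gt_eqF.
Qed.

Lemma lebesgue_measure_shift (h : R) (A : set (measurableTypeR R)) : measurable A ->
  pushforward mu ((fun x => x + h) : _ -> measurableTypeR R) A = mu A.
Proof.
have mphi : measurable_fun setT ((fun x => x + h) : measurableTypeR R -> measurableTypeR R).
  exact: measurable_funD.
move=> mA.
apply/esym.
pose phi : {mfun measurableTypeR R >-> measurableTypeR R} := HB.pack (fun x : measurableTypeR R => x + h) (isMeasurableFun.Build _ _ _ _ _ mphi).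
apply: (@lebesgue_measure_unique R (pushforward mu phi)) => //= _ [[a b]] _ <-.
rewrite /pushforward /=.
have -> : (fun x => x + h) @^-1` [set` Interval (BRight a) (BRight b)] =
   [set` Interval (BRight (a - h)) (BRight (b - h))].
  by apply/seteqP; split => x /=; rewrite !in_itv /= ltrBlDr lerBrDr.
rewrite !lebesgue_measure_itv/= !lte_fin ltrD2r; case: ifP => // _.
by rewrite -!EFinB; congr (_%:E); ring.
Qed.

Lemma Rintegral_shift (h : R) (g : R -> R) :
  mu.-integrable `[h, +oo[ (EFin \o g) ->
  \int[mu]_(x in `[0, +oo[) g (x + h) = \int[mu]_(x in `[h, +oo[) g x.
Proof.
move=> ig.
have mphi : measurable_fun setT ((fun x => x + h) : measurableTypeR R -> measurableTypeR R).
  exact: measurable_funD.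
have mD a : measurable (`[a, +oo[%classic : set (measurableTypeR R)) by exact: measurable_itv.
have pre : (fun x => x + h) @^-1` `[h, +oo[%classic = `[0, +oo[%classic.
  by apply/seteqP; split => x /=; rewrite !in_itv /= !andbT lerDr.
(* [g] is known to be measurable on the half-line only, whereas the change of variables composes a
   globally measurable function with the shift. *)
pose G := g \_ `[h, +oo[.
have mG : measurable_fun setT (G : measurableTypeR R -> R).
  apply/(measurable_restrictT _ (mD h)).
  by apply/measurable_EFinP; exact: measurable_int ig.
have -> : \int[mu]_(x in `[0, +oo[) g (x + h) = \int[mu]_(x in `[0, +oo[) G (x + h).
  apply: eq_Rintegral => x; rewrite inE /= in_itv /= andbT => x0.
  by rewrite /G patchE mem_set //= in_itv /= andbT lerDr.
have -> : \int[mu]_(x in `[h, +oo[) g x = \int[mu]_(x in `[h, +oo[) G x.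
  by apply: eq_Rintegral => x xh; rewrite /G patchE xh.
have iG : mu.-integrable `[h, +oo[ (EFin \o G).
  by apply: eq_integrable ig => // x xh; rewrite /= /G patchE xh.
have E : (\int[pushforward mu ((fun x : R => (x + h)%R) : measurableTypeR R -> measurableTypeR R)]_(x in `[h, +oo[) (G x)%:E =
   \int[mu]_(x in `[h, +oo[) (G x)%:E)%E.
  by apply: eq_measure_integral => A mA _; exact: lebesgue_measure_shift.
rewrite /Rintegral -E integral_pushforward //; last 2 first.
- exact/measurable_EFinP.
- rewrite pre; apply/integrableP; split.
    apply/measurable_EFinP; apply: measurable_funTS.
    exact: (measurableT_comp mG mphi).
  rewrite -pre.
  have := @ge0_integral_pushforward _ _ _ _ R _ mphi mu `[h, +oo[ (fun x => `|(G x)%:E|%E).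
  move=> /(_ (mD h)) H; rewrite -[X in (X < _)%E]H //; last first.
    apply/measurable_EFinP; apply: measurableT_comp => //; exact: measurable_funTS.
  rewrite (_ : integral _ _ _ = (\int[mu]_(x in `[h, +oo[) `|(EFin \o G) x|)%E).
    by case/integrableP: iG.
  by apply: eq_measure_integral => A mA _; exact: lebesgue_measure_shift.
by rewrite pre.
Qed.

End lebesgue_halfline.

(** * Strongly continuous semigroups and their resolvents *)

Section C0.
Context {R : realType} {V : hilbertType R}.
Variables (S : R -> {linear V -> V}) (c0 b0 : R).
Hypotheses (c0_ge0 : 0 <= c0) (b0_ge0 : 0 <= b0).
Hypotheses (C0S : C0_semigroup S) (gS : growth_bound S c0 b0).

(** Right continuity at 0 propagates to every time: factoring out the smaller of two times bounds
    [S t z - S s z] by a multiple of the norm of [S |t - s| z - z]. *)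
Lemma C0_cvg {T : Type} (F : set_system T) {FF : Filter F} (f : T -> R) (r : R) (z : V) :
  (\forall x \near F, 0 <= f x) -> 0 <= r -> f x @[x --> F] --> r ->
  S (f x) z @[x --> F] --> S r z.
Proof.
case: C0S => S0 SD _ Sl f0 r0 fr.
have H s t : 0 <= s -> s <= t -> `|S t z - S s z| <= c0 * expR (b0 * s) * `|S (t - s) z - z|.
  move=> s0 st; have -> : S t z = S s (S (t - s) z) by rewrite -SD ?subr_ge0 // addrC subrK.
  by rewrite -linearB; exact: gS.
have {}H s t : 0 <= s -> 0 <= t -> `|S t z - S s z| <= c0 * expR (b0 * s) * `|S `|t - s| z - z|.
  move=> s0 t0; have [st|ts] := leP s t; first by rewrite ger0_norm ?subr_ge0 // H.
  rewrite [leLHS]distrC; apply: le_trans (H _ _ t0 (ltW ts)) _.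
  rewrite ltr0_norm ?subr_lt0 // opprB ler_wpM2r // ler_wpM2l // ler_expR ler_wpM2l //.
  exact: ltW.
apply: (cvg_norm_le0 (e := fun x => c0 * expR (b0 * r) * `|S `|f x - r| z - z|)).
  by apply: filterS f0 => x fx; exact: H.
rewrite -(mulr0 (c0 * expR (b0 * r))); apply: cvgMr.
apply/cvgrPdist_lt => e e0.
have /cvgrPdist_lt /(_ e e0) [d /= d0 Hd] := Sl z.
move/cvgrPdist_lt : fr => /(_ d d0); apply: filterS => x fxr.
rewrite sub0r normrN normr_id.
(* The right neighbourhood of 0 in [Sl] leaves 0 out, so [f x = r] is treated apart. *)
have [fr0|fr0] := eqVneq `|f x - r| 0; first by rewrite fr0 S0 subrr normr0.
rewrite distrC; apply: Hd; last by rewrite lt_neqAle eq_sym fr0 /=.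
by rewrite /= sub0r normrN normr_id distrC.
Qed.

(** The adjoint of [S t] at [z]; it carries [S t] across a weak integral. *)
Lemma C0_adjoint t z : 0 <= t -> exists w, forall y, '[S t y, z] = '[y, w].
Proof.
move=> t0; apply: (@riesz_representation _ _ (fun y => '[S t y, z]) (c0 * expR (b0 * t) * `|z|)).
- by move=> x y; rewrite linearD hdotDl.
- by move=> c x; rewrite linearZ hdotZl.
- move=> x; apply: le_trans (hdot_CauchySchwarz _ _) _.
  by rewrite mulrAC ler_wpM2r //; exact: gS.
Qed.

Section resolvent.
Variable alpha : R.
Hypothesis b0_lt_alpha : b0 < alpha.
Local Notation mu := (@lebesgue_measure R).
Local Notation U := (resolvent S alpha).

Let k0 : 0 < alpha - b0. Proof. by rewrite subr_gt0. Qed.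

Let mD (a : R) : measurable (`[a, +oo[%classic : set (measurableTypeR R)).
Proof. exact: measurable_itv. Qed.

Lemma resolvent_integrand_le x s : 0 <= s ->
  `|expR (- alpha * s) *: S s x| <= c0 * `|x| * expR (- (alpha - b0) * s).
Proof.
move=> s0; rewrite normrZ ger0_norm ?expR_ge0 //.
apply: le_trans (_ : expR (- alpha * s) * (c0 * expR (b0 * s) * `|x|) <= _).
  by rewrite ler_wpM2l ?expR_ge0 //; exact: gS.
rewrite (_ : - (alpha - b0) * s = - alpha * s + b0 * s); last by ring.
by rewrite expRD le_eqVlt; apply/orP; left; apply/eqP; ring.
Qed.

Lemma resolvent_weak x :
  is_weak_integral mu `[0, +oo[ (fun s => expR (- alpha * s) *: S s x) (U x).
Proof.
pose h n : R := n.+1%:R^-1.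
have h0 n : 0 < h n by exact: invn_gt0.
pose f s := expR (- alpha * s) *: S s x.
(* With mesh [1 / (n + 1)], the [(n + 1)^2] cells cover [[0, n + 1[], which exhausts the
   half-line. *)
apply: (@bochner_dominated _ _ _ _ _ _ (mD 0) _
  (fun n => stepf (h n) (n.+1 ^ 2) (fun i => f (i.+1%:R * h n)))
  (fun s => c0 * `|x| * expR (- (alpha - b0) * s))).
- by move=> n; exact: stepf_simple.
- move=> s; rewrite /= in_itv /= andbT => s0.
  have fr : f (next (h n) s) @[n --> \oo] --> f s.
    have nc := next_cvg h0 s0 (@cvgn_inv_nat R).
    have nc' : next (h n) s @[n --> \oo] --> s.
      by apply: cvg_trans nc _; exact: cvg_within.
    apply: cvgZ.
      apply: continuous_cvg; first exact: continuous_expR.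
      exact: cvgMr.
    apply: C0_cvg => //; apply: nearW => n.
    have /andP[/ltW + _] := next_gt (h0 n) s0; exact: le_trans.
  apply: cvg_trans fr; apply: near_eq_cvg.
  exists (Num.truncn s).+1 => // n /= sn; rewrite stepf_next //.
  rewrite natrX expr2 -mulrA divff ?mulr1 ?pnatr_eq0 //.
  by apply: lt_trans (truncnS_gt s) _; rewrite ltr_nat.
- exact: integrable_expN.
- move=> n s; rewrite /= in_itv /= andbT => s0.
  rewrite /stepf s0 /=; case: ifP => _; last by rewrite normr0 !mulr_ge0 // expR_ge0.
  (* Sampling to the right of [s] keeps the decaying bound at [s] valid. *)
  have /andP[h1 h2] := next_gt (h0 n) s0.
  apply: le_trans (resolvent_integrand_le _ (le_trans s0 (ltW h1))) _.
  rewrite ler_wpM2l ?mulr_ge0 // ler_expR !mulNr lerN2 ler_pM2l //; exact: ltW.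
Qed.

Lemma resolventD x y : U (x + y) = U x + U y.
Proof.
apply: (weak_integral_uniq (resolvent_weak _)) => a.
have [Ix Ex] := resolvent_weak x a; have [Iy Ey] := resolvent_weak y a.
have E s : '[expR (- alpha * s) *: S s (x + y), a] =
  '[expR (- alpha * s) *: S s x, a] + '[expR (- alpha * s) *: S s y, a].
  by rewrite linearD scalerDr hdotDl.
split.
  by have := integrableD (mD 0) Ix Iy; apply: eq_integrable => // s _; rewrite /= E.
under eq_Rintegral do rewrite E.
rewrite (RintegralD (mD 0) Ix Iy) -Ex -Ey; exact: hdotDl.
Qed.

Lemma resolventZ c x : U (c *: x) = c *: U x.
Proof.
apply: (weak_integral_uniq (resolvent_weak _)) => a.
have [Ix Ex] := resolvent_weak x a.
have E s : '[expR (- alpha * s) *: S s (c *: x), a] = c * '[expR (- alpha * s) *: S s x, a].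
  by rewrite linearZ scalerA mulrC -scalerA hdotZl.
split.
  by have := integrableZl (mD 0) c Ix; apply: eq_integrable => // s _; rewrite /= E.
by under eq_Rintegral do rewrite E; rewrite RintegralZl // hdotZl Ex.
Qed.

Lemma resolventB x y : U (x - y) = U x - U y.
Proof. by rewrite -scaleN1r resolventD resolventZ scaleN1r. Qed.

Lemma resolvent_le : exists2 C, 0 <= C & forall x, `|U x| <= C * `|x|.
Proof.
have I1 := integrable_expN 1 k0.
set I := \int[mu]_(s in `[0, +oo[) (1 * expR (- (alpha - b0) * s)).
have I0 : 0 <= I by apply: Rintegral_ge0 => s _; rewrite mul1r expR_ge0.
exists (c0 * I) => [|x]; first exact: mulr_ge0.
apply: norm_le_hdot => [|a]; first by rewrite !mulr_ge0.
have [Ix ->] := resolvent_weak x a.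
rewrite (_ : c0 * I * `|x| * `|a| = (c0 * `|x| * `|a|) * I); last by ring.
rewrite -RintegralZl //; apply: le_Rintegral => //.
  by have := integrableZl (mD 0) (c0 * `|x| * `|a|) I1; apply: eq_integrable.
move=> s; rewrite /= in_itv /= andbT => s0.
apply: le_trans (ler_norm _) _; apply: le_trans (hdot_CauchySchwarz _ _) _.
apply: le_trans (ler_wpM2r (normr_ge0 _) (resolvent_integrand_le x s0)) _.
by rewrite le_eqVlt; apply/orP; left; apply/eqP; ring.
Qed.

Lemma resolvent_commute t x : 0 <= t -> S t (U x) = U (S t x).
Proof.
move=> t0; case: C0S => _ SD _ _.
apply: hdot_inj => a; have [w Hw] := C0_adjoint a t0.
rewrite (Hw (U x)); apply: etrans (proj2 (resolvent_weak x w)) _.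
apply: etrans (esym (proj2 (resolvent_weak (S t x) a))); apply: eq_Rintegral => s; rewrite inE /= in_itv /= andbT => s0.
by rewrite !hdotZl -Hw -!SD // addrC.
Qed.

(** Applying [S h] shifts time by [h] in the integral defining [U x]: the exponential weight yields
    the factor [e^(alpha h)], and the piece over [[0, h[] is lost. *)
Lemma semigroup_resolvent h x z : 0 <= h ->
  '[S h (U x), z] = expR (alpha * h) * ('[U x, z] -
     \int[mu]_(s in `[0, h[) '[expR (- alpha * s) *: S s x, z]).
Proof.
move=> h0; case: C0S => _ SD _ _.
have [w Hw] := C0_adjoint z h0.
have [Iz Ez] := resolvent_weak x z.
rewrite (Hw (U x)) (proj2 (resolvent_weak x w)) Ez.
pose g s := '[expR (- alpha * s) *: S s x, z].
have Ig : mu.-integrable `[h, +oo[ (EFin \o g).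
  apply: integrableS Iz => // s; rewrite /= !in_itv /= !andbT; exact: le_trans.
have Ig' : mu.-integrable `[0, h[ (EFin \o g).
  by apply: integrableS Iz => // s; rewrite /= !in_itv /= andbT => /andP[].
have -> : \int[mu]_(s in `[0, +oo[) '[expR (- alpha * s) *: S s x, w] =
   \int[mu]_(s in `[0, +oo[) (expR (alpha * h) * g (s + h)).
  apply: eq_Rintegral => s; rewrite inE /= in_itv /= andbT => s0.
  rewrite /g !hdotZl mulrA -expRD -Hw -SD // (addrC h).
  by congr (expR _ * _); ring.
have Igh : mu.-integrable `[0, +oo[ (EFin \o (fun s => g (s + h))).
  have := integrableZl (mD 0) (expR (- (alpha * h))) (proj1 (resolvent_weak x w)).
  apply: eq_integrable => // s; rewrite inE /= in_itv /= andbT => s0.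
  rewrite /= -EFinM /g !hdotZl mulrA -expRD -Hw -SD // (addrC h).
  by congr ((expR _ * _)%:E); ring.
rewrite RintegralZl // Rintegral_shift //; congr (_ * _).
rewrite (_ : `[0, +oo[%classic = `[0, h[%classic `|` `[h, +oo[%classic); last first.
  by rewrite -itv_bndbnd_setU ?bnd_simp.
rewrite Rintegral_setU //.
- by rewrite /g addrC addKr.
- by rewrite -itv_bndbnd_setU ?bnd_simp.
- apply/disj_setPS => s [] /=; rewrite !in_itv /= andbT => /andP[_ sh].
  by rewrite leNgt sh.
Qed.

Let alpha0 : 0 < alpha. Proof. exact: le_lt_trans b0_lt_alpha. Qed.

Let expR_sub1 (y : R) : 0 <= y -> y <= expR y - 1 <= y * expR y.
Proof.
move=> y0; rewrite lerBrDl expR_ge1Dx /= lerBlDr -lerBlDl -{1}[expR y]mul1r -mulrBl.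
rewrite -(ler_pM2r (expR_gt0 (- y))) -mulrA -expRD subrr expR0 mulr1 mul1r.
exact: expR_ge1Dx.
Qed.

(** Mean value estimate for the lost piece, used with [v = 0] for the Lipschitz bound and with
    [v = x] for the generator. *)
Let semigroup_resolvent_dist h x z (v : V) omega : 0 < h -> 0 <= omega ->
  (forall s, 0 <= s < h -> `|expR (- alpha * s) *: S s x - v| <= omega) ->
  `|(\int[mu]_(s in `[0, h[) '[expR (- alpha * s) *: S s x, z]) - h * '[v, z]|
    <= h * (omega * `|z|).
Proof.
move=> h0 w0 H.
have mh : measurable (`[0, h[%classic : set (measurableTypeR R)) by exact: measurable_itv.
have Iz := proj1 (resolvent_weak x z).
have Ig' : mu.-integrable `[0, h[ (EFin \o (fun s => '[expR (- alpha * s) *: S s x, z])).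
  by apply: integrableS Iz => // s; rewrite /= !in_itv /= andbT => /andP[].
have muh : mu `[0, h[%classic = h%:E.
  by rewrite lebesgue_measure_itv /= lte_fin h0 oppr0 addr0.
have Ic (c : R) : mu.-integrable `[0, h[ (EFin \o (fun=> c)).
  apply: (bounded_integrable (C := `|c|)) => //.
  by rewrite [X in (X < _)%E]muh ltry.
have cstE (c : R) : \int[mu]_(s in `[0, h[) c = h * c.
  by rewrite Rintegral_cst // [X in _ * fine X]muh mulrC.
rewrite -cstE -RintegralB // -cstE.
have IB : mu.-integrable `[0, h[ (EFin \o (fun s => '[expR (- alpha * s) *: S s x, z] - '[v, z])).
  by have := integrableB mh Ig' (Ic '[v, z]); apply: eq_integrable.
apply: le_trans (le_normr_Rintegral mh IB) _.
apply: le_Rintegral => //.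
  by have := integrable_norm IB; apply: eq_integrable.
move=> s; rewrite /= in_itv /= => sh; rewrite -hdotBl.
apply: le_trans (hdot_CauchySchwarz _ _) _.
by rewrite ler_wpM2r // H.
Qed.

Lemma resolvent_increment tau : 0 <= tau -> exists2 K, 0 <= K &
  forall h x, 0 <= h <= tau -> `|S h (U x) - U x| <= K * h * `|x|.
Proof.
move=> tau0; have [C C0 UC] := resolvent_le.
(* By [semigroup_resolvent] the increment is [(e^(alpha h) - 1) U x] minus [e^(alpha h)] times an
   integral over [[0, h[]. They contribute [alpha C] and [c0], each times [e^(alpha tau) h |x|]. *)
exists (expR (alpha * tau) * (alpha * C + c0)) => [|h x /andP[h0 ht]].
  by rewrite mulr_ge0 ?expR_ge0 // addr_ge0 // mulr_ge0 // ltW.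
have [->|hn0] := eqVneq h 0; first by case: C0S => -> _ _ _; rewrite subrr normr0 mulr0 mul0r.
have hp : 0 < h by rewrite lt_neqAle eq_sym hn0.
apply: norm_le_hdot => [|z].
  by rewrite !mulr_ge0 ?expR_ge0 // addr_ge0 // mulr_ge0 // ltW.
rewrite hdotBl semigroup_resolvent //.
have := @semigroup_resolvent_dist h x z 0 (c0 * `|x|) hp (mulr_ge0 c0_ge0 (normr_ge0 _)).
rewrite hdot0l mulr0 subr0; set I := Rintegral _ _ _ => HI.
have {}HI : `|I| <= h * (c0 * `|x| * `|z|).
  apply: HI => s /andP[s0 _]; rewrite subr0; apply: le_trans (resolvent_integrand_le _ s0) _.
  rewrite ler_piMr ?mulr_ge0 // -expR0 ler_expR mulNr oppr_le0 mulr_ge0 //; exact: ltW.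
have h1 := le_trans (ler_norm _) (hdot_CauchySchwarz (U x) z).
have /andP[e1 e2] : alpha * h <= expR (alpha * h) - 1 <= alpha * h * expR (alpha * h).
  by apply: expR_sub1; rewrite mulr_ge0 // ltW.
have e3 : expR (alpha * h) <= expR (alpha * tau) by rewrite ler_expR ler_pM2l.
have ah0 : 0 <= alpha * h by rewrite mulr_ge0 // ltW.
have h2 : (expR (alpha * h) - 1) * '[U x, z] <= expR (alpha * tau) * (alpha * h * (C * `|x| * `|z|)).
  apply: le_trans (_ : (expR (alpha * h) - 1) * (C * `|x| * `|z|) <= _).
    by rewrite ler_wpM2l ?(le_trans ah0) //; apply: le_trans h1 _; rewrite ler_wpM2r.
  rewrite mulrA ler_wpM2r ?mulr_ge0 //; apply: le_trans e2 _.
  by rewrite mulrC ler_wpM2r.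
have h3 : - (expR (alpha * h) * I) <= expR (alpha * tau) * (h * (c0 * `|x| * `|z|)).
  rewrite -mulrN; apply: le_trans (_ : expR (alpha * h) * `|I| <= _).
    by rewrite ler_wpM2l ?expR_ge0 // -normrN ler_norm.
  by rewrite ler_pM ?expR_ge0.
apply: le_trans (_ : (expR (alpha * h) - 1) * '[U x, z] + - (expR (alpha * h) * I) <= _).
  by rewrite le_eqVlt; apply/orP; left; apply/eqP; ring.
apply: le_trans (lerD h2 h3) _.
by rewrite le_eqVlt; apply/orP; left; apply/eqP; ring.
Qed.

(** [U] maps into the domain of the generator [A], with [A U = alpha U - 1]. Pairings with [z] are
    estimated with errors proportional to [|z|], which gives convergence in norm. *)
Lemma resolvent_generator x :
  h^-1 *: (S h (U x) - U x) @[h --> 0^'+] --> alpha *: U x - x.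
Proof.
case: (C0S) => S0 _ _ Sl.
apply/cvgrPdist_le => eps eps0.
pose M := alpha * `|U x| + `|x|.
have M0 : 0 <= M by rewrite addr_ge0 // mulr_ge0 // ltW.
have ec (c : R) : expR (c * h) @[h --> 0^'+] --> (1 : R).
  rewrite -(@expR0 R); apply: cvg_at_right_filter; apply: continuous_cvg; first exact: continuous_expR.
  have H : c * h @[h --> (0 : R)] --> c * 0 by exact: cvgMr.
  by rewrite mulr0 in H.
have fx : expR (- alpha * s) *: S s x @[s --> 0^'+] --> x.
  rewrite -[X in _ --> X]scale1r; apply: cvgZ => //.
have e4 : 0 < eps / 4 by rewrite divr_gt0.
have /cvgrPdist_lt /(_ _ e4) [d /= d0 Hd] := fx.
(* The error splits in three. The prefactor [e^(alpha h) <= 2] turns [eps / 4] into [eps / 2]; the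
   two terms carrying [e^(alpha h) - 1] total at most [(e^(alpha h) - 1) M |z|], where the
   coefficient of [|z|] is at most [eps / 2]. *)
have e5 : 0 < Num.min 1 (eps / 2 / (M + 1)).
  by rewrite lt_min ltr01 /= !divr_gt0 // ltr_wpDl.
move/cvgrPdist_lt : (ec alpha) => /(_ _ e5) {}ec.
near=> h.
have h0 : 0 < h by near: h; exact: nbhs_right_gt.
have hd : h < d by near: h; exact: nbhs_right_lt.
have hec : `|1 - expR (alpha * h)| < Num.min 1 (eps / 2 / (M + 1)) by near: h.
have /andP[e1 e2] : alpha * h <= expR (alpha * h) - 1 <= alpha * h * expR (alpha * h).
  by apply: expR_sub1; rewrite mulr_ge0 // ltW.
have ah0 : 0 < alpha * h by rewrite mulr_gt0.
have e10 : 0 <= expR (alpha * h) - 1 by apply: le_trans e1; exact: ltW.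
move: hec; rewrite distrC ger0_norm // lt_min ltr_pdivlMr; last by rewrite ltr_wpDl.
move=> /andP[e21 eM].
rewrite distrC; apply: norm_le_hdot => [|z]; first exact: ltW.
rewrite hdotBl hdotZl !hdotBl hdotZl (@semigroup_resolvent h x z (ltW h0)).
have := @semigroup_resolvent_dist h x z x (eps / 4) h0 (ltW e4).
set I := Rintegral _ _ _ => HI.
have {}HI : `|I - h * '[x, z]| <= h * (eps / 4 * `|z|).
  apply: HI => s /andP[s0 sh].
  have [->|sn0] := eqVneq s 0; first by rewrite mulr0 expR0 scale1r S0 subrr normr0 ltW.
  have sp : 0 < s by rewrite lt_neqAle eq_sym sn0.
  rewrite distrC ltW //; apply: Hd => //.
  by rewrite /= sub0r normrN ger0_norm // (lt_trans sh).
set e := expR (alpha * h) in e1 e2 e10 e21 eM *.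
set u := '[U x, z]; set w := '[x, z] in HI *.
have hu : `|u| <= `|U x| * `|z| by exact: hdot_CauchySchwarz.
have hw : `|w| <= `|x| * `|z| by exact: hdot_CauchySchwarz.
have E : h^-1 * (e * (u - I) - u) - (alpha * u - w) =
   ((e - 1) / h - alpha) * u - e * ((I - h * w) / h) - (e - 1) * w.
  by field; rewrite gt_eqF.
rewrite E.
have h1 : 0 <= (e - 1) / h - alpha <= alpha * (e - 1).
  rewrite subr_ge0 ler_pdivlMr // e1 /= lerBlDl ler_pdivrMr //.
  by apply: le_trans e2 _; rewrite le_eqVlt; apply/orP; left; apply/eqP; ring.
have t1 : ((e - 1) / h - alpha) * u <= alpha * (e - 1) * (`|U x| * `|z|).
  case/andP: h1 => h1 h2; apply: le_trans (ler_norm _) _; rewrite normrM (ger0_norm h1).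
  by rewrite ler_pM.
have t2 : - (e * ((I - h * w) / h)) <= 2 * (eps / 4 * `|z|).
  rewrite -mulrN; apply: le_trans (ler_norm _) _; rewrite normrM normrN.
  have e0 : 0 <= e by lra.
  rewrite ler_pM // ?normr_ge0 //; first by rewrite ger0_norm //; lra.
  have hV : `|h^-1| = h^-1 by rewrite ger0_norm // invr_ge0 ltW.
  by rewrite normrM hV ler_pdivrMr // [leRHS]mulrC.
have t3 : - ((e - 1) * w) <= (e - 1) * (`|x| * `|z|).
  by rewrite -mulrN ler_wpM2l // (le_trans _ hw) // -normrN ler_norm.
apply: le_trans (lerD (lerD t1 t2) t3) _.
have -> : alpha * (e - 1) * (`|U x| * `|z|) + 2 * (eps / 4 * `|z|) + (e - 1) * (`|x| * `|z|) =
  ((e - 1) * M + eps / 2) * `|z| by rewrite /M; field.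
rewrite ler_wpM2r //; move: eM; rewrite mulrDr mulr1; lra.
Unshelve. all: by end_near. Qed.

End resolvent.
End C0.

Lemma cvg_continuous {T : Type} {V W : topologicalType} (F : set_system T) {FF : Filter F}
    (f : V -> W) (u : T -> V) (l : V) :
  continuous f -> u t @[t --> F] --> l -> f (u t) @[t --> F] --> f l.
Proof. by move=> cf ul; apply: (@continuous_cvg _ _ _ _ _ _ f l) => //; exact: cf. Qed.

Lemma bounded_additive_continuous {R : realType} {V W : normedModType R} (L : V -> W) (C : R) :
  (forall x y, L (x - y) = L x - L y) -> (forall x, `|L x| <= C * `|x|) -> continuous L.
Proof.
move=> LB LC x; apply: (cvg_norm_le0 (e := fun y => C * `|y - x|)).
  by apply: nearW => y; rewrite -LB.
rewrite -(mulr0 C); apply: cvgMr; rewrite -(@normr0 _ V) -(subrr x); apply: cvg_norm.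
by apply: cvgB => //; exact: cvg_cst.
Qed.

Lemma normB_sqr_le {R : realType} {V : hilbertType R} (x y : V) :
  `|x - y| ^+ 2 <= 2 * `|x| ^+ 2 + 2 * `|y| ^+ 2.
Proof. by have := sqr_ge0 `|x + y|; rewrite (normD_hilbert x y) (normB_hilbert x y); lra. Qed.

(** * The entrance space and its completion *)

Section entrance_space.
Context {R : realType} {H : hilbertType R}.
Variables (T : R -> {linear H -> H}) (c0 b0 b alpha : R).
Hypotheses (c0_ge0 : 0 <= c0) (b0_ge0 : 0 <= b0) (b0_lt_b : b0 < b)
  (b0_lt_alpha : b0 < alpha)
  (C0T : C0_semigroup T) (growthT : growth_bound T c0 b0).
Variables (Ht : hilbertType R) (ev : Ht -> R -> H).
Hypothesis evP : is_entrance_space T b ev.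

Local Notation mu := (@lebesgue_measure R).
Local Notation pos := (`]0, +oo[%classic : set (measurableTypeR R)).
Local Notation U := (resolvent T alpha).
#[local] Opaque resolvent.

Let mpos : measurable pos. Proof. exact: measurable_itv. Qed.

Let posP s : pos s -> 0 < s.
Proof. by rewrite /= in_itv /= andbT. Qed.

Lemma ev_inj x y : (forall s, 0 < s -> ev x s = ev y s) -> x = y.
Proof. by case: evP => _ _ h _ _; exact: h. Qed.

Lemma ev_shift x r t : 0 < r -> 0 <= t -> ev x (r + t) = T t (ev x r).
Proof.
case: evP => h _ _ _ _ r0; have [p _] := h x.
rewrite le_eqVlt => /predU1P[<-|]; last exact: p.
by case: C0T => -> _ _ _; rewrite addr0.
Qed.

Lemma evD x y s : 0 < s -> ev (x + y) s = ev x s + ev y s.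
Proof. by case: evP => _ _ _ h _ s0; have := h 1 x y s s0; rewrite !scale1r. Qed.

Lemma evB x y s : 0 < s -> ev (x - y) s = ev x s - ev y s.
Proof. by case: evP => _ _ _ h _ s0; have := h (-1) y x s s0; rewrite !scaleN1r addrC => ->; rewrite addrC. Qed.

Lemma evZ c x s : 0 < s -> ev (c *: x) s = c *: ev x s.
Proof.
move=> s0; have e0 : ev 0 s = 0 by rewrite -(subrr x) evB // subrr.
by case: evP => _ _ _ h _; have := h c x 0 s s0; rewrite addr0 e0 addr0.
Qed.

(** Away from 0 a path is an orbit of [T]: it is restarted from the time [s / 2]. *)
Lemma ev_continuous x : {in `]0, +oo[, continuous (ev x)}.
Proof.
move=> s; rewrite in_itv /= andbT => s0.
have r0 : 0 < s / 2 by rewrite divr_gt0.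
have h : T (u - s / 2) (ev x (s / 2)) @[u --> s] --> T (s - s / 2) (ev x (s / 2)).
  apply: (C0_cvg c0_ge0 b0_ge0 C0T growthT).
  - near=> u; rewrite subr_ge0; apply: ltW; near: u.
    by apply: lt_nbhsr; lra.
  - by lra.
  - by apply: cvgB => //; exact: cvg_cst.
have es u : s / 2 <= u -> ev x u = T (u - s / 2) (ev x (s / 2)).
  by move=> su; rewrite -ev_shift ?subr_ge0 // addrC subrK.
rewrite -[X in _ --> X]es in h; last by lra.
apply: cvg_trans h; apply: near_eq_cvg; near=> u.
by rewrite (es u) //; apply: ltW; near: u; apply: lt_nbhsr; lra.
Unshelve. all: by end_near. Qed.

Lemma ev_measurable (g : H -> R) x : continuous g ->
  measurable_fun pos (fun s => g (ev x s)).
Proof.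
move=> cg; apply: open_continuous_measurable_fun; first exact: interval_open.
move=> s s0; apply: continuous_comp; last exact: cg.
by apply: ev_continuous; rewrite inE in s0.
Qed.

Let weight_measurable : measurable_fun pos (fun s => expR (- 2 * b * s)).
Proof.
apply: measurable_funTS; apply: continuous_measurable_fun => s.
apply: continuous_comp; last exact: continuous_expR.
exact: mulrl_continuous.
Qed.

Lemma weighted_measurable (g : H -> R) x : continuous g ->
  measurable_fun pos (fun s => expR (- 2 * b * s) * g (ev x s)).
Proof. by move=> cg; apply: measurable_funM => //; exact: ev_measurable. Qed.

Let normsq_continuous (V : hilbertType R) : continuous (fun x : V => `|x| ^+ 2).
Proof.
have -> : (fun x : V => `|x| ^+ 2) = (fun x => `|x| * `|x|) by apply/funext => x; rewrite expr2.
by move=> x; apply: cvgM; apply: cvg_norm.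
Qed.

(** Below [l] local square integrability applies; beyond [l] the path is an orbit started at time
    [r], and [b > b0] lets the weight beat its growth. Integrability must be established because the
    inner product is a real integral, which takes a default value when it diverges. *)
Lemma weighted_integrable x : mu.-integrable pos
  (EFin \o (fun s => expR (- 2 * b * s) * `|ev x s| ^+ 2)).
Proof.
case: evP => hx _ _ _ _; have [_ [l l0 hl]] := hx x.
pose r := l / 2; have r0 : 0 < r by rewrite divr_gt0.
pose A := `]0, l[%classic : set (measurableTypeR R).
have mA : measurable A by exact: measurable_itv.
have subA : A `<=` pos by move=> s; rewrite /A /= !in_itv /= andbT => /andP[].
have IA : mu.-integrable A (EFin \o (fun s => `|ev x s| ^+ 2)).
  apply/integrableP; split.
    apply/measurable_EFinP; apply: measurable_funS (@ev_measurable (fun v => `|v| ^+ 2) x _) => //.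
  by under eq_integral do rewrite /= ger0_norm ?sqr_ge0 //.
have IA' : mu.-integrable pos (EFin \o ((fun s => `|ev x s| ^+ 2) \_ A)).
  have : mu.-integrable (pos `&` A) (EFin \o (fun s => `|ev x s| ^+ 2)) by rewrite (setIidr subA).
  move=> /(integrable_restrict mu mA mpos).
  by apply: eq_integrable => // s _ /=; rewrite !patchE; case: ifP.
have Iexp : mu.-integrable pos (EFin \o
   (fun s => (c0 * expR (- b0 * r) * `|ev x r|) ^+ 2 * expR (- (2 * (b - b0)) * s))).
  apply: integrableS (integrable_expN _ _) => //.
  - by move=> s; rewrite /= !in_itv /= !andbT; exact: ltW.
  - by rewrite mulr_gt0 // subr_gt0.
apply: (@integrable_dominated _ _ _ mu pos _ (fun s => ((fun s => `|ev x s| ^+ 2) \_ A) s +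
  (c0 * expR (- b0 * r) * `|ev x r|) ^+ 2 * expR (- (2 * (b - b0)) * s))) => //.
- by apply: (weighted_measurable (g := fun v => `|v| ^+ 2)); exact: normsq_continuous.
- move=> s /posP s0; rewrite ger0_norm ?mulr_ge0 ?sqr_ge0 ?expR_ge0 //.
  have b_gt0 : 0 < b by exact: le_lt_trans b0_lt_b.
  have [sl|ls] := ltP s l.
    rewrite patchE mem_set; last by rewrite /A /= in_itv /= s0.
    apply: ler_wpDr; first by rewrite mulr_ge0 ?sqr_ge0 ?expR_ge0.
    rewrite ler_piMl ?sqr_ge0 // -expR0 ler_expR !mulNr oppr_le0.
    by rewrite !mulr_ge0 // ltW.
  rewrite patchE memNset ?add0r; last by rewrite /A /= in_itv /= => /andP[_]; rewrite ltNge ls.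
  have rs : r <= s by apply: le_trans ls; rewrite /r; lra.
  have -> : ev x s = T (s - r) (ev x r) by rewrite -ev_shift ?subr_ge0 // addrC subrK.
  have h : `|T (s - r) (ev x r)| <= c0 * expR (b0 * (s - r)) * `|ev x r|.
    by apply: growthT; rewrite subr_ge0.
  apply: le_trans (_ : expR (- 2 * b * s) * (c0 * expR (b0 * (s - r)) * `|ev x r|) ^+ 2 <= _).
    by rewrite ler_wpM2l ?expR_ge0 // lerXn2r // nnegrE ?mulr_ge0 // expR_ge0.
  rewrite le_eqVlt; apply/orP; left; apply/eqP.
  have -> : b0 * (s - r) = b0 * s + - b0 * r by ring.
  have -> : - (2 * (b - b0)) * s = - 2 * b * s + (b0 * s) * 2%:R by ring.
  by rewrite !expRD expRM_natr; ring.
- by have := integrableD mpos IA' Iexp; apply: eq_integrable.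
Qed.

Lemma entrance_normE x : `|x| ^+ 2 =
  \int[mu]_(s in pos) (expR (- 2 * b * s) * `|ev x s| ^+ 2).
Proof.
case: evP => _ _ _ _ h; rewrite -hdot_norm h; apply: eq_Rintegral => s _.
by rewrite hdot_norm.
Qed.

(** The operators on paths considered below act separately at each time [s], so their norm bounds
    reduce to bounds in [H] through this comparison. *)
Lemma weighted_le (p q : R -> H) C : 0 <= C ->
  measurable_fun pos (fun s => expR (- 2 * b * s) * `|p s| ^+ 2) ->
  mu.-integrable pos (EFin \o (fun s => expR (- 2 * b * s) * `|q s| ^+ 2)) ->
  (forall s, 0 < s -> `|p s| <= C * `|q s|) ->
  mu.-integrable pos (EFin \o (fun s => expR (- 2 * b * s) * `|p s| ^+ 2)) /\
  \int[mu]_(s in pos) (expR (- 2 * b * s) * `|p s| ^+ 2) <=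
  C ^+ 2 * \int[mu]_(s in pos) (expR (- 2 * b * s) * `|q s| ^+ 2).
Proof.
move=> C_ge0 mp Iq pq.
have IC : mu.-integrable pos (EFin \o (fun s => C ^+ 2 * (expR (- 2 * b * s) * `|q s| ^+ 2))).
  by have := integrableZl mpos (C ^+ 2) Iq; apply: eq_integrable.
have le s : pos s -> expR (- 2 * b * s) * `|p s| ^+ 2 <= C ^+ 2 * (expR (- 2 * b * s) * `|q s| ^+ 2).
  move=> /posP s0; rewrite [leRHS]mulrCA ler_wpM2l ?expR_ge0 // -exprMn.
  by rewrite lerXn2r ?pq // nnegrE ?mulr_ge0.
have Ip : mu.-integrable pos (EFin \o (fun s => expR (- 2 * b * s) * `|p s| ^+ 2)).
  apply: integrable_dominated IC => // s /le; rewrite ger0_norm //.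
by split => //; rewrite -RintegralZl //; exact: le_Rintegral.
Qed.

Let U_continuous : continuous U.
Proof.
have [C C_ge0 UC] := resolvent_le c0_ge0 b0_ge0 C0T growthT b0_lt_alpha.
apply: bounded_additive_continuous UC => x y.
exact: (resolventB c0_ge0 b0_ge0 C0T growthT).
Qed.

Variables (Tt : R -> Ht -> Ht).
Hypothesis (TtE : forall t x s, 0 <= t -> 0 < s -> ev (Tt t x) s = ev x (t + s)).

Lemma ev_Tt t x s : 0 <= t -> 0 < s -> ev (Tt t x) s = T t (ev x s).
Proof. by move=> t0 s0; rewrite TtE // addrC ev_shift. Qed.

Lemma Tt0 x : Tt 0 x = x.
Proof. by apply: ev_inj => s s0; rewrite TtE // add0r. Qed.

Lemma Tt_semigroup s t x : 0 <= s -> 0 <= t -> Tt (s + t) x = Tt s (Tt t x).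
Proof.
move=> s0 t0; apply: ev_inj => u u0; rewrite !TtE ?addr_ge0 ?ltr_wpDl //.
by congr (ev x _); ring.
Qed.

Section embedding.
Variable J : H -> Ht.
Hypothesis JE : forall x s, 0 < s -> ev (J x) s = T s x.

Lemma J_ev x t : 0 < t -> J (ev x t) = Tt t x.
Proof.
move=> t0; apply: ev_inj => s s0; rewrite JE // TtE ?ltW // ev_shift //; exact: ltW.
Qed.

Lemma J_D x y : J (x + y) = J x + J y.
Proof. by apply: ev_inj => s s0; rewrite evD // !JE // linearD. Qed.

Lemma J_Z c x : J (c *: x) = c *: J x.
Proof. by apply: ev_inj => s s0; rewrite evZ // !JE // linearZ. Qed.

Lemma J_le : exists2 C, 0 <= C & forall x, `|J x| <= C * `|x|.
Proof.
pose I := \int[mu]_(s in pos) (1 * expR (- (2 * (b - b0)) * s)).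
have I1 : mu.-integrable pos (EFin \o (fun s => 1 * expR (- (2 * (b - b0)) * s))).
  apply: integrableS (integrable_expN _ _) => //.
  - by move=> s; rewrite /= !in_itv /= !andbT; exact: ltW.
  - by rewrite mulr_gt0 // subr_gt0.
have I0 : 0 <= I by apply: Rintegral_ge0 => s _; rewrite mul1r expR_ge0.
exists (c0 * Num.sqrt I) => [|x]; first by rewrite mulr_ge0 ?sqrtr_ge0.
rewrite -(@ler_sqr _ `|J x|) ?nnegrE ?mulr_ge0 ?sqrtr_ge0 // !exprMn sqr_sqrtr //.
rewrite entrance_normE mulrAC -RintegralZl //; apply: le_Rintegral => //.
- exact: weighted_integrable.
- by have := integrableZl mpos (c0 ^+ 2 * `|x| ^+ 2) I1; apply: eq_integrable.
move=> s /posP s0; rewrite JE // mul1r.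
apply: le_trans (_ : expR (- 2 * b * s) * (c0 * expR (b0 * s) * `|x|) ^+ 2 <= _).
  rewrite ler_wpM2l ?expR_ge0 // lerXn2r ?nnegrE ?mulr_ge0 ?expR_ge0 //.
  by apply: growthT; exact: ltW.
rewrite le_eqVlt; apply/orP; left; apply/eqP.
have -> : - (2 * (b - b0)) * s = - 2 * b * s + (b0 * s) * 2%:R by ring.
by rewrite expRD expRM_natr !exprMn; ring.
Qed.

End embedding.

(** * The completion and the extended semigroup *)

Section completion.
Variables (Hb : hilbertType R) (iota : {linear Ht -> Hb}).
Hypothesis iotaP : is_resolvent_completion T b alpha ev iota.

Lemma iota_normE x : `|iota x| ^+ 2 =
  \int[mu]_(s in pos) (expR (- 2 * b * s) * `|U (ev x s)| ^+ 2).
Proof.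
case: iotaP => _ h; rewrite -hdot_norm h; apply: eq_Rintegral => s _.
by rewrite hdot_norm.
Qed.

Let Unorm_measurable x :
  measurable_fun pos (fun s => expR (- 2 * b * s) * `|U (ev x s)| ^+ 2).
Proof.
apply: (weighted_measurable (g := fun v => `|U v| ^+ 2)) => v.
by apply: (@continuous_comp _ _ _ U (fun w : H => `|w| ^+ 2)); [exact: U_continuous|exact: normsq_continuous].
Qed.

Lemma iota_integrable x : mu.-integrable pos
  (EFin \o (fun s => expR (- 2 * b * s) * `|U (ev x s)| ^+ 2)).
Proof.
have [C C_ge0 UC] := resolvent_le c0_ge0 b0_ge0 C0T growthT b0_lt_alpha.
by have [] := weighted_le C_ge0 (Unorm_measurable x) (weighted_integrable x) (fun s _ => UC (ev x s)).
Qed.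

Let sqr_le (p q C : R) : 0 <= C -> 0 <= p -> 0 <= q -> p ^+ 2 <= C ^+ 2 * q ^+ 2 -> p <= C * q.
Proof. by move=> C_ge0 p0 q0; rewrite -exprMn ler_sqr // nnegrE mulr_ge0. Qed.

Lemma iota_le : exists2 C, 0 <= C & forall x, `|iota x| <= C * `|x|.
Proof.
have [C C_ge0 UC] := resolvent_le c0_ge0 b0_ge0 C0T growthT b0_lt_alpha.
exists C => // x; apply: sqr_le => //; rewrite iota_normE entrance_normE.
by have [] := weighted_le C_ge0 (Unorm_measurable x) (weighted_integrable x) (fun s _ => UC (ev x s)).
Qed.

(** [U] commutes with [T t], so the bound of [T t] passes unchanged to the norm of the
    completion. *)
Lemma iota_Tt_le t x : 0 <= t -> `|iota (Tt t x)| <= c0 * expR (b0 * t) * `|iota x|.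
Proof.
move=> t0; have C_ge0 : 0 <= c0 * expR (b0 * t) by rewrite mulr_ge0 ?expR_ge0.
apply: sqr_le => //; rewrite !iota_normE.
have [] // := weighted_le C_ge0 (Unorm_measurable (Tt t x)) (iota_integrable x) _.
move=> s s0; rewrite ev_Tt // -(resolvent_commute c0_ge0 b0_ge0 C0T growthT) //.
exact: growthT.
Qed.

Lemma iota_Tt_increment tau : 0 <= tau -> exists2 K, 0 <= K &
  forall h x, 0 <= h <= tau -> `|iota (Tt h x) - iota x| <= K * h * `|x|.
Proof.
move=> tau0; have [K K_ge0 HK] := resolvent_increment c0_ge0 b0_ge0 C0T growthT b0_lt_alpha tau0.
exists K => // h x hh; have h0 : 0 <= h by case/andP: hh.
have C_ge0 : 0 <= K * h by rewrite mulr_ge0.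
rewrite -linearB; apply: sqr_le => //; rewrite iota_normE entrance_normE.
have [] // := weighted_le C_ge0 (Unorm_measurable (Tt h x - x)) (weighted_integrable x) _.
move=> s s0; rewrite evB // (resolventB c0_ge0 b0_ge0 C0T growthT) //.
by rewrite ev_Tt // -(resolvent_commute c0_ge0 b0_ge0 C0T growthT) // HK.
Qed.

(** In [H], after applying [U], the quotient at each time converges to [alpha U y - y] with
    deviation [D h y]. The distance between two quotients in [Hb] is controlled by the weighted
    norms [q] of these deviations, so the quotients are Cauchy. *)
Lemma iota_Tt_diffquot_cvg x :
  cvg (h^-1 *: (iota (Tt h x) - iota x) @[h --> 0^'+]).
Proof.
have [C C_ge0 UC] := resolvent_le c0_ge0 b0_ge0 C0T growthT b0_lt_alpha.
have [K K_ge0 HK] := resolvent_increment c0_ge0 b0_ge0 C0T growthT b0_lt_alpha (@ler01 R).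
have a0 : 0 < alpha by exact: le_lt_trans b0_lt_alpha.
pose D h (y : H) := h^-1 *: (T h (U y) - U y) - (alpha *: U y - y).
pose K' := K + (alpha * C + 1).
have K'0 : 0 <= K' by rewrite !addr_ge0 // mulr_ge0 // ltW.
have DK h y : 0 < h <= 1 -> `|D h y| <= K' * `|y|.
  move=> /andP[h0 h1]; rewrite /D /K' mulrDl.
  apply: le_trans (ler_normB _ _) (lerD _ _).
    rewrite normrZ gtr0_norm ?invr_gt0 // ler_pdivrMl // mulrA (mulrC h).
    by apply: HK; rewrite ltW.
  apply: le_trans (ler_normB _ _) _; rewrite mulrDl mul1r lerD2r.
  by rewrite normrZ gtr0_norm // -mulrA ler_pM2l.
have Dcont h : 0 < h <= 1 -> continuous (D h).
  move=> /andP[/ltW h0 _] y; have Uy := @U_continuous y.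
  have Th : continuous (T h) by case: C0T => _ _ + _; apply.
  apply: cvgB; last by apply: cvgB => //; apply: cvgZ; [exact: cvg_cst|exact: Uy].
  apply: cvgZ; first exact: cvg_cst.
  apply: cvgB => //; apply: (@continuous_comp _ _ _ U (T h)) => //; exact: Th.
pose q h := \int[mu]_(s in pos) (expR (- 2 * b * s) * `|D h (ev x s)| ^+ 2).
have mDev h : 0 < h <= 1 -> measurable_fun pos (fun s => expR (- 2 * b * s) * `|D h (ev x s)| ^+ 2).
  move=> hh; apply: (weighted_measurable (g := fun v => `|D h v| ^+ 2)) => v.
  by apply: (@continuous_comp _ _ _ (D h) (fun w : H => `|w| ^+ 2)); [exact: Dcont|exact: normsq_continuous].
have IDev h : 0 < h <= 1 -> mu.-integrable pos (EFin \o (fun s => expR (- 2 * b * s) * `|D h (ev x s)| ^+ 2)).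
  move=> hh.
  by have [] := weighted_le K'0 (mDev h hh) (weighted_integrable x) (fun s _ => DK h (ev x s) hh).
(* Dominated convergence along arbitrary positive sequences tending to 0, shifted by [N] because the
   bound [DK] concerns steps of at most 1. *)
have qcvg : q h @[h --> 0^'+] --> 0.
  apply/cvg_at_rightP => u [u0 uc].
  have [N _ HN] : \forall n \near \oo, u n <= 1.
    by move/cvgrPdist_lt : uc => /(_ 1 ltr01); apply: filterS => n; rewrite sub0r normrN gtr0_norm // => /ltW.
  rewrite -(cvg_shiftn N).
  have uN n : 0 < u (n + N)%N <= 1 by rewrite u0 HN //= leq_addl.
  have [] := @Rdominated_convergence _ _ _ mu pos
     (fun n s => expR (- 2 * b * s) * `|D (u (n + N)%N) (ev x s)| ^+ 2) (fun=> 0)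
     (fun s => K' ^+ 2 * (expR (- 2 * b * s) * `|ev x s| ^+ 2)) mpos.
  - by move=> n; exact: mDev.
  - move=> s _; rewrite -(mulr0 (expR (- 2 * b * s))); apply: cvgMr.
    have h1 : D (u (n + N)%N) (ev x s) @[n --> \oo] --> (0 : H).
      rewrite (cvg_shiftn N (fun n => D (u n) (ev x s))).
      have h2 : D h (ev x s) @[h --> 0^'+] --> (0 : H).
        rewrite -(subrr (alpha *: U (ev x s) - ev x s)); apply: cvgB; last exact: cvg_cst.
        exact: (resolvent_generator c0_ge0 b0_ge0 C0T growthT).
      apply: cvg_trans h2 => A /= [e e0 He].
      move/cvgrPdist_lt : uc => /(_ e e0) [M _ HM]; exists M => // n Mn /=.
      apply: He => //; exact: HM.
    have h2 : `|D (u (n + N)%N) (ev x s)| ^+ 2 @[n --> \oo] --> `|0 : H| ^+ 2.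
      by apply: (cvg_continuous (f := fun w : H => `|w| ^+ 2)) h1; exact: normsq_continuous.
    by rewrite normr0 expr0n /= in h2.
  - by have := integrableZl mpos (K' ^+ 2) (weighted_integrable x); apply: eq_integrable.
  - move=> n s /posP s0; rewrite ger0_norm ?mulr_ge0 ?sqr_ge0 ?expR_ge0 //.
    rewrite [leRHS]mulrCA ler_wpM2l ?expR_ge0 // -exprMn lerXn2r ?nnegrE ?mulr_ge0 //.
    exact: DK.
  by move=> _ _; rewrite Rintegral_cst // mul0r.
have q_ge0 h : 0 <= q h by apply: Rintegral_ge0 => s _; rewrite mulr_ge0 ?sqr_ge0 ?expR_ge0.
pose F h := h^-1 *: (iota (Tt h x) - iota x).
have Fdist h k : 0 < h <= 1 -> 0 < k <= 1 -> `|F h - F k| <= Num.sqrt (2 * q h + 2 * q k).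
  move=> hh kk; have /andP[h0 _] := hh; have /andP[k0 _] := kk.
  rewrite -[X in X <= _](@ger0_norm R) // -sqrtr_sqr ler_wsqrtr //.
  have -> : F h - F k = iota (h^-1 *: (Tt h x - x) - k^-1 *: (Tt k x - x)).
    have iB a c : iota (a - c) = iota a - iota c by exact: linearB.
    have iZ l a : iota (l *: a) = l *: iota a by exact: linearZ.
    by rewrite /F iB !iZ !iB.
  set y := _ - _; rewrite iota_normE /q.
  have Ih := integrableZl mpos 2 (IDev h hh); have Ik := integrableZl mpos 2 (IDev k kk).
  rewrite -!RintegralZl //; [|exact: IDev|exact: IDev]; rewrite -RintegralD //.
  apply: le_Rintegral => //; first exact: iota_integrable.
    by have := integrableD mpos Ih Ik; apply: eq_integrable.
  move=> s /posP s0.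
  have -> : U (ev y s) = D h (ev x s) - D k (ev x s).
    have UB := resolventB c0_ge0 b0_ge0 C0T growthT b0_lt_alpha.
    have UZ := resolventZ c0_ge0 b0_ge0 C0T growthT b0_lt_alpha.
    have Uc := resolvent_commute c0_ge0 b0_ge0 C0T growthT b0_lt_alpha.
    rewrite /y evB // !evZ // !evB // !ev_Tt // ?ltW // UB !UZ !UB -!Uc ?ltW //.
    by apply: hdot_inj => v; rewrite /D !hdotBl; ring.
  have le2 : `|D h (ev x s) - D k (ev x s)| ^+ 2 <= 2 * `|D h (ev x s)| ^+ 2 + 2 * `|D k (ev x s)| ^+ 2.
    exact: normB_sqr_le.
  by have := ler_wpM2l (expR_ge0 (- 2 * b * s)) le2; lra.
apply/cauchy_cvgP/cauchyP => e e0.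
(* With both values of [q] below [e^2 / 5], the bound [Fdist] stays below [e]. *)
have e4 : 0 < e ^+ 2 / 5 by rewrite divr_gt0 // exprn_gt0.
move/cvgrPdist_lt : qcvg => /(_ _ e4) qe.
have qe' : \forall h \near 0^'+, q h < e ^+ 2 / 5.
  by apply: filterS qe => h; rewrite sub0r normrN ger0_norm.
have near1 : \forall h \near (0 : R)^'+, 0 < h <= 1.
  by apply: filterS2 (nbhs_right_gt (0 : R)) (nbhs_right_le (@ltr01 R)) => h -> ->.
have [k [k1 qk]] : exists k, 0 < k <= 1 /\ q k < e ^+ 2 / 5.
  exact: (@filter_ex _ _ (at_right_proper_filter (0 : R)) _ (filterI near1 qe')).
exists (F k); apply: filterS2 near1 qe' => h hh qh; rewrite -ball_normE /= -/(F h).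
apply: le_lt_trans (Fdist _ _ k1 hh) _.
rewrite -[X in _ < X](@ger0_norm R) ?ltW // -sqrtr_sqr ltr_sqrt ?exprn_gt0 //; lra.
Qed.

Section extension.
Variable (Tb : R -> {linear Hb -> Hb}).
Hypotheses (Tb_cont : forall t, 0 <= t -> continuous (Tb t))
  (TbE : forall t x, 0 <= t -> Tb t (iota x) = iota (Tt t x)).

Lemma iota_dense (z : Hb) (e : R) : 0 < e -> exists x, `|z - iota x| < e.
Proof.
case: iotaP => dr _ e0.
have [y [zy [x _ xy]]] := dr (ball z e) (ex_intro _ z (ballxx z e0)) (ball_open z e).
by exists x; rewrite xy; move: zy; rewrite -ball_normE.
Qed.

Lemma iota_seq (z : Hb) : exists x : nat -> Ht, iota (x n) @[n --> \oo] --> z.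
Proof.
pose x n := projT1 (cid (iota_dense z (invn_gt0 n))).
exists x; apply: (cvg_norm_le0 (e := fun n => n.+1%:R^-1)); last exact: cvgn_inv_nat.
apply: nearW => n; rewrite distrC; apply: ltW.
exact: (projT2 (cid (iota_dense z (invn_gt0 n)))).
Qed.

Lemma Tb_growth : growth_bound Tb c0 b0.
Proof.
move=> t z t0; have [x xz] := iota_seq z.
have h1 : `|Tb t (iota (x n))| @[n --> \oo] --> `|Tb t z|.
  by apply: cvg_norm; apply: (cvg_continuous (f := Tb t)) xz; exact: Tb_cont.
have h2 : c0 * expR (b0 * t) * `|iota (x n)| @[n --> \oo] --> c0 * expR (b0 * t) * `|z|.
  by apply: cvgMr; exact: cvg_norm.
apply: (ler_cvg_to h1 h2); apply: nearW => n; rewrite TbE //.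
exact: iota_Tt_le.
Qed.

(** The algebraic laws extend from the dense range of [iota] by continuity. For strong continuity at
    0, [z] is approximated by [iota x], on which the semigroup is Lipschitz, and the remainder is
    controlled by a bound uniform in [h <= 1]. *)
Lemma Tb_C0 : C0_semigroup Tb.
Proof.
split => //.
- move=> z; have [x xz] := iota_seq z.
  have h1 : Tb 0 (iota (x n)) @[n --> \oo] --> Tb 0 z.
    by apply: (cvg_continuous (f := Tb 0)) xz; exact: Tb_cont.
  have E : (fun n => Tb 0 (iota (x n))) = (fun n => iota (x n)).
    by apply/funext => n; rewrite TbE // Tt0.
  by rewrite E in h1; exact: (cvg_unique _ h1).
- move=> s t z s0 t0; have [x xz] := iota_seq z.
  have h1 : Tb (s + t) (iota (x n)) @[n --> \oo] --> Tb (s + t) z.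
    by apply: (cvg_continuous (f := Tb (s + t))) xz; apply: Tb_cont; exact: addr_ge0.
  have h2 : Tb s (Tb t (iota (x n))) @[n --> \oo] --> Tb s (Tb t z).
    apply: (cvg_continuous (f := Tb s)); first exact: Tb_cont.
    by apply: (cvg_continuous (f := Tb t)) xz; exact: Tb_cont.
  have E : (fun n => Tb (s + t) (iota (x n))) = (fun n => Tb s (Tb t (iota (x n)))).
    by apply/funext => n; rewrite !TbE ?addr_ge0 // Tt_semigroup.
  by rewrite E in h1; exact: (cvg_unique _ h1).
- move=> z; apply/cvgrPdist_lt => e e0.
  (* [M - 1] bounds [Tb h] for [h <= 1], so the two terms in [z - iota x] total at most
     [M |z - iota x| < e / 3]. *)
  pose M := c0 * expR (b0 * 1) + 1.
  have M0 : 0 < M by rewrite ltr_wpDl // mulr_ge0 // expR_ge0.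
  have [x zx] := @iota_dense z (e / (3 * M)) (divr_gt0 e0 (mulr_gt0 (ltr0n _ 3) M0)).
  have [K K_ge0 HK] := iota_Tt_increment (@ler01 R).
  pose N := K * `|x| + 1.
  have N0 : 0 < N by rewrite ltr_wpDl // mulr_ge0.
  near=> h.
  have h0 : 0 < h by near: h; exact: nbhs_right_gt.
  have h1 : h <= 1 by near: h; exact: nbhs_right_le.
  have h2 : h < e / (3 * N) by near: h; apply: nbhs_right_lt; rewrite divr_gt0 // mulr_gt0.
  have -> : z - Tb h z = (z - iota x) - Tb h (z - iota x) - (iota (Tt h x) - iota x).
    by rewrite linearB TbE ?ltW //; apply: hdot_inj => v; rewrite !hdotBl; ring.
  have h3 := Tb_growth (z - iota x) (ltW h0).
  have h4 := HK h x (@introT _ _ andP (conj (ltW h0) h1)).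
  have h5 : c0 * expR (b0 * h) <= M - 1.
    by rewrite /M addrK ler_wpM2l // ler_expR ler_wpM2l.
  have h6 : (M - 1) * `|z - iota x| + `|z - iota x| < e / 3.
    rewrite mulrBl mul1r subrK mulrC -ltr_pdivlMr //; apply: lt_le_trans zx _.
    by rewrite le_eqVlt; apply/orP; left; apply/eqP; field; rewrite gt_eqF.
  have h7 : c0 * expR (b0 * h) * `|z - iota x| <= (M - 1) * `|z - iota x| by rewrite ler_wpM2r.
  have h8 : K * h * `|x| < e / 3.
    apply: (@le_lt_trans _ _ (N * h)); first by rewrite /N mulrDl mulrAC lerDl mul1r ltW.
    rewrite mulrC -ltr_pdivlMr //; apply: lt_le_trans h2 _.
    by rewrite le_eqVlt; apply/orP; left; apply/eqP; field; rewrite gt_eqF.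
  apply: le_lt_trans (ler_normB _ _) _; have := ler_normB (z - iota x) (Tb h (z - iota x)).
  lra.
Unshelve. all: by end_near. Qed.

(** [generator] is a bare [lim]; this makes it a true limit on the range of [iota]. *)
Lemma generator_cvg x :
  h^-1 *: (Tb h (iota x) - iota x) @[h --> 0^'+] --> generator Tb (iota x).
Proof.
set l := lim (h^-1 *: (iota (Tt h x) - iota x) @[h --> (0 : R)^'+]).
have hl : h^-1 *: (iota (Tt h x) - iota x) @[h --> (0 : R)^'+] --> l.
  exact: iota_Tt_diffquot_cvg.
have h2 : h^-1 *: (Tb h (iota x) - iota x) @[h --> 0^'+] --> l.
  apply: cvg_trans hl; apply: near_eq_cvg; near=> h.
  by rewrite TbE //; apply: ltW; near: h; exact: nbhs_right_gt.
by rewrite /generator (cvg_lim _ h2).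
Unshelve. all: by end_near. Qed.

Lemma Tb_increment tau : 0 <= tau -> exists2 K, 0 <= K &
  forall r s x, 0 <= r -> r <= s -> s <= tau ->
    `|Tb s (iota x) - Tb r (iota x)| <= K * (s - r) * `|x|.
Proof.
move=> tau0; have [K K_ge0 HK] := iota_Tt_increment tau0.
exists (c0 * expR (b0 * tau) * K) => [|r s x r0 rs st].
  by rewrite !mulr_ge0 // expR_ge0.
have [_ TD _ _] := Tb_C0.
have -> : Tb s (iota x) = Tb r (Tb (s - r) (iota x)) by rewrite -TD ?subr_ge0 // addrC subrK.
rewrite -linearB; apply: le_trans (Tb_growth _ r0) _.
rewrite TbE ?subr_ge0 // -!mulrA mulrA [leRHS]mulrA; apply: ler_pM => //.
- by rewrite mulr_ge0 // expR_ge0.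
- by rewrite ler_wpM2l // ler_expR ler_wpM2l // (le_trans rs).
- by rewrite mulrA HK // subr_ge0 rs /= lerBlDr ler_wpDr.
Qed.

End extension.

(** Density of the countable set [iota (J (u n))] in three steps of [e / 3]: from [z] to some
    [iota x], then to [iota (Tt h x)] for small [h], which equals [iota (J (ev x h))], then to some
    [iota (J (u n))]. *)
Lemma completion_separable (J : H -> Ht) :
  (forall x s, 0 < s -> ev (J x) s = T s x) -> separable H -> separable Hb.
Proof.
move=> JE sH; have [u du] := separable_seq sH.
have [CJ CJ0 HJ] := J_le JE; have [Ci Ci0 Hi] := iota_le.
exists (range (fun n => iota (J (u n)))); split.
  apply: (@card_le_trans _ _ _ [set: nat]); first exact: card_image_le.
  exact: card_lexx.
move=> O [z Oz] oO.
have /nbhs_ballP[e /= e0 ze] := open_nbhs_nbhs (conj oO Oz).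
have e3 : 0 < e / 3 by rewrite divr_gt0.
have [x zx] := iota_dense z e3.
have [K K_ge0 HK] := iota_Tt_increment (@ler01 R).
pose N := K * `|x| + 1.
have N0 : 0 < N by rewrite ltr_wpDl // mulr_ge0.
(* Chosen so that [h <= 1] and [K h |x| < e / 3]. *)
pose h := Num.min 1 (e / 3 / (2 * N)).
have h0 : 0 < h by rewrite lt_min ltr01 /= !divr_gt0 // mulr_gt0.
have h1 : h <= 1 by rewrite ge_min lexx.
have h2 : h * (2 * N) <= e / 3 by rewrite -ler_pdivlMr ?mulr_gt0 // ge_min lexx orbT.
have h3 := HK h x (@introT _ _ andP (conj (ltW h0) h1)).
pose M := Ci * CJ + 1.
have M0 : 0 < M by rewrite ltr_wpDl // mulr_ge0.
have [n hn] := du (ev x h) (e / 3 / M) (divr_gt0 e3 M0).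
exists (iota (J (u n))); split; last by exists n.
apply: ze; rewrite -ball_normE /=.
have h4 : `|iota (J (ev x h)) - iota (J (u n))| < e / 3.
  have JB v w : J (v - w) = J v - J w.
    by rewrite -scaleN1r (J_D JE) (J_Z JE) scaleN1r.
  rewrite -linearB -JB; apply: le_lt_trans (Hi _) _.
  apply: le_lt_trans (ler_wpM2l Ci0 (HJ _)) _.
  rewrite mulrA; apply: (@le_lt_trans _ _ (M * `|ev x h - u n|)).
    by rewrite ler_wpM2r // /M lerDl.
  by rewrite mulrC -ltr_pdivlMr.
have h5 : `|iota (Tt h x) - iota x| < e / 3.
  apply: le_lt_trans h3 _; apply: lt_le_trans h2.
  rewrite mulrAC mulrC ltr_pM2l // /N.
  have : 0 <= K * `|x| by rewrite mulr_ge0.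
  by set k := K * `|x|; lra.
have -> : z - iota (J (u n)) = (z - iota x) - (iota (Tt h x) - iota x) +
   (iota (J (ev x h)) - iota (J (u n))).
  by rewrite (J_ev JE) //; apply: hdot_inj => v; rewrite !hdotBl hdotDl !hdotBl; ring.
apply: le_lt_trans (ler_normD _ _) _; have := ler_normB (z - iota x) (iota (Tt h x) - iota x).
lra.
Qed.

End completion.

End entrance_space.

(** * Independence *)

Section image_and_independence.
Context {R : realType} {d1 d2 : measure_display} {T1 : measurableType d1} {T2 : measurableType d2}.
Variable (P : probability T1 R).

Lemma expect_image (m : probability T2 R) (X : T1 -> T2) (f : T2 -> R) :
  measurable_fun setT X -> is_image P X m -> bmeas f ->
  \int[m]_(y in setT) f y = \int[P]_(x in setT) f (X x).
Proof.
move=> mX im [mf [C fC]]; rewrite /Rintegral; congr fine.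
rewrite (@eq_measure_integral _ _ _ setT (pushforward P X)) => [|A mA _]; last exact: im.
rewrite integral_pushforward //; first by apply/measurable_EFinP.
by apply: bmeas_integrable; split; [exact: measurableT_comp|exists C].
Qed.

Lemma sum_below_natE (n m : nat) : (\sum_(k < n) ((k < m)%N : nat) = minn m n)%N.
Proof.
elim: n => [|n ih]; first by rewrite big_ord0 minn0.
rewrite big_ord_recr /= ih; case: (ltnP n m) => nm.
  by rewrite (minn_idPr nm) addn1.
by rewrite (minn_idPl (leqW nm)) addn0.
Qed.

(* The sum is the integer part of [n.+1%:R * y] divided by [n.+1]. *)
Lemma layer_sum_cvg (y : R) : 0 <= y <= 1 ->
  \sum_(k < n.+1) n.+1%:R^-1 * (k.+1%:R / n.+1%:R <= y)%R%:R @[n --> \oo] --> y.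
Proof.
move=> /andP[y0 y1].
apply: (@cvg_norm_le0 R R^o _ _ _ _ _ (fun n => n.+1%:R^-1)); last exact: cvgn_inv_nat.
apply: nearW => n; set N : R := n.+1%:R.
have N0 : 0 < N by rewrite /N.
have -> : \sum_(k < n.+1) N^-1 * (k.+1%:R / N <= y)%R%:R = N^-1 * (Num.truncn (N * y))%:R.
  rewrite -mulr_sumr; congr (_ * _).
  have Ny : 0 <= N * y by rewrite mulr_ge0 // ltW.
  have h (k : nat) : (k.+1%:R / N <= y) = (k < Num.truncn (N * y))%N.
    by rewrite ler_pdivrMr // mulrC truncn_ge_nat.
  under eq_bigr do rewrite h.
  rewrite -natr_sum sum_below_natE (minn_idPl _) //.
  rewrite leqNgt -h -ltNge ltr_pdivlMr //; apply: (@le_lt_trans _ _ N).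
    by rewrite ler_piMl // ltW.
  by rewrite /N ltr_nat.
have /truncn_itv/andP[h1 h2] : 0 <= N * y by rewrite mulr_ge0 // ltW.
have -> : N^-1 * (Num.truncn (N * y))%:R - y = N^-1 * ((Num.truncn (N * y))%:R - N * y).
  by rewrite mulrBr mulrA mulVf ?mul1r // gt_eqF.
have Ni : 0 <= N^-1 by rewrite invr_ge0 ltW.
rewrite normrM (ger0_norm Ni) ler_piMr //.
by rewrite ler_norml; move: h1 h2; rewrite -natr1; lra.
Qed.

(* Layer-cake approximation of [f] by indicators. *)
Lemma expect_indep (g : T1 -> R) (Z : T1 -> T2) (f : T2 -> R) :
  bmeas g -> measurable_fun setT Z ->
  (forall B, measurable B -> \int[P]_(x in setT) (g x * \1_B (Z x)) =
     \int[P]_(x in setT) g x * \int[P]_(x in setT) \1_B (Z x)) ->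
  bmeas f ->
  \int[P]_(x in setT) (g x * f (Z x)) =
    \int[P]_(x in setT) g x * \int[P]_(x in setT) f (Z x).
Proof.
move=> bg mZ gZ.
have bZ h : bmeas h -> bmeas (fun x => h (Z x)).
  by move=> [mh [C hC]]; split; [exact: measurableT_comp|exists C].
pose good h := bmeas h /\ \int[P]_(x in setT) (g x * h (Z x)) =
    \int[P]_(x in setT) g x * \int[P]_(x in setT) h (Z x).
have goodD h k : good h -> good k -> good (fun y => h y + k y).
  move=> [bh eh] [bk ek]; split; first exact: bmeasD.
  under eq_Rintegral do rewrite mulrDr.
  by rewrite !expectD ?mulrDr ?eh ?ek //; try (apply: bmeasM => //); exact: bZ.
have goodZ c h : good h -> good (fun y => c * h y).
  move=> [bh eh]; split; first exact: bmeasZ.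
  under eq_Rintegral do rewrite mulrCA.
  rewrite (expectZ P c (bmeasM bg (bZ _ _ bh))) (expectZ P c (bZ _ _ bh)) eh.
  exact: mulrCA.
have good_indic B : measurable B -> good (\1_B).
  by move=> mB; split; [exact: bmeas_indic|exact: gZ].
have good1 c : good (fun=> c).
  have -> : (fun=> c) = (fun y => c * \1_(setT : set T2) y).
    by apply/funext => y; rewrite indicT mulr1.
  exact/goodZ/good_indic.
have good_sum n (F : nat -> T2 -> R) : (forall k, good (F k)) -> good (fun y => \sum_(k < n) F k y).
  move=> gF; elim: n => [|n ih]; first by under eq_fun do rewrite big_ord0; exact: good1.
  by under eq_fun do rewrite big_ord_recr /=; exact: goodD.
have good01 h : bmeas h -> (forall y, 0 <= h y <= 1) -> good h.
  move=> bh h01; split=> //.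
  pose s n y : R := \sum_(k < n.+1) n.+1%:R^-1 * \1_[set y | k.+1%:R / n.+1%:R <= h y] y.
  have sE n y : s n y = \sum_(k < n.+1) n.+1%:R^-1 * (k.+1%:R / n.+1%:R <= h y)%R%:R.
    apply: eq_bigr => k _; rewrite indicE.
    suff -> : (y \in [set y0 | k.+1%:R / n.+1%:R <= h y0]) = (k.+1%:R / n.+1%:R <= h y) by [].
    by apply/idP/idP; rewrite inE.
  have sh y : s n y @[n --> \oo] --> h y.
    by under eq_fun do rewrite sE; exact: layer_sum_cvg.
  have gs n : good (s n).
    apply: (good_sum _ (fun k y => n.+1%:R^-1 * \1_[set y | k.+1%:R / n.+1%:R <= h y] y)) => k; apply: goodZ; apply: good_indic.
    have := proj1 bh measurableT `[k.+1%:R / n.+1%:R, +oo[%classic (measurable_itv _).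
    by rewrite setTI; congr measurable; apply/seteqP; split=> y /=; rewrite in_itv /= andbT.
  have s1 n y : `|s n y| <= 1.
    rewrite sE; apply: le_trans (ler_norm_sum _ _ _) _.
    apply: (@le_trans _ _ (\sum_(k < n.+1) n.+1%:R^-1 : R)).
      apply: ler_sum => k _; rewrite normrM ger0_norm ?invr_ge0 //.
      by case: (_ <= h y); rewrite ?normr1 ?normr0 ?mulr1 ?mulr0.
    by rewrite sumr_const card_ord -(mulr_natr n.+1%:R^-1) mulVf.
  have [C gC] := proj2 bg.
  have c1 : \int[P]_(x in setT) (g x * s n (Z x)) @[n --> \oo] -->
            \int[P]_(x in setT) (g x * h (Z x)).
    apply: (@expect_cvg _ _ _ _ _ _ C).
    - move=> n; exact: (proj1 (bmeasM bg (bZ _ _ (proj1 (gs n))))).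
    - move=> n x; rewrite normrM -[C]mulr1; exact: ler_pM.
    - by move=> x; apply: cvgMr; exact: sh.
  have c2 : \int[P]_(x in setT) g x * \int[P]_(x in setT) s n (Z x) @[n --> \oo] -->
            \int[P]_(x in setT) g x * \int[P]_(x in setT) h (Z x).
    apply: cvgMr; apply: (@expect_cvg _ _ _ _ _ _ 1) => //.
    - move=> n; exact: (proj1 (bZ _ _ (proj1 (gs n)))).
  apply: (cvg_unique _ c1) => //.
  have -> : (fun n => \int[P]_(x in setT) (g x * s n (Z x))) =
    fun n => \int[P]_(x in setT) g x * \int[P]_(x in setT) s n (Z x).
    by apply/funext => n; exact: (proj2 (gs n)).
  exact: c2.
move=> [mf [C fC]].
(* An affine rescaling puts the values of [f] in [[0, 1]], where the layer sums apply. *)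
pose D := `|C| + 1.
have D0 : 0 < D by rewrite ltr_wpDl.
suff [] : good f by [].
have -> : f = (fun y => (2 * D) * ((2 * D)^-1 * (f y + D)) + - D).
  by apply/funext => y; field; rewrite gt_eqF.
apply: goodD; last exact: good1.
apply/goodZ/good01.
  apply: bmeasZ; apply: bmeasD; last exact: bmeas_cst.
  by split=> //; exists C.
move=> y; have := fC y; have := ler_norm C; rewrite ler_norml => hC /andP[h1 h2].
rewrite mulrC ler_pdivlMr ?ler_pdivrMr ?mulr_gt0 // mul0r /D; lra.
Qed.

End image_and_independence.

Section complex_expectation.
Context {R : realType} {d : measure_display} {T : measurableType d}.
Implicit Types (f g : T -> R[i]).

Lemma complex_ext (x y : R[i]) :
  complex.Re x = complex.Re y -> complex.Im x = complex.Im y -> x = y.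
Proof. by case: x y => [a b] [c e] /= -> ->. Qed.

Lemma complex_Re_mul (x y : R[i]) :
  complex.Re (x * y) = complex.Re x * complex.Re y - complex.Im x * complex.Im y.
Proof. by case: x y => [a b] [c e]. Qed.

Lemma complex_Im_mul (x y : R[i]) :
  complex.Im (x * y) = complex.Re x * complex.Im y + complex.Im x * complex.Re y.
Proof. by case: x y => [a b] [c e]. Qed.

Lemma complex_Re_opp (x : R[i]) : complex.Re (- x) = - complex.Re x.
Proof. by case: x. Qed.

Lemma complex_Im_opp (x : R[i]) : complex.Im (- x) = - complex.Im x.
Proof. by case: x. Qed.

Lemma complex_Re_sum (I : Type) (r : seq I) (F : I -> R[i]) :
  complex.Re (\sum_(i <- r) F i) = \sum_(i <- r) complex.Re (F i).
Proof. by apply: big_morph => //; case=> [a b] [c e]. Qed.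

Lemma complex_Im_sum (I : Type) (r : seq I) (F : I -> R[i]) :
  complex.Im (\sum_(i <- r) F i) = \sum_(i <- r) complex.Im (F i).
Proof. by apply: big_morph => //; case=> [a b] [c e]. Qed.

Definition cbmeas f :=
  bmeas (fun x => complex.Re (f x)) /\ bmeas (fun x => complex.Im (f x)).

Lemma cbmeasM f g : cbmeas f -> cbmeas g -> cbmeas (fun x => f x * g x).
Proof.
move=> [rf jf] [rg jg]; split.
  under eq_fun do rewrite complex_Re_mul.
  by apply: bmeasB; exact: bmeasM.
under eq_fun do rewrite complex_Im_mul.
by apply: bmeasD; exact: bmeasM.
Qed.

Lemma cbmeas_real (h : T -> R) : bmeas h -> cbmeas (fun x => (h x)%:C%C).
Proof. by move=> bh; split => //=; exact: bmeas_cst. Qed.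

Lemma cbmeas_cst (c : R[i]) : cbmeas (fun=> c).
Proof. by split; exact: bmeas_cst. Qed.

Lemma cbmeas_prod (I : eqType) (r : seq I) (p : pred I) (F : I -> T -> R[i]) :
  (forall i, p i -> cbmeas (F i)) -> cbmeas (fun x => \prod_(i <- r | p i) F i x).
Proof.
move=> bF; elim: r => [|i r ih].
  by under eq_fun do rewrite big_nil; exact: cbmeas_cst.
under eq_fun do rewrite big_cons.
by have [pi|//] := boolP (p i); apply: cbmeasM => //; exact: bF.
Qed.

Variable P : probability T R.
Local Notation E f := (Cintegral P setT f).

Lemma cexpect_cst (c : R[i]) : E (fun=> c) = c.
Proof. by apply: complex_ext => /=; exact: expect_cst. Qed.

Lemma cexpect_mul f g : cbmeas f -> cbmeas g -> E (fun x => f x * g x) =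
  ((\int[P]_(x in setT) (complex.Re (f x) * complex.Re (g x)) -
    \int[P]_(x in setT) (complex.Im (f x) * complex.Im (g x))) +i*
   (\int[P]_(x in setT) (complex.Re (f x) * complex.Im (g x)) +
    \int[P]_(x in setT) (complex.Im (f x) * complex.Re (g x))))%C.
Proof.
move=> [rf jf] [rg jg]; apply: complex_ext => /=.
  by under eq_Rintegral do rewrite complex_Re_mul; rewrite expectB //; exact: bmeasM.
by under eq_Rintegral do rewrite complex_Im_mul; rewrite expectD //; exact: bmeasM.
Qed.

End complex_expectation.

Section complex_independence.
Context {R : realType} {d1 d2 : measure_display} {T1 : measurableType d1} {T2 : measurableType d2}.
Variable (P : probability T1 R).
Local Notation E f := (Cintegral P setT f).
Local Notation ind B := (fun y : T2 => (\1_B y)%:C%C : R[i]).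

Lemma cbmeas_compZ (Z : T1 -> T2) (f : T2 -> R[i]) :
  measurable_fun setT Z -> cbmeas f -> cbmeas (fun x => f (Z x)).
Proof.
move=> mZ [[mr [C rC]] [mi [D iD]]]; split; split.
- exact: (measurableT_comp mr).
- by exists C.
- exact: (measurableT_comp mi).
- by exists D.
Qed.

Lemma cbmeas_ind B : measurable B -> cbmeas (ind B).
Proof. by move=> mB; apply: cbmeas_real; exact: bmeas_indic. Qed.

Lemma cexpect_indep (g : T1 -> R[i]) (Z : T1 -> T2) (f : T2 -> R[i]) :
  cbmeas g -> measurable_fun setT Z ->
  (forall B, measurable B -> E (fun x => g x * ind B (Z x)) = E g * E (fun x => ind B (Z x))) ->
  cbmeas f ->
  E (fun x => g x * f (Z x)) = E g * E (fun x => f (Z x)).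
Proof.
move=> bg mZ gZ bf.
have [rg jg] := bg; have [rf jf] := bf.
have zero (h : T1 -> R) : \int[P]_(x in setT) (h x * 0) = 0.
  by under eq_Rintegral do rewrite mulr0; exact: expect_cst.
have iR B : measurable B -> \int[P]_(x in setT) (complex.Re (g x) * \1_B (Z x)) =
    \int[P]_(x in setT) complex.Re (g x) * \int[P]_(x in setT) \1_B (Z x).
  move=> mB; have := gZ B mB; rewrite cexpect_mul //; last exact: (cbmeas_compZ (f := ind B) mZ (cbmeas_ind mB)).
  by move=> /(congr1 (@complex.Re R)) /=; rewrite !zero expect_cst mulr0 !subr0.
have iI B : measurable B -> \int[P]_(x in setT) (complex.Im (g x) * \1_B (Z x)) =
    \int[P]_(x in setT) complex.Im (g x) * \int[P]_(x in setT) \1_B (Z x).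
  move=> mB; have := gZ B mB; rewrite cexpect_mul //; last exact: (cbmeas_compZ (f := ind B) mZ (cbmeas_ind mB)).
  by move=> /(congr1 (@complex.Im R)) /=; rewrite !zero expect_cst mulr0 !add0r.
rewrite cexpect_mul //; last exact: cbmeas_compZ.
apply: complex_ext => /=.
  by rewrite (expect_indep rg mZ iR rf) (expect_indep jg mZ iI jf).
by rewrite (expect_indep rg mZ iR jf) (expect_indep jg mZ iI rf).
Qed.

(* Indicators are exchanged for the functions [f i] one factor at a time. *)
Lemma cexpect_prod_indep (n : nat) (Z : nat -> T1 -> T2) (f : nat -> T2 -> R[i]) :
  (forall i, (i < n)%N -> measurable_fun setT (Z i)) ->
  (forall B : nat -> set T2, (forall i, (i < n)%N -> measurable (B i)) ->
    P [set w | forall i, (i < n)%N -> B i (Z i w)] =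
    (\prod_(i < n) P [set w | B i (Z i w)])%E) ->
  (forall i, cbmeas (f i)) ->
  E (fun w => \prod_(i < n) f i (Z i w)) = \prod_(i < n) E (fun w => f i (Z i w)).
Proof.
move=> mZ hP bf.
(* Hybrid product: the first [k] factors carry [f i], the others indicators. The induction on [k]
   quantifies over all [B]. *)
pose F k (B : nat -> set T2) i w := if (i < k)%N then f i (Z i w) else ind (B i) (Z i w).
have bF k B i : (forall i, (i < n)%N -> measurable (B i)) -> (i < n)%N -> cbmeas (F k B i).
  move=> mB ltin; rewrite /F; case: (i < k)%N; first exact: (cbmeas_compZ (mZ _ ltin)).
  exact: (cbmeas_compZ (f := ind (B i)) (mZ _ ltin) (cbmeas_ind (mB _ ltin))).
suff claim k : (k <= n)%N -> forall B : nat -> set T2, (forall i, (i < n)%N -> measurable (B i)) ->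
    E (fun w => \prod_(i < n) F k B i w) = \prod_(i < n) E (F k B i).
  have := claim n (leqnn n) (fun=> setT) (fun _ _ => measurableT).
  have FE (i : 'I_n) : F n (fun=> setT) i = fun w => f i (Z i w).
    by apply/funext => w; rewrite /F ltn_ord.
  under [in X in _ = X -> _]eq_bigr do rewrite FE.
  by under [in X in Cintegral _ _ X]eq_fun do under eq_bigr do rewrite FE.
elim: k => [_|k ih kn] B mB.
  pose S := [set w | forall i, (i < n)%N -> B i (Z i w)].
  have mpre i : (i < n)%N -> measurable [set w | B i (Z i w)].
    by move=> ltin; have := mZ _ ltin measurableT _ (mB _ ltin); rewrite setTI.
  have mS : measurable S.
    have -> : S = \bigcap_(i in `I_n) [set w | B i (Z i w)] by [].
    by apply: fin_bigcap_measurable => // i; exact: mpre.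
  have Eind A : measurable A -> E (fun w => (\1_A w)%:C%C : R[i]) = (fine (P A))%:C%C.
    by move=> mA; apply: complex_ext => /=; [exact: expect_indic|exact: expect_cst].
  have -> : (fun w => \prod_(i < n) F 0%N B i w) = fun w => (\1_S w)%:C%C.
    apply/funext => w; have [Sw|nSw] := pselect (S w).
      by rewrite indicE mem_set // big1 // => i _; rewrite /F /= indicE mem_set //; exact: Sw.
    rewrite indicE memNset //; move/existsNP: nSw => [i /not_implyP[ltin nB]].
    by rewrite (bigD1 (Ordinal ltin)) //= /F /= indicE memNset // mul0r.
  rewrite Eind //; have := hP B mB; rewrite -/S => ->.
  have -> : (\prod_(i < n) P [set w | B i (Z i w)] = (\prod_(i < n) fine (P [set w | B i (Z i w)]))%:E)%E.
    rewrite -prodEFin; apply: eq_bigr => i _; rewrite fineK // fin_num_measure //; exact: mpre.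
  rewrite /= (rmorph_prod (real_complex R)); apply: eq_bigr => i _.
  exact: (esym (Eind _ (mpre _ (ltn_ord i)))).
(* Slot [k] receives an arbitrary test set [A]. The induction hypothesis for [upd A] shows that the
   product [G] of the other factors is uncorrelated with every indicator of [Z k], which is what
   [cexpect_indep] asks for. *)
pose upd A i := if i == k then A else B i.
have mupd A : measurable A -> forall i, (i < n)%N -> measurable (upd A i).
  by move=> mA i ltin; rewrite /upd; case: eqP => // _; exact: mB.
pose k' := Ordinal kn.
pose G w := \prod_(i < n | i != k') F k.+1 B i w.
have Fneq A (i : 'I_n) : i != k' -> F k (upd A) i = F k.+1 B i.
  move=> ik; have ik' : (i : nat) != k by [].
  have lt_ik : (i < k.+1)%N = (i < k)%N by rewrite ltnS leq_eqVlt (negbTE ik').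
  by apply/funext => w; rewrite /F /upd lt_ik (negbTE ik').
have prodF A w : \prod_(i < n) F k (upd A) i w = G w * ind A (Z k w).
  rewrite (bigD1 k') //= mulrC; congr (_ * _).
    by apply: eq_bigr => i ik; rewrite Fneq.
  by rewrite /F /upd ltnn eqxx.
have bG : cbmeas G by apply: cbmeas_prod => i _; exact: bF.
have ihA A : measurable A -> E (fun w => G w * ind A (Z k w)) =
    E (fun w => ind A (Z k w)) * \prod_(i < n | i != k') E (F k.+1 B i).
  move=> mA; have := ih (ltnW kn) _ (mupd A mA).
  have -> : (fun w => \prod_(i < n) F k (upd A) i w) = (fun w => G w * ind A (Z k w)).
    by apply/funext => w; exact: prodF.
  move=> ->; rewrite (bigD1 k') //=; congr (_ * _).
    by congr (Cintegral _ _); apply/funext => w; rewrite /F /upd ltnn eqxx.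
  by apply: eq_bigr => i ik; rewrite Fneq.
(* The choice [A = setT] neutralizes slot [k] and evaluates the mean of [G]. *)
have EG : E G = \prod_(i < n | i != k') E (F k.+1 B i).
  have := ihA setT measurableT.
  have -> : (fun w => G w * ind setT (Z k w)) = G.
    by apply/funext => w; rewrite indicT mulr1.
  move=> ->; have -> : (fun w => ind setT (Z k w)) = fun=> 1.
    by apply/funext => w; rewrite indicT.
  by rewrite cexpect_cst mul1r.
have -> : (fun w => \prod_(i < n) F k.+1 B i w) = (fun w => G w * f k (Z k w)).
  apply/funext => w; rewrite (bigD1 k') //= mulrC; congr (_ * _).
  by rewrite /F ltnSn.
rewrite (cexpect_indep bG (mZ _ kn)) //; last by move=> A mA; rewrite ihA // EG mulrC.
rewrite EG [RHS](bigD1 k') //= [RHS]mulrC; congr (_ * _).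
by congr (Cintegral _ _); apply/funext => w; rewrite /F ltnSn.
Qed.

End complex_independence.

(** * The complex exponential and continuous logarithms *)

Section complex_exponential.
Context {R : realType}.
Implicit Types z u : R[i].

Lemma cexp_imag (y : R) : cexp (0 +i* y)%C = (cos y +i* sin y)%C.
Proof. by rewrite /cexp /= expR0 !mul1r. Qed.

Lemma cexpD z u : cexp (z + u) = cexp z * cexp u.
Proof.
case: z u => [a b] [c e]; apply: complex_ext; rewrite /cexp /= expRD ?cosD ?sinD; ring.
Qed.

Lemma cexp0 : cexp (0 : R[i]) = 1.
Proof. by rewrite (_ : (0 : R[i]) = (0 +i* 0)%C) // cexp_imag cos0 sin0. Qed.

Lemma cexp_sum (I : Type) (r : seq I) (F : I -> R[i]) :
  cexp (\sum_(i <- r) F i) = \prod_(i <- r) cexp (F i).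
Proof. by apply: big_morph; [exact: cexpD|exact: cexp0]. Qed.

Lemma cexp_eq z u : cexp z = cexp u ->
  complex.Re z = complex.Re u /\ cos (complex.Im z - complex.Im u) = 1.
Proof.
case: z u => [a b] [c e]; rewrite /cexp /= => -[h1 h2].
have sq (x y : R) : (expR x * cos y) ^+ 2 + (expR x * sin y) ^+ 2 = expR x ^+ 2.
  by rewrite !exprMn -mulrDr cos2Dsin2 mulr1.
have h : expR a = expR c.
  apply/eqP; rewrite -(@eqrXn2 _ 2) ?expR_ge0 //; apply/eqP.
  by rewrite -(sq a b) -(sq c e) h1 h2.
have ac := expR_inj h; split=> //.
have ec : expR c != 0 by rewrite gt_eqF // expR_gt0.
rewrite ac in h1 h2.
by rewrite cosB (mulfI ec h1) (mulfI ec h2) -!expr2 cos2Dsin2.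
Qed.

(** Otherwise, up to sign, the intermediate value theorem makes [p] reach [min (p 1) pi], a point of
    []0, pi]], where the cosine is not 1. *)
Lemma continuous_cos_eq1 (p : R -> R) : {within `[0, 1], continuous p} -> p 0 = 0 ->
  (forall t, 0 <= t <= 1 -> cos (p t) = 1) -> p 1 = 0.
Proof.
wlog p1 : p / 0 <= p 1.
  move=> W cp p0 hp; have [|p1] := leP 0 (p 1); first by move=> p1; exact: W.
  apply/eqP; rewrite -oppr_eq0; apply/eqP.
  apply: (W (fun t => - p t)); first by rewrite oppr_ge0 ltW.
  - by move=> t; apply: continuousN; exact: cp.
  - by rewrite p0 oppr0.
  - by move=> t /hp; rewrite cosN.
move=> cp p0 hp.
have pi0 := @pi_gt0 R.
have [|t] := @IVT R p 0 1 (Num.min (p 1) pi) ler01 cp.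
  rewrite p0 (min_idPl p1) (max_idPr p1); apply/andP; split.
    by rewrite le_min p1 ltW.
  by rewrite ge_min lexx.
rewrite in_itv /= => t01 pt.
have m0 : Num.min (p 1) pi = 0.
  apply: cos_inj.
  - by rewrite in_itv /= le_min p1 ltW //= ge_min lexx orbT.
  - by rewrite in_itv /= lexx ltW.
  - by rewrite -pt cos0; exact: hp.
by move: m0; rewrite minElt; case: ifP => // _ e; rewrite e ltxx in pi0.
Qed.

(** Comparing moduli settles the real parts; the difference of the imaginary parts is continuous,
    starts at 0 and always has cosine 1. *)
Lemma continuous_log_uniq (f g : R -> R[i]) :
  continuousC f -> continuousC g -> f 0 = g 0 ->
  (forall t, cexp (f t) = cexp (g t)) -> f 1 = g 1.
Proof.
move=> [cf cf'] [cg cg'] fg0 fg.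
apply: complex_ext; first by have [] := cexp_eq (fg 1).
apply/eqP; rewrite -subr_eq0; apply/eqP.
apply: (continuous_cos_eq1 (p := fun t => complex.Im (f t) - complex.Im (g t))).
- apply: continuous_subspaceT => t.
  by apply: continuousB; [exact: cf'|exact: cg'].
- by rewrite fg0 subrr.
- by move=> t _; have [] := cexp_eq (fg t).
Qed.

Lemma cbmeas_cexp {d : measure_display} {T : measurableType d} (U : T -> R) : measurable_fun setT U ->
  cbmeas (fun w => cexp (0 +i* U w)%C).
Proof.
move=> mU; under eq_fun do rewrite cexp_imag.
by split => /=; [exact: bmeas_cos|exact: bmeas_sin].
Qed.

Context {d : measure_display} {T : measurableType d} (P : probability T R).
Local Notation E f := (Cintegral P setT f).

Lemma char_fun_image (V : hilbertType R) (m : probability (borel V) R) (X : T -> V) a :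
  measurable_fun setT (X : T -> borel V) -> is_image P (X : T -> borel V) m ->
  char_fun m a = E (fun w => cexp (0 +i* '[X w, a])%C).
Proof.
move=> mX im; rewrite /char_fun.
have [bR bI] := cbmeas_cexp (hdot_borel_measurable a).
by apply: complex_ext => /=; rewrite (expect_image mX im).
Qed.

(** Dominated convergence on one side and continuity of [cexp] on the other: only the exponents
    remain to be compared in the limit. *)
Lemma cexpect_cexp_cvg (U_ : nat -> T -> R) (U : T -> R) (z_ : nat -> R[i]) (z : R[i]) :
  (forall n, measurable_fun setT (U_ n)) ->
  (forall w, U_ n w @[n --> \oo] --> U w) ->
  (forall n, E (fun w => cexp (0 +i* U_ n w)%C) = cexp (z_ n)) ->
  complex.Re (z_ n) @[n --> \oo] --> complex.Re z ->
  complex.Im (z_ n) @[n --> \oo] --> complex.Im z ->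
  E (fun w => cexp (0 +i* U w)%C) = cexp z.
Proof.
move=> mU UU Ez zR zI.
have eR : expR (complex.Re (z_ n)) @[n --> \oo] --> expR (complex.Re z).
  exact: (cvg_continuous (f := @expR R) (@continuous_expR R)).
have rhsR : complex.Re (cexp (z_ n)) @[n --> \oo] --> complex.Re (cexp z).
  by apply: cvgM eR _; exact: (cvg_continuous (f := @cos R) (@continuous_cos R)).
have rhsI : complex.Im (cexp (z_ n)) @[n --> \oo] --> complex.Im (cexp z).
  by apply: cvgM eR _; exact: (cvg_continuous (f := @sin R) (@continuous_sin R)).
have lhsR : complex.Re (E (fun w => cexp (0 +i* U_ n w)%C)) @[n --> \oo] -->
            complex.Re (E (fun w => cexp (0 +i* U w)%C)).
  apply: (@expect_cvg _ _ _ _ _ _ 1).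
  - by move=> n; have [[]] := cbmeas_cexp (mU n).
  - by move=> n w; rewrite cexp_imag /= ler_norml cos_geN1 cos_le1.
  - move=> w; rewrite cexp_imag /=.
    have -> : (fun n => complex.Re (cexp (0 +i* U_ n w)%C)) = fun n => cos (U_ n w).
      by apply/funext => n; rewrite cexp_imag.
    exact: (cvg_continuous (f := @cos R) (@continuous_cos R)).
have lhsI : complex.Im (E (fun w => cexp (0 +i* U_ n w)%C)) @[n --> \oo] -->
            complex.Im (E (fun w => cexp (0 +i* U w)%C)).
  apply: (@expect_cvg _ _ _ _ _ _ 1).
  - by move=> n; have [_ []] := cbmeas_cexp (mU n).
  - by move=> n w; rewrite cexp_imag /= ler_norml sin_geN1 sin_le1.
  - move=> w; rewrite cexp_imag /=.
    have -> : (fun n => complex.Im (cexp (0 +i* U_ n w)%C)) = fun n => sin (U_ n w).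
      by apply/funext => n; rewrite cexp_imag.
    exact: (cvg_continuous (f := @sin R) (@continuous_sin R)).
have ER : (fun n => complex.Re (E (fun w => cexp (0 +i* U_ n w)%C))) = fun n => complex.Re (cexp (z_ n)).
  by apply/funext => n; rewrite Ez.
have EI : (fun n => complex.Im (E (fun w => cexp (0 +i* U_ n w)%C))) = fun n => complex.Im (cexp (z_ n)).
  by apply/funext => n; rewrite Ez.
apply: complex_ext; [apply: (cvg_unique _ lhsR)|apply: (cvg_unique _ lhsI)] => //.
  by rewrite ER.
by rewrite EI.
Qed.

End complex_exponential.

(** * The driven integral *)

(** One-sided limits bound the path near each point and compactness of [[0, t]] makes the bound
    uniform; in the covering argument the filter at infinity supplies the common bound. *)
Lemma cadlag_bounded {R : realType} {V : hilbertType R} (y : R -> V) (t : R) :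
  cadlag y -> exists2 M, 0 <= M & forall s, 0 <= s <= t -> `|y s| <= M.
Proof.
move=> [yr yl].
have bnd (F : set_system R) (FF : ProperFilter F) (l : V) :
    y s @[s --> F] --> l -> \forall s \near F, `|y s| < `|l| + 1.
  move=> /cvgrPdist_lt /(_ _ (@ltr01 R)); apply: filterS => s h.
  rewrite -ltrBlDl; apply: le_lt_trans h.
  by rewrite distrC; exact: lerB_dist.
have loc (s : R) : 0 <= s -> exists M : R, \forall u \near s, 0 <= u -> `|y u| <= M.
  move=> s0.
  have [L HL] : exists L : R, \forall u \near s, u < s -> 0 <= u -> `|y u| <= L.
    have [sp|sn] := ltP 0 s.
      have := yl _ sp; set l := lim _ => hl.
      have hb : \forall u \near s, u < s -> `|y u| < `|l| + 1 by exact: bnd hl.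
      by exists (`|l| + 1); apply: filterS hb => u h us _; exact/ltW/h.
    (* At [s = 0] no nonnegative point lies to the left, so any bound will do. *)
    by exists 0; apply: (@nearW _ (nbhs s)) => u us u0; move: (le_lt_trans u0 us); rewrite ltNge sn.
  have Hr : \forall u \near s, s < u -> `|y u| <= `|y s| + 1.
    have hb : \forall u \near s, s < u -> `|y u| < `|y s| + 1 by exact: (bnd _ _ _ (yr _ s0)).
    by apply: filterS hb => u h us; exact/ltW/h.
  exists (Num.max L (`|y s| + 1)); apply: filterS2 HL Hr => u hl hr u0.
  rewrite le_max; case: (ltgtP u s) => [us|su|->].
  - by rewrite hl.
  - by rewrite hr // orbT.
  - by rewrite lerDl ler01 orbT.
have /compact_near_coveringP cov := @segment_compact R 0 t.
have [|M HM] := @filter_ex _ (pinfty_nbhs R) _ _ (cov R (pinfty_nbhs R) (fun M u => 0 <= u -> `|y u| <= M) _ _).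
  move=> s; rewrite /= in_itv /= => /andP[s0 _].
  have [M hM] := loc s s0.
  near=> u N => /= u0; apply: (@le_trans _ _ M).
    by apply: (near hM u).
  near: N; apply: nbhs_pinfty_ge; exact: num_real.
exists (Num.max 0 M); first by rewrite le_max lexx.
move=> s /andP[s0 st]; rewrite le_max HM ?orbT //= in_itv /= s0 st //.
Unshelve. all: by end_near. Qed.

(** * Riemann sums *)

Section riemann_sums.
Context {R : realType}.
Local Notation mu := (@lebesgue_measure R).
Variable t : R.
Hypothesis t0 : 0 < t.
Local Notation h n := (t / n.+1%:R).

Lemma mesh_gt0 n : 0 < h n.
Proof. by rewrite divr_gt0. Qed.

Lemma mesh_cvg : h n @[n --> \oo] --> (0 : R).
Proof. by rewrite -(mulr0 t); apply: cvgMr; exact: cvgn_inv_nat. Qed.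

Lemma mesh_mul n : n.+1%:R * h n = t.
Proof. by rewrite mulrC divfK // pnatr_eq0. Qed.

Lemma next_le n x : 0 <= x < t -> 0 <= next (h n) x <= t.
Proof.
move=> /andP[x0 xt]; have h0 := mesh_gt0 n; have /andP[h1 h2] := next_gt h0 x0.
rewrite (le_trans x0 (ltW h1)) /= /next -[leRHS](mesh_mul n) ler_pM2r // ler_nat.
by rewrite -trunc_lt // mesh_mul.
Qed.

Lemma cell_sub_itv n i : (i < n.+1)%N -> cell (h n) i `<=` `[0, t[%classic.
Proof.
move=> ltin x /[dup] /(cell_ge0 (mesh_gt0 n)) x0; rewrite /cell /= !in_itv /= x0 /= => /andP[_ xi].
apply: lt_le_trans xi _; rewrite -[leRHS](mesh_mul n) ler_pM2r ?mesh_gt0 // ler_nat //.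
Qed.

Lemma riemann_sum_cvg (g : R -> R) : continuous g ->
  \sum_(i < n.+1) h n * g (t - i%:R * h n) @[n --> \oo] --> \int[mu]_(x in `]0, t[) g x.
Proof.
move=> cg.
have m0t : measurable (`[0, t[%classic : set (measurableTypeR R)) by exact: measurable_itv.
have gint : mu.-integrable `[0, t] (EFin \o g).
  apply: continuous_compact_integrable; first exact: segment_compact.
  exact: continuous_subspaceT.
have gint' : mu.-integrable `]0, t[ (EFin \o g).
  by apply: integrableS gint => //; apply: subset_itv; rewrite bnd_simp.
rewrite (@Rintegral_itv_obnd_cbnd _ 0 (BLeft t)) //.
pose s n := stepf (h n) n.+1 (fun i => g (i.+1%:R * h n)).
have -> : (fun n => \sum_(i < n.+1) h n * g (t - i%:R * h n)) =
    fun n => \int[mu]_(x in `[0, t[) s n x.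
  apply/funext => n; rewrite stepf_Rintegral ?mesh_gt0 //; last exact: cell_sub_itv.
  (* Reversing the index turns [t - i h] into the right end [(i + 1) h] of a cell, because
     [t = (n + 1) h]. *)
  rewrite (reindex_inj rev_ord_inj) /=; apply: eq_bigr => i _; congr (_ * g _).
  rewrite -[X in X - _](mesh_mul n) -mulrBl -natrB ?leq_subr //.
  by rewrite subKn.
have [M M0 HM] : exists2 M, 0 <= M & forall x, 0 <= x <= t -> `|g x| <= M.
  have [c _ hc] := EVT_max (ltW t0) (continuous_subspaceT (fun x => continuous_comp (cg x) (@norm_continuous R R^o (g x)))).
  by exists `|g c| => // x xt; apply: hc; rewrite in_itv.
have [|||||_ _ //] := @Rdominated_convergence _ _ _ mu `[0, t[ s g (fun=> M).
- by [].
- move=> n; apply: measurable_funTS; exact: stepf_measurable (mesh_gt0 n).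
- move=> x; rewrite /= in_itv /= => /andP[x0 xt].
  have -> : (fun n => s n x) = fun n => g (next (h n) x).
    by apply/funext => n; rewrite /s (stepf_next g) ?mesh_gt0 // mesh_mul.
  have cnx : next (h n) x @[n --> \oo] --> x.
    apply: cvg_trans (next_cvg _ x0 _) _; [exact: mesh_gt0|exact: mesh_cvg|].
    exact: cvg_within.
  exact: (cvg_continuous cg cnx).
- apply: (bounded_integrable (C := M)) => //.
  + by rewrite [X in (X < _)%E]lebesgue_measure_itv /= lte_fin t0 -EFinB ltry.
  + by move=> x _; rewrite ger0_norm.
- move=> n x; rewrite /= in_itv /= => /andP[x0 xt].
  rewrite /s (stepf_next g) ?mesh_gt0 ?mesh_mul //.
  by apply: HM; apply: next_le; rewrite x0.
Qed.

End riemann_sums.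

(** Applied with [u i = Y (i h)] and [c i = theta (t - i h)]: the boundary term pairs [Y t] with
    [theta 0], which is the pairing of [iota (Y t)] with [a]. *)
Lemma abel_sum {R : realType} {V : hilbertType R} (u c : nat -> V) (n : nat) : u 0%N = 0 ->
  '[u n, c n] + \sum_(i < n) ('[u i.+1, c i] - '[u i.+1, c i.+1]) =
  \sum_(i < n) '[u i.+1 - u i, c i].
Proof.
move=> u0; elim: n => [|n ih]; first by rewrite !big_ord0 u0 hdot0l addr0.
by rewrite !big_ord_recr /= -ih hdotBl; ring.
Qed.

Section path_integral.
Context {R : realType} {Ht Hb : hilbertType R}.
Variables (iota : {linear Ht -> Hb}) (Tb : R -> {linear Hb -> Hb}) (c0 b0 : R).
Local Notation gen x := (generator Tb (iota x)).
Local Notation quot h x := (h^-1 *: (Tb h (iota x) - iota x)).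
Hypotheses (c0_ge0 : 0 <= c0) (b0_ge0 : 0 <= b0)
  (C0Tb : C0_semigroup Tb) (growthTb : growth_bound Tb c0 b0)
  (gen_cvg : forall x, quot h x @[h --> 0^'+] --> gen x)
  (Tb_lipschitz : forall tau, 0 <= tau -> exists2 K, 0 <= K & forall r s x,
    0 <= r -> r <= s -> s <= tau ->
    `|Tb s (iota x) - Tb r (iota x)| <= K * (s - r) * `|x|).

Local Notation lambda := (@lebesgue_measure R).

Lemma quotB (h : R) x y : quot h (x - y) = quot h x - quot h y.
Proof.
rewrite (linearB iota x y) (linearB (Tb h)) /=.
by apply: hdot_inj => v; rewrite !(hdotZl, hdotBl); ring.
Qed.

Lemma quot_le (tau : R) : 0 <= tau -> exists2 K, 0 <= K &
  forall h x, 0 < h <= tau -> `|quot h x| <= K * `|x|.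
Proof.
move=> tau0; have [K K0 HK] := Tb_lipschitz tau0; exists K => // h x /andP[h0 ht].
have [S0 _ _ _] := C0Tb.
rewrite normrZ gtr0_norm ?invr_gt0 // ler_pdivrMl //.
have := HK 0 h x (lexx _) (ltW h0) ht; rewrite S0 subr0; move/le_trans; apply.
by rewrite mulrAC mulrC.
Qed.

Lemma growth_le (r t : R) z : 0 <= r <= t -> `|Tb r z| <= c0 * expR (b0 * t) * `|z|.
Proof.
move=> /andP[r0 rt]; apply: le_trans (growthTb _ r0) _.
by rewrite ler_wpM2r // ler_wpM2l // ler_expR ler_wpM2l.
Qed.

(** Three quantities move together: the step [h n], the sample [s n] and the remaining time
    [t - s n]. The uniform bounds [quot_le] and [growth_le] allow the limits to be taken one at a
    time. *)
Lemma quot_path_cvg (h s : nat -> R) (t x : R) (y : R -> Ht) :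
  (forall n, 0 < h n <= t) -> h n @[n --> \oo] --> 0 ->
  (forall n, 0 <= s n <= t) -> s n @[n --> \oo] --> x -> x <= t ->
  y (s n) @[n --> \oo] --> y x ->
  Tb (t - s n) (quot (h n) (y (s n))) @[n --> \oo] --> Tb (t - x) (gen (y x)).
Proof.
move=> hh h0 st sx xt ysx.
have t0 : 0 <= t by have /andP[/le_trans h1 /h1] := st 0%N.
have [K K0 HK] := quot_le t0.
have q1 : quot (h n) (y x) @[n --> \oo] --> gen (y x).
  have hr : h n @[n --> \oo] --> (0 : R)^'+.
    move=> U U0; have : \forall n \near \oo, 0 < h n -> U (h n) by exact: (h0 _ U0).
    by apply: filterS => n; apply; have /andP[] := hh n.
  exact: (cvg_comp h (fun h => quot h (y x)) hr (@gen_cvg (y x))).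
have q2 : quot (h n) (y (s n)) @[n --> \oo] --> gen (y x).
  have -> : (fun n => quot (h n) (y (s n))) = fun n => quot (h n) (y (s n) - y x) + quot (h n) (y x).
    by apply/funext => n; rewrite quotB subrK.
  rewrite -[X in _ --> X]add0r; apply: cvgD q1.
  apply: (cvg_norm_le0 (e := fun n => K * `|y (s n) - y x|)).
    by apply: nearW => n; rewrite subr0; exact: HK.
  rewrite -(mulr0 K); apply: cvgMr; rewrite -(@normr0 _ Ht) -(subrr (y x)); apply: cvg_norm.
  by apply: cvgB => //; exact: cvg_cst.
have q3 : Tb (t - s n) (gen (y x)) @[n --> \oo] --> Tb (t - x) (gen (y x)).
  apply: (C0_cvg c0_ge0 b0_ge0 C0Tb growthTb).
  - by apply: nearW => n; rewrite subr_ge0; have /andP[] := st n.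
  - by rewrite subr_ge0.
  - by apply: cvgB => //; exact: cvg_cst.
have -> : (fun n => Tb (t - s n) (quot (h n) (y (s n)))) = fun n =>
    Tb (t - s n) (quot (h n) (y (s n)) - gen (y x)) + Tb (t - s n) (gen (y x)).
  by apply/funext => n; rewrite -linearD subrK.
rewrite -[X in _ --> X]add0r; apply: cvgD q3.
apply: (cvg_norm_le0 (e := fun n => c0 * expR (b0 * t) * `|quot (h n) (y (s n)) - gen (y x)|)).
  apply: nearW => n; rewrite subr0; apply: growth_le.
  by have /andP[s0 s1] := st n; rewrite subr_ge0 s1 lerBlDr lerDl.
rewrite -(mulr0 (c0 * expR (b0 * t))); apply: cvgMr.
rewrite -(@normr0 _ Hb) -(subrr (gen (y x))); apply: cvg_norm.
by apply: cvgB => //; exact: cvg_cst.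
Qed.

(** With the generator replaced by the quotient of step [h n], frozen at the right end of each cell,
    the cell width cancels the divisor and the semigroup law leaves a difference of two values of
    [Tb]. *)
Lemma bochner_path_cvg (y : R -> Ht) (t : R) (a : Hb) : 0 < t -> cadlag y ->
  \sum_(i < n.+1) '[Tb (t - i%:R * (t / n.+1%:R)) (iota (y (i.+1%:R * (t / n.+1%:R)))) -
      Tb (t - i.+1%:R * (t / n.+1%:R)) (iota (y (i.+1%:R * (t / n.+1%:R)))), a] @[n --> \oo] -->
  '[bochner lambda `[0, t] (fun s => Tb (t - s) (gen (y s))), a].
Proof.
move=> t0 cy; have [S0 SD _ _] := C0Tb.
have m0t : measurable (`[0, t[%classic : set (measurableTypeR R)) by exact: measurable_itv.
have m0t' : measurable (`[0, t]%classic : set (measurableTypeR R)) by exact: measurable_itv.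
pose f s := Tb (t - s) (gen (y s)).
pose h n : R := t / n.+1%:R.
have h0 n : 0 < h n by exact: mesh_gt0.
have ht n : 0 < h n <= t.
  by rewrite h0 /= /h ler_pdivrMr // ler_peMr ?ler1n // ltW.
pose F n r := Tb (t - r) (quot (h n) (y r)).
(* The extra cell beyond [t] makes the step functions converge at the endpoint
   as well. *)
pose c n i := if (i < n.+1)%N then F n (i.+1%:R * h n) else f t.
pose s n := stepf (h n) n.+2 (c n).
have sF n x : 0 <= x < t -> s n x = F n (next (h n) x).
  move=> /andP[x0 xt].
  have trn : (Num.truncn (x / h n) < n.+1)%N by rewrite -trunc_lt // mesh_mul.
  by rewrite /s /stepf x0 trunc_lt // (ltn_trans trn) // /c trn.
have st n : s n t = f t.
  have trn : Num.truncn (t / h n) = n.+1.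
    by rewrite /h invf_div mulrC divfK ?gt_eqF // natrK.
  by rewrite /s /stepf (ltW t0) trunc_lt ?(ltW t0) // trn ltnSn /c ltnn.
have [M M0 yM] := cadlag_bounded t cy.
have [K K0 HK] := quot_le (ltW t0).
pose C := c0 * expR (b0 * t) * (K * M).
have C0 : 0 <= C by rewrite !mulr_ge0 // expR_ge0.
have FC n r : 0 <= r <= t -> `|F n r| <= C.
  move=> /andP[r0 rt]; apply: le_trans (growth_le _ (_ : 0 <= t - r <= t)) _.
    by rewrite subr_ge0 rt lerBlDr lerDl.
  rewrite ler_wpM2l ?mulr_ge0 ?expR_ge0 //; apply: le_trans (HK _ _ (ht n)) _.
  by rewrite ler_wpM2l // yM // r0.
have sf x : `[0, t]%classic x -> s n x @[n --> \oo] --> f x.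
  rewrite /= in_itv /= => /andP[x0]; rewrite le_eqVlt => /orP[/eqP ->|xt].
    by have -> : s^~ t = fun=> f t; [apply/funext => n; exact: st|exact: cvg_cst].
  have -> : (fun n => s n x) = fun n => F n (next (h n) x).
    by apply/funext => n; rewrite sF // x0.
  have nx : next (h n) x @[n --> \oo] --> x^'+.
    by apply: next_cvg => //; exact: mesh_cvg.
  apply: quot_path_cvg => //.
  - exact: mesh_cvg.
  - by move=> n; apply: next_le; rewrite // x0.
  - by apply: cvg_trans nx _; exact: cvg_within.
  - exact: ltW.
  - by apply: (cvg_comp _ y nx); have [+ _] := cy; apply.
have sC n x : `[0, t]%classic x -> `|s n x| <= C + `|f t|.
  rewrite /= in_itv /= => /andP[x0]; rewrite le_eqVlt => /orP[/eqP ->|xt].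
    by rewrite st lerDr.
  by rewrite sF ?x0 // ler_wpDr // FC // next_le // x0.
have Cint : lambda.-integrable `[0, t] (EFin \o (fun=> C + `|f t|)).
  apply: (bounded_integrable (C := C + `|f t|)) => //.
    by rewrite [X in (X < _)%E]lebesgue_measure_itv /= lte_fin t0 -EFinB ltry.
  by move=> x _; rewrite ger0_norm // addr_ge0.
have ss n : simple_integrable lambda `[0, t] (s n) by apply: stepf_simple.
have [_ ->] := bochner_dominated m0t' ss sf Cint sC a.
have sa n x : '[s n x, a] = stepf (h n) n.+2 (fun i => '[c n i, a]) x by exact: stepf_hdot.
have saC n x : `[0, t]%classic x -> `|'[s n x, a]| <= (C + `|f t|) * `|a|.
  by move=> xt; apply: le_trans (hdot_CauchySchwarz _ _) _; rewrite ler_wpM2r // sC.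
have mD : lebesgue_measure (`[0, t] : set R) = t%:E.
  by rewrite lebesgue_measure_itv /= lte_fin t0 -EFinB subr0.
have msa n : measurable_fun setT ((fun x => '[s n x, a]) : measurableTypeR R -> R).
  by under eq_fun do rewrite sa; exact: stepf_measurable.
have saint n : lambda.-integrable `[0, t] (EFin \o (fun x => '[s n x, a])).
  apply: (bounded_integrable m0t' _ _ (saC n)); first by rewrite [X in (X < _)%E]mD ltry.
  exact: measurable_funTS.
have Ca : lambda.-integrable `[0, t] (EFin \o (fun=> (C + `|f t|) * `|a|)).
  apply: (bounded_integrable (C := (C + `|f t|) * `|a|)) => //.
    by rewrite [X in (X < _)%E]mD ltry.
  by move=> x _; rewrite ger0_norm // mulr_ge0 // addr_ge0.
have [||||_ _ lim_s] := @Rdominated_convergence _ _ _ lambda `[0, t] (fun n x => '[s n x, a])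
    (fun x => '[f x, a]) (fun=> (C + `|f t|) * `|a|) m0t'.
- by move=> n; exact: measurable_funTS.
- by move=> x xt; apply: cvg_hdotl; exact: sf.
- by [].
- exact: saC.
suff E n : \int[lambda]_(x in `[0, t]) '[s n x, a] =
    \sum_(i < n.+1) '[Tb (t - i%:R * h n) (iota (y (i.+1%:R * h n))) -
      Tb (t - i.+1%:R * h n) (iota (y (i.+1%:R * h n))), a].
  by move: lim_s; under eq_fun do rewrite E.
(* Dropping the null endpoint [t] discards the extra cell; whole cells remain. *)
rewrite -(Rintegral_itv_bndo_bndc (a := BLeft 0)); last first.
  by apply: integrableS (saint n) => //; apply: subset_itv; rewrite bnd_simp.
have -> : \int[lambda]_(x in `[0, t[) '[s n x, a] =
    \int[lambda]_(x in `[0, t[) stepf (h n) n.+1 (fun i => '[F n (i.+1%:R * h n), a]) x.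
  apply: eq_Rintegral => x; rewrite inE /= in_itv /= => xt.
  rewrite (stepf_next (fun r => '[F n r, a])) ?sF ?mesh_mul //; by have /andP[] := xt.
rewrite stepf_Rintegral //; last exact: cell_sub_itv.
apply: eq_bigr => i _; rewrite /F; set z := iota (y _).
have ih : i.+1%:R * h n <= t.
  by rewrite -[leRHS](mesh_mul t n) ler_pM2r // ler_nat.
rewrite linearZ linearB /= -SD ?(ltW (h0 n)) ?subr_ge0 //.
have -> : t - i.+1%:R * h n + h n = t - i%:R * h n by rewrite -natr1; ring.
by rewrite hdotZl mulrA mulfV ?mul1r // gt_eqF.
Qed.

End path_integral.

Lemma comp_continuousC {R : realType} {S T : topologicalType} (g : S -> T) (f : T -> R[i]) :
  continuous g -> continuousC f -> continuousC (fun x => f (g x)).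
Proof.
move=> cg [fr fi]; split=> x.
  exact: (@continuous_comp _ _ _ g (fun y => complex.Re (f y)) x (cg x) (fr (g x))).
exact: (@continuous_comp _ _ _ g (fun y => complex.Im (f y)) x (cg x) (fi (g x))).
Qed.

Lemma opp_continuousC {R : realType} {S : topologicalType} (f : S -> R[i]) :
  continuousC f -> continuousC (fun x => - f x).
Proof.
move=> [fr fi]; split=> x.
  by under eq_fun do rewrite complex_Re_opp; apply: continuousN; exact: fr.
by under eq_fun do rewrite complex_Im_opp; apply: continuousN; exact: fi.
Qed.

Lemma dist_max0 {R : realDomainType} (x y : R) : `|Num.max 0 x - Num.max 0 y| <= `|x - y|.
Proof.
wlog xy : x y / y <= x.
  by move=> W; case: (leP y x) => [/W//|/ltW/W]; rewrite distrC (distrC y).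
rewrite (ger0_norm (_ : 0 <= x - y)) ?subr_ge0 // ger0_norm ?subr_ge0.
  by case: (leP 0 x); case: (leP 0 y); lra.
by rewrite ge_max !le_max lexx /= xy orbT.
Qed.

(** * Characteristic functional of the noise term *)

Section mild_solution.
Context {R : realType} {Ht Hb : hilbertType R}.
Variables (iota : {linear Ht -> Hb}) (Tb : R -> {linear Hb -> Hb}) (c0 b0 : R).
Local Notation gen x := (generator Tb (iota x)).
Hypotheses (c0_ge0 : 0 <= c0) (b0_ge0 : 0 <= b0)
  (C0Tb : C0_semigroup Tb) (growthTb : growth_bound Tb c0 b0)
  (iota_le : exists2 C, 0 <= C & forall x, `|iota x| <= C * `|x|)
  (gen_cvg : forall x, h^-1 *: (Tb h (iota x) - iota x) @[h --> 0^'+] --> gen x)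
  (Tb_lipschitz : forall tau, 0 <= tau -> exists2 K, 0 <= K & forall r s x,
    0 <= r -> r <= s -> s <= tau ->
    `|Tb s (iota x) - Tb r (iota x)| <= K * (s - r) * `|x|).

(** [theta] is built at the positive part of [s], which makes it continuous on the whole line, as
    [riemann_sum_cvg] requires. Continuity in norm holds because the Lipschitz bound is uniform over
    the unit ball. *)
Lemma adjoint_path (a : Hb) : exists2 theta : R -> Ht, continuous theta &
  forall s x, 0 <= s -> '[Tb s (iota x), a] = '[x, theta s].
Proof.
have [C C0 HC] := iota_le.
have ex s : exists z, forall x, '[Tb (Num.max 0 s) (iota x), a] = '[x, z].
  have m0 : 0 <= Num.max 0 s by rewrite le_max lexx.
  apply: (@riesz_representation _ _ _ (c0 * expR (b0 * Num.max 0 s) * C * `|a|)).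
  - by move=> x y; rewrite !linearD /= hdotDl.
  - by move=> c x; rewrite !linearZ /= hdotZl.
  - move=> x; apply: le_trans (hdot_CauchySchwarz _ _) _; rewrite mulrAC ler_wpM2r //.
    apply: le_trans (growthTb _ m0) _; rewrite -[leRHS]mulrA ler_wpM2l //.
    by rewrite mulr_ge0 // expR_ge0.
have [theta H] := choice ex.
exists theta; last by move=> s x s0; rewrite -H (max_idPr s0).
move=> s0; pose tau := Num.max 0 s0 + 1.
have tau0 : 0 <= tau by rewrite addr_ge0 // le_max lexx.
have [K K0 HK] := Tb_lipschitz tau0.
have HK' r s x : 0 <= r <= tau -> 0 <= s <= tau ->
    `|Tb s (iota x) - Tb r (iota x)| <= K * `|s - r| * `|x|.
  wlog rs : r s / r <= s.
    by move=> W r0 s00; case: (leP r s) => [/W|/ltW/W W']; [exact|rewrite distrC (distrC s); exact: W'].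
  by move=> /andP[r0 _] /andP[_ st]; rewrite (ger0_norm (_ : 0 <= s - r)) ?subr_ge0 // HK.
apply: (cvg_norm_le0 (e := fun s => K * `|a| * `|s - s0|)).
  near=> s; apply: norm_le_hdot => [|v]; first by rewrite !mulr_ge0.
  rewrite hdotBl (hdotC (theta s)) (hdotC (theta s0)) -!H -hdotBl.
  apply: le_trans (ler_norm _) _; apply: le_trans (hdot_CauchySchwarz _ _) _.
  have s1 : `|s - s0| <= 1.
    by near: s; exists 1 => //= z; rewrite /ball_ /= distrC => /ltW.
  have smax : `|Num.max 0 s - Num.max 0 s0| <= `|s - s0| by exact: dist_max0.
  have stau : 0 <= Num.max 0 s <= tau.
    rewrite le_max lexx /= /tau; move: smax s1; rewrite ler_norml => /andP[_ h1] h2; lra.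
  have s0tau : 0 <= Num.max 0 s0 <= tau by rewrite /tau le_max lexx /= lerDl.
  rewrite [leRHS](_ : _ = K * `|s - s0| * `|v| * `|a|); last by ring.
  rewrite ler_wpM2r //; apply: le_trans (HK' _ _ _ s0tau stau) _.
  by rewrite ler_wpM2r // ler_wpM2l.
have h : K * `|a| * `|s - s0| @[s --> s0] --> K * `|a| * `|s0 - s0|.
  by apply: cvgMr; apply: cvg_norm; apply: cvgB; [exact: cvg_id|exact: cvg_cst].
by rewrite subrr normr0 mulr0 in h.
Unshelve. all: by end_near. Qed.

Context {d : measure_display} {Om : measurableType d}.
Variables (P : probability Om R) (gamma : R -> probability (borel Ht) R) (psi0 : Ht -> R[i])
  (Y : R -> Om -> Ht).
Hypotheses (psi0_cont : continuousC psi0)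
  (gammaE : forall t a, 0 <= t -> char_fun (gamma t) a = cexp (- ((t +i* 0)%C * psi0 a)))
  (Y_cadlag : forall w, cadlag (Y ^~ w)) (Y_0 : forall w, Y 0 w = 0)
  (Y_indep : independent_increments P Y)
  (Y_law : forall r t, 0 <= r -> r <= t ->
    has_law P ((fun w => Y t w - Y r w) : Om -> borel Ht) (gamma (t - r))).

Local Notation lambda := (@lebesgue_measure R).
Local Notation E f := (Cintegral P setT f).
Local Notation noise t w := (iota (Y t w) +
  bochner lambda `[0, t] (fun s => Tb (t - s) (gen (Y s w)))).

Lemma increment_measurable (r s : R) (a : Ht) : 0 <= r <= s ->
  measurable_fun setT (fun w => '[Y s w - Y r w, a]).
Proof.
move=> /andP[r0 rs]; have [mY _] := Y_law r0 rs.
exact: (measurableT_comp (hdot_borel_measurable a) mY).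
Qed.

Lemma increments_char_fun (h : R) (n : nat) (c : nat -> Ht) : 0 < h ->
  E (fun w => cexp (0 +i* (\sum_(i < n) '[Y (i.+1%:R * h) w - Y (i%:R * h) w, c i]))%C) =
  cexp (- \sum_(i < n) (h +i* 0)%C * psi0 (c i)).
Proof.
move=> h0.
have gr i : i%:R * h <= i.+1%:R * h by rewrite ler_pM2r // ler_nat.
have g0 i : 0 <= i%:R * h by rewrite mulr_ge0 // ltW.
pose Z i w : borel Ht := Y (i.+1%:R * h) w - Y (i%:R * h) w.
pose f i (x : borel Ht) : R[i] := cexp (0 +i* '[x : Ht, c i])%C.
have -> : (fun w => cexp (0 +i* (\sum_(i < n) '[Y (i.+1%:R * h) w - Y (i%:R * h) w, c i]))%C) =
    fun w => \prod_(i < n) f i (Z i w).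
  apply/funext => w; rewrite -cexp_sum; congr cexp.
  elim/big_rec2 : _ => // i x z _ <-; by apply: complex_ext => /=; rewrite ?addr0.
have mZ i : measurable_fun setT (Z i) by have [] := Y_law (g0 i) (gr i).
rewrite (cexpect_prod_indep (fun i _ => mZ i)); first last.
- by move=> i; apply: cbmeas_cexp; exact: hdot_borel_measurable.
- move=> B mB; apply: (Y_indep (t := fun i => i%:R * h)) => //.
rewrite -sumrN cexp_sum; apply: eq_bigr => i _.
have [_ im] := Y_law (g0 i) (gr i).
rewrite /f -(char_fun_image (c i) (mZ i) im) gammaE ?subr_ge0 //.
by rewrite -mulrBl -natrB // subSnn mul1r.
Qed.

Lemma noise_sum_cvg (theta : R -> Ht) (a : Hb) (t : R) w : 0 < t ->
  (forall s x, 0 <= s -> '[Tb s (iota x), a] = '[x, theta s]) ->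
  \sum_(i < n.+1) '[Y (i.+1%:R * (t / n.+1%:R)) w - Y (i%:R * (t / n.+1%:R)) w,
      theta (t - i%:R * (t / n.+1%:R))] @[n --> \oo] --> '[noise t w, a].
Proof.
move=> t0 H; rewrite hdotDl.
have [S0 _ _ _] := C0Tb.
have := bochner_path_cvg c0_ge0 b0_ge0 C0Tb growthTb gen_cvg Tb_lipschitz (a := a) t0 (Y_cadlag w).
move=> /(cvgD (cvg_cst '[iota (Y t w), a])).
set u := (X in X @ _ --> _ -> _); set v := (X in _ -> X @ _ --> _).
suff -> : u = v by [].
apply/funext => n; rewrite /u /v /=; set h := t / n.+1%:R.
have hn : n.+1%:R * h = t by exact: mesh_mul.
have h0 : 0 < h by exact: mesh_gt0.
have hi i : (i <= n.+1)%N -> 0 <= t - i%:R * h.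
  by move=> ltin; rewrite subr_ge0 -[leRHS]hn ler_pM2r // ler_nat.
rewrite -(@abel_sum _ _ (fun i => Y (i%:R * h) w) (fun i => theta (t - i%:R * h)) n.+1); last first.
  by rewrite mul0r Y_0.
rewrite hn -H ?subrr // S0; congr (_ + _).
apply: eq_bigr => i _; rewrite hdotBl !H ?hi // ltnW //.
Qed.

(** The grid argument needs [t > 0]. At [t = 0] the domain is one null point, on which any integrand
    agrees with a constant. *)
Lemma bochner_point (V : hilbertType R) (f : R -> V) : bochner lambda `[0%R, 0%R] f = 0.
Proof.
have m00 : measurable (`[0, 0]%classic : set (measurableTypeR R)) by exact: measurable_itv.
have mu0 : lambda (`[0, 0]%classic : set R) = 0%E by rewrite set_itv1 lebesgue_measure_set1.
have ss : simple_integrable lambda `[0, 0] (fun=> f 0).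
  split.
  - by apply: (@sub_finite_set _ _ [set f 0]); [move=> _ [x _ <-]|exact: finite_set1].
  - move=> v; rewrite preimage_cst; case: ifP => _; exact: measurableT || exact: measurable0.
  - move=> v _; apply: (@le_lt_trans _ _ (lambda (`[0, 0]%classic : set R))); last by rewrite mu0.
    apply: le_measure; rewrite ?inE //; apply: measurableI => //.
    by rewrite preimage_cst; case: ifP => _; [exact: measurableT|exact: measurable0].
have f0 x : `[0, 0]%classic x -> f x = f 0.
  by rewrite /= in_itv /= => /le_anti <-.
have W : is_weak_integral lambda `[0, 0] f (bochner lambda `[0, 0] f).
  apply: (bochner_dominated m00 (s := fun _ _ => f 0) (g := fun=> `|f 0|)) => //.
    by move=> x /f0 ->; exact: cvg_cst.
  apply: (bounded_integrable (C := `|f 0|)) => //; first by rewrite [X in (X < _)%E]mu0.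
  by move=> x _; rewrite normr_id.
by apply: hdot_inj => a; rewrite hdot0l (proj2 (W a)) set_itv1 Rintegral_set1.
Qed.

Lemma noise0 w : noise 0 w = 0.
Proof. by rewrite Y_0 linear0 add0r bochner_point. Qed.

(** Inherited from the finite sums of increments, which converge to the pairing for every [w]. *)
Lemma noise_hdot_measurable (t : R) (a : Hb) : 0 <= t ->
  measurable_fun setT (fun w => '[noise t w, a]).
Proof.
rewrite le_eqVlt => /orP[/eqP <-|t0].
  by under eq_fun do rewrite noise0 hdot0l; exact: measurable_cst.
have [theta _ H] := adjoint_path a.
pose U n w := \sum_(i < n.+1) '[Y (i.+1%:R * (t / n.+1%:R)) w - Y (i%:R * (t / n.+1%:R)) w,
      theta (t - i%:R * (t / n.+1%:R))].
apply: (@measurable_fun_cvg _ _ _ _ U) => [n|w _]; last exact: noise_sum_cvg.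
apply: measurable_sum => i; apply: increment_measurable.
have h0 := ltW (mesh_gt0 t0 n).
by rewrite mulr_ge0 //= ler_wpM2r // ler_nat.
Qed.

Lemma noise_char_fun (theta : R -> Ht) (a : Hb) (t : R) : 0 <= t -> continuous theta ->
  (forall s x, 0 <= s -> '[Tb s (iota x), a] = '[x, theta s]) ->
  E (fun w => cexp (0 +i* '[noise t w, a])%C) =
  cexp (- Cintegral lambda `]0, t[ (fun s => psi0 (theta s))).
Proof.
rewrite le_eqVlt => /orP[/eqP <-|t0] ct H.
  rewrite (_ : (fun w => _) = fun=> 1); last first.
    by apply/funext => w; rewrite noise0 hdot0l -[RHS]cexp0.
  rewrite cexpect_cst /Cintegral set_itvoo0 !Rintegral_set0 -[LHS]cexp0; congr cexp.
  by apply: complex_ext; rewrite /= oppr0.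
have [cr ci] := comp_continuousC ct psi0_cont.
pose h n : R := t / n.+1%:R.
apply: (@cexpect_cexp_cvg _ _ _ P
  (fun n w => \sum_(i < n.+1) '[Y (i.+1%:R * h n) w - Y (i%:R * h n) w, theta (t - i%:R * h n)])
  _ (fun n => - \sum_(i < n.+1) (h n +i* 0)%C * psi0 (theta (t - i%:R * h n)))).
- move=> n; apply: measurable_sum => i; apply: increment_measurable.
  have h0 := ltW (mesh_gt0 t0 n).
  by rewrite mulr_ge0 //= ler_wpM2r // ler_nat.
- by move=> w; exact: noise_sum_cvg.
- by move=> n; exact: (increments_char_fun n.+1 (fun i => theta (t - i%:R * h n)) (mesh_gt0 t0 n)).
- have -> : (fun n => complex.Re (- \sum_(i < n.+1) (h n +i* 0)%C * psi0 (theta (t - i%:R * h n)))) =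
      fun n => - \sum_(i < n.+1) h n * complex.Re (psi0 (theta (t - i%:R * h n))).
    apply/funext => n; rewrite complex_Re_opp complex_Re_sum; congr (- _).
    by apply: eq_bigr => i _; rewrite complex_Re_mul mul0r subr0.
  by apply: cvgN; exact: (riemann_sum_cvg t0 cr).
- have -> : (fun n => complex.Im (- \sum_(i < n.+1) (h n +i* 0)%C * psi0 (theta (t - i%:R * h n)))) =
      fun n => - \sum_(i < n.+1) h n * complex.Im (psi0 (theta (t - i%:R * h n))).
    apply/funext => n; rewrite complex_Im_opp complex_Im_sum; congr (- _).
    by apply: eq_bigr => i _; rewrite complex_Im_mul mul0r addr0.
  by apply: cvgN; exact: (riemann_sum_cvg t0 ci).
Qed.

End mild_solution.

(** * The law of the solution *)

Lemma continuous_scale_to {R : realType} {V : normedModType R} (c : V) :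
  continuous (fun t : R => t *: c).
Proof. by move=> t; apply: cvgZ; [exact: cvg_id|exact: cvg_cst]. Qed.

(** Along the rays [t w] and [t v] both exponents are continuous logarithms of the same function of
    [t] and vanish at [t = 0]; hence they agree at [t = 1]. *)
Lemma exponent_uniq {R : realType} {V W : hilbertType R} (m : probability (borel V) R)
    (f : V -> R[i]) (g : W -> R[i]) (v : V) (w : W) (L : V -> W) :
  continuousC f -> continuousC g -> f 0 = 0 -> g 0 = 0 ->
  (forall a, char_fun m a = cexp (- f a)) ->
  (forall a, cexp (- g a) = Cintegral m setT (fun x : V => cexp (0 +i* '[L x, a])%C)) ->
  (forall x, '[L x, w] = '[x, v]) -> g w = f v.
Proof.
move=> cf cg f0 g0 mf mg Lwv.
apply: oppr_inj; rewrite -[w]scale1r -[v]scale1r.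
apply: (continuous_log_uniq (f := fun t : R => - g (t *: w)) (g := fun t : R => - f (t *: v))).
- by apply: opp_continuousC; exact: (comp_continuousC (continuous_scale_to (c := w)) cg).
- by apply: opp_continuousC; exact: (comp_continuousC (continuous_scale_to (c := v)) cf).
- by rewrite !scale0r f0 g0.
- move=> t; rewrite -mf mg /char_fun; congr (Cintegral _ _); apply/funext => x.
  by rewrite !hdotZr Lwv.
Qed.

Section laws.
Context {R : realType} {d : measure_display} {Om : measurableType d} (P : probability Om R).
Context {V : hilbertType R}.
Hypothesis sepV : separable V.

Lemma law_of_char_fun (m : probability (borel V) R) (Z : Om -> V) :
  (forall a, measurable_fun setT (fun w => '[Z w, a])) ->
  (forall a, Cintegral P setT (fun w => cexp (0 +i* '[Z w, a])%C) = char_fun m a) ->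
  has_law P (Z : Om -> borel V) m.
Proof.
move=> mZa Zm; have mZ := hdot_measurableP sepV mZa.
split=> // B mB.
pose Z' : {mfun Om >-> borel V} := mfun_Sub (mem_set mZ : (Z : Om -> borel V) \in mfun).
have im : is_image P (Z : Om -> borel V) (distribution P Z') by [].
rewrite (@char_fun_inj _ _ m (distribution P Z') sepV) // => a.
by rewrite (char_fun_image a mZ im) Zm.
Qed.

Lemma translate_measurable (z : V) :
  measurable_fun setT ((fun y : V => z + y) : borel V -> borel V).
Proof.
apply: continuous_borelT_measurable => y.
by apply: cvgD; [exact: cvg_cst|exact: cvg_id].
Qed.

Lemma mehler_kernelE (S : R -> {linear V -> V}) (mu : R -> probability (borel V) R) t x
    (B : set (borel V)) : measurable B ->
  mehler_kernel S mu t x B = mu t [set y : borel V | B (S t x + (y : V))].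
Proof.
move=> mB; rewrite /mehler_kernel /mehler.
have mA : measurable [set y : borel V | B (S t x + (y : V))].
  by have := translate_measurable (S t x) measurableT mB; rewrite setTI.
rewrite (_ : \int[mu t]_y _ = fine (mu t [set y : borel V | B (S t x + (y : V))])).
  by rewrite fineK // fin_num_measure.
by rewrite -expect_indic //; apply: eq_Rintegral => y _; rewrite !indicE.
Qed.

Lemma mehler_law (S : R -> {linear V -> V}) (mu : R -> probability (borel V) R) t x (Z : Om -> V) :
  has_law P (Z : Om -> borel V) (mu t) ->
  has_law P ((fun w => S t x + Z w) : Om -> borel V) (mehler_kernel S mu t x).
Proof.
move=> [mZ im]; have mT := translate_measurable (S t x).
split; first exact: (measurableT_comp mT mZ).
move=> B mB; rewrite mehler_kernelE // im //.
by have := mT measurableT _ mB; rewrite setTI.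
Qed.

End laws.

Lemma bounded_linear_range_measurable {R : realType} {V W : hilbertType R} (L : V -> W) (C : R) :
  (forall x y, L (x + y) = L x + L y) -> (forall c x, L (c *: x) = c *: L x) ->
  (forall x, `|L x| <= C * `|x|) -> measurable (range L : set (borel W)).
Proof.
move=> LD LZ LC.
have -> : range L = \bigcup_n [set L x | x in [set x : V | `|x| <= n%:R]].
  apply/seteqP; split=> [_ [x _ <-]|_ [n _ [x _ <-]]]; last by exists x.
  exists (Num.truncn `|x|).+1 => //; exists x => //=.
  by apply: ltW; have /truncn_itv/andP[] := normr_ge0 x.
apply: bigcup_measurable => n _; rewrite -[X in measurable X]setCK; apply: measurableC.
apply: sub_sigma_algebra; apply: closed_openC; exact: closed_image_ball LC.
Qed.

Theorem lemma4p3 (R : realType)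
  (* the semigroup on H *)
  (H : hilbertType R) (T : R -> {linear H -> H}) (c0 b0 b alpha : R)
  (sepH : separable H)
  (c0_ge0 : 0 <= c0) (b0_ge0 : 0 <= b0) (b0_lt_b : b0 < b)
  (b0_lt_alpha : b0 < alpha)
  (C0T : C0_semigroup T) (growthT : growth_bound T c0 b0)
  (* the entrance space, the embedding J and the shift semigroup *)
  (Ht : hilbertType R) (ev : Ht -> R -> H) (evP : is_entrance_space T b ev)
  (J : H -> Ht) (JE : forall x s, 0 < s -> ev (J x) s = T s x)
  (Tt : R -> Ht -> Ht)
  (TtE : forall t x s, 0 <= t -> 0 < s -> ev (Tt t x) s = ev x (t + s))
  (* the completion and the extended semigroup *)
  (Hb : hilbertType R) (iota : {linear Ht -> Hb})
  (iotaP : is_resolvent_completion T b alpha ev iota)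
  (Tb : R -> {linear Hb -> Hb})
  (Tb_cont : forall t, 0 <= t -> continuous (Tb t))
  (TbE : forall t x, 0 <= t -> Tb t (iota x) = iota (Tt t x))
  (* the measure lambda0 and its exponent *)
  (lambda0 : probability (borel Ht) R) (psi0 : Ht -> R[i])
  (lambda0_id : infinitely_divisible lambda0)
  (lambda0_centered : centered lambda0)
  (lambda0_sq : (\int[lambda0]_(x in setT) (`|x : Ht| ^+ 2)%:E < +oo)%E)
  (psi0_cont : continuousC psi0) (psi0_0 : psi0 0 = 0)
  (psi0E : forall a, char_fun lambda0 a = cexp (- psi0 a))
  (* the SC-semigroup on H and its images *)
  (psi : R -> H -> R[i])
  (psi_cont : forall s, 0 < s -> continuousC (psi s))
  (psi_0 : forall s, 0 < s -> psi s 0 = 0)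
  (psiE : forall s a, 0 < s ->
    cexp (- psi s a) =
    Cintegral lambda0 setT (fun x : Ht => cexp (0 +i* '[ev x s, a])%C))
  (mu : R -> probability (borel H) R)
  (mu_SC : SC_semigroup T mu)
  (mu_centered : forall t, 0 <= t -> centered (mu t))
  (muE : forall t a, 0 <= t ->
    char_fun (mu t) a =
    cexp (- Cintegral lebesgue_measure `]0, t[ (fun s => psi s a)))
  (mut : R -> probability (borel Ht) R)
  (mutE : forall t, 0 <= t -> is_image (mu t) (J : borel H -> borel Ht) (mut t))
  (mub : R -> probability (borel Hb) R)
  (mubE : forall t, 0 <= t ->
    is_image (mut t) (iota : borel Ht -> borel Hb) (mub t))
  (* the driving process *)
  (d : measure_display) (Om : measurableType d) (P : probability Om R)
  (gamma : R -> probability (borel Ht) R)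
  (gammaE : forall t a, 0 <= t ->
    char_fun (gamma t) a = cexp (- ((t +i* 0)%C * psi0 a)))
  (Y : R -> Om -> Ht)
  (Y_cadlag : forall w, cadlag (Y ^~ w)) (Y_0 : forall w, Y 0 w = 0)
  (Y_indep : independent_increments P Y)
  (Y_law : forall r t, 0 <= r -> r <= t ->
    has_law P ((fun w => Y t w - Y r w) : Om -> borel Ht) (gamma (t - r)))
  (xb : Hb) :
  let X t w : Hb :=
    Tb t xb + iota (Y t w) +
    bochner lebesgue_measure `[0, t]
      (fun s => Tb (t - s) (generator Tb (iota (Y s w)))) in
  (forall t, 0 <= t ->
     has_law P (X t : Om -> borel Hb) (mehler_kernel Tb mub t xb)) /\
  ((exists x, xb = iota (J x)) ->
     forall t, 0 <= t -> {ae P, forall w, exists x, X t w = iota (J x)}).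
Proof.
move=> X.
have C0Tb : C0_semigroup Tb by apply: (Tb_C0 c0_ge0 b0_ge0 b0_lt_b b0_lt_alpha C0T growthT evP TtE iotaP Tb_cont TbE).
have growthTb : growth_bound Tb c0 b0.
  by apply: (Tb_growth c0_ge0 b0_ge0 b0_lt_b b0_lt_alpha C0T growthT evP TtE iotaP Tb_cont TbE).
have genP := generator_cvg c0_ge0 b0_ge0 b0_lt_b b0_lt_alpha C0T growthT evP TtE iotaP TbE.
have TbK := Tb_increment c0_ge0 b0_ge0 b0_lt_b b0_lt_alpha C0T growthT evP TtE iotaP Tb_cont TbE.
have iotaC := iota_le c0_ge0 b0_ge0 b0_lt_b b0_lt_alpha C0T growthT evP iotaP.
have sepHb : separable Hb.
  by apply: (completion_separable c0_ge0 b0_ge0 b0_lt_b b0_lt_alpha C0T growthT evP TtE iotaP JE sepH).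
have [CJ CJ0 HJ] := J_le c0_ge0 b0_ge0 b0_lt_b C0T growthT evP JE.
have [Ci Ci0 Hi] := iotaC.
have JD := J_D evP JE; have JZ := J_Z evP JE.
have iJ_le x : `|iota (J x)| <= Ci * CJ * `|x|.
  by rewrite -mulrA; apply: le_trans (Hi _) _; rewrite ler_wpM2l.
have iJD x y : iota (J (x + y)) = iota (J x) + iota (J y) by rewrite JD linearD.
have iJZ c x : iota (J (c *: x)) = c *: iota (J x) by rewrite JZ linearZ.
have mJ : measurable_fun setT (J : borel H -> borel Ht).
  apply: continuous_borelT_measurable; apply: (bounded_additive_continuous _ HJ) => x y.
  by rewrite JD -scaleN1r JZ scaleN1r.
have miota : measurable_fun setT (iota : borel Ht -> borel Hb).
  apply: continuous_borelT_measurable; apply: (bounded_additive_continuous _ Hi) => x y.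
  exact: linearB.
have [Tb0 _ _ _] := C0Tb.
(* The random part of [X t] has law [mub t]; translation by the deterministic vector [Tb t xb] will
   give the Mehler kernel. *)
have law0 t : 0 <= t -> has_law P (fun w => iota (Y t w) +
    bochner lebesgue_measure `[0, t] (fun s => Tb (t - s) (generator Tb (iota (Y s w)))) : borel Hb) (mub t).
  move=> t0; apply: law_of_char_fun => // a.
    exact: (noise_hdot_measurable c0_ge0 b0_ge0 C0Tb growthTb iotaC genP TbK Y_cadlag Y_0 Y_law).
  have [theta ct H1] := adjoint_path c0_ge0 growthTb iotaC TbK a.
  rewrite (noise_char_fun c0_ge0 b0_ge0 C0Tb growthTb genP TbK psi0_cont gammaE Y_cadlag Y_0 Y_indep Y_law t0 ct H1).
  (* [theta 0] and [c] pull the functional [a] back to [Ht] and to [H], which reduces the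
     characteristic functional of [mub t] at [a] to that of [mu t] at [c]. *)
  have [c Hc] : exists c, forall x, '[iota (J x), a] = '[x, c].
    apply: (@riesz_representation _ _ _ (Ci * CJ * `|a|)).
    - by move=> x y; rewrite iJD hdotDl.
    - by move=> k x; rewrite iJZ hdotZl.
    - move=> x; apply: le_trans (hdot_CauchySchwarz _ _) _.
      by rewrite mulrAC ler_wpM2r.
  have theta0 x : '[iota x, a] = '[x, theta 0] by rewrite -H1 // Tb0.
  rewrite (char_fun_image a miota (mubE t t0)).
  transitivity (char_fun (mu t) c); last first.
    transitivity (char_fun (mut t) (theta 0)).
      rewrite (char_fun_image (theta 0) mJ (mutE t t0)) /char_fun.
      by congr (Cintegral _ _); apply/funext => x; rewrite -theta0 Hc.
    by rewrite /char_fun; congr (Cintegral _ _); apply/funext => x; rewrite theta0.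
  rewrite muE //; congr (cexp (- _)).
  have psiE' s : s \in `]0, t[%classic -> psi0 (theta s) = psi s c.
    rewrite inE /= in_itv /= => /andP[s0 _].
    apply/esym; apply: (@exponent_uniq _ _ _ lambda0 psi0 (psi s) _ _ (fun x => ev x s)) => //.
    - exact: psi_cont.
    - exact: psi_0.
    - by move=> a'; exact: psiE.
    move=> x.
    by rewrite -Hc (J_ev C0T evP TtE JE) // -TbE ?ltW // H1 // ltW.
  by apply: complex_ext; apply: eq_Rintegral => s /psiE' ->.
have lawX t : 0 <= t -> has_law P (X t : Om -> borel Hb) (mehler_kernel Tb mub t xb).
  move=> t0; have := mehler_law Tb xb (law0 t t0).
  by congr (has_law P _ _); apply/funext => w; rewrite /X addrA.
split=> // -[x xbE] t t0.
pose D : set (borel Hb) := range (fun h => iota (J h)).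
have mD : measurable (~` D) by apply: measurableC; exact: bounded_linear_range_measurable iJ_le.
have [mX imX] := lawX t t0.
exists (X t @^-1` (~` D)); split.
- by have := mX measurableT _ mD; rewrite setTI.
- rewrite -(imX _ mD) mehler_kernelE // mubE //; last first.
    by have := translate_measurable (Tb t xb) measurableT mD; rewrite setTI.
  rewrite mutE //; last first.
    have mA := translate_measurable (Tb t xb) measurableT mD; rewrite setTI in mA.
    by have := miota measurableT _ mA; rewrite setTI.
  (* Pulled back to [H], the exceptional event is the set of [h] with [Tb t xb + iota (J h)] outside
     [D]. It is empty, since this vector is [iota (J (T t x + h))]. *)
  rewrite (_ : J @^-1` _ = set0) ?measure0 // -subset0 => h; apply.
  exists (T t x + h) => //; rewrite iJD xbE TbE //; congr (iota _ + _).
  apply: (ev_inj evP) => s s0; rewrite TtE // !JE // ?ltr_wpDl //.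
  by have [_ TD _ _] := C0T; rewrite addrC TD // ltW.
- move=> w /= nw Dw; apply: nw; have [h _ hw] := Dw.
  by exists h.
Qed.
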